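(* Let $N=2$, let $q\in\mathbb{C}^*$ be such that $q$ is not a root of unity or $q=1$, and let $\xi$ be a diagonal $2\times2$ complex matrix which is not a scalar multiple of any integral power of $\begin{pmatrix}q^2&0\\0&1\end{pmatrix}$. Then both $\beta^\xi$ and $\alpha^\xi$ map $\mathcal{O}(M_q)$ surjectively onto $\mathcal{O}(D\setminus GL_q)$. In particular, $\mathrm{im}(\beta^\xi)=\mathrm{im}(\alpha^\xi)$ is a quantum homogeneous space (i.e. a right coideal subalgebra of $\mathcal{O}(GL_q)$). Moreover, the kernel of $\beta^\xi$ is the right ideal of $\mathcal{O}(M_q)$ generated by $\tau_1-\tau_1(\xi)$ and $\tau_2-\tau_2(\xi)$, and the kernel of $\alpha^\xi$ is the left ideal of $\mathcal{O}(M_q)$ generated by $\sigma_1-\sigma_1(\xi)$ and $\sigma_2-\sigma_2(\xi)$.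
   Context: $\mathcal{O}(M_q)$ (here for $2\times 2$ quantum matrices) is the unital associative $\mathbb{C}$-algebra generated by $x_{11},x_{12},x_{21},x_{22}$ subject to $x_{11}x_{12}=qx_{12}x_{11}$, $x_{21}x_{22}=qx_{22}x_{21}$, $x_{11}x_{21}=qx_{21}x_{11}$, $x_{12}x_{22}=qx_{22}x_{12}$, $x_{12}x_{21}=x_{21}x_{12}$, $x_{11}x_{22}-x_{22}x_{11}=(q-q^{-1})x_{12}x_{21}$. It is a bialgebra with $\Delta(x_{ij})=\sum_k x_{ik}\otimes x_{kj}$, $\varepsilon(x_{ij})=\delta_{ij}$. The quantum determinant $\det_q=x_{11}x_{22}-qx_{12}x_{21}$ is central, and $\mathcal{O}(GL_q)=\mathcal{O}(M_q)[\det_q^{-1}]$ is a Hopf algebra with comultiplication $\Delta$ and antipode $S$ given by $S(x_{11})=x_{22}/\det_q$, $S(x_{22})=x_{11}/\det_q$, $S(x_{12})=-q^{-1}x_{12}/\det_q$, $S(x_{21})=-qx_{21}/\det_q$. In Sweedler notation, define the right coactions $\beta,\alpha:\mathcal{O}(M_q)\to\mathcal{O}(M_q)\otimes\mathcal{O}(GL_q)$ by $\beta(h)=\sum h_2\otimes S(h_1)h_3$ and $\alpha(h)=\sum h_2\otimes h_3S(h_1)$. For a diagonal complex matrix $\xi$, let $\mathrm{ev}_\xi:\mathcal{O}(M_q)\to\mathbb{C}$ be the algebra homomorphism $x_{ij}\mapsto\xi_{ij}$, and write $f(\xi)=\mathrm{ev}_\xi(f)$. The co-orbit maps are the linear maps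 $\beta^\xi=(\mathrm{ev}_\xi\otimes\mathrm{id})\circ\beta$ and $\alpha^\xi=(\mathrm{ev}_\xi\otimes\mathrm{id})\circ\alpha$ from $\mathcal{O}(M_q)$ to $\mathcal{O}(GL_q)$. Set $\tau_1=q^{-2}x_{11}+q^{-4}x_{22}$, $\tau_2=q^{-6}\det_q$, $\sigma_1=x_{11}+x_{22}$, $\sigma_2=\det_q$ (the scalar factor in $\tau_2$ is immaterial). Let $\mathcal{O}(D)=\mathbb{C}[t_1^{\pm1},t_2^{\pm1}]$ with $\Delta(t_i)=t_i\otimes t_i$, let $\pi_D:\mathcal{O}(GL_q)\to\mathcal{O}(D)$ be the Hopf algebra homomorphism $x_{ij}\mapsto\delta_{ij}t_i$, and $\lambda_D=(\pi_D\otimes\mathrm{id})\circ\Delta$. Then $\mathcal{O}(D\setminus GL_q)=\{f\in\mathcal{O}(GL_q)\mid\lambda_D(f)=1\otimes f\}$. A right coideal subalgebra of $\mathcal{O}(GL_q)$ is a subalgebra $B$ with $\Delta(B)\subseteq B\otimes\mathcal{O}(GL_q)$. *)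

(* Defs.v *)
From HB Require Import structures.
From mathcomp Require Import all_boot all_order all_algebra.
From mathcomp Require Import generic_quotient ring.
From mathcomp Require Import boolp classical_sets.

Set Implicit Arguments.
Unset Strict Implicit.
Unset Printing Implicit Defensive.

Import GRing.Theory.

Local Open Scope ring_scope.
Local Open Scope quotient_scope.
Local Open Scope classical_set_scope.

(* Algebras presented by generators and relations.  [pres rel] is the set of
   formal expressions in the generators modulo the smallest congruence that
   contains [rel] and the axioms of unital associative K-algebras; its universal
   property is [pres_homE] and [pres_ext] below. *)

Inductive aexpr (K G : Type) : Type :=
| Gen of G
| ZeroE
| OneE
| OppE of aexpr K G
| AddE of aexpr K G & aexpr K G
| MulE of aexpr K G & aexpr K G
| ScaleE of K & aexpr K G.

Arguments Gen {K G}.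
Arguments ZeroE {K G}.
Arguments OneE {K G}.

Declare Scope aexpr_scope.
Delimit Scope aexpr_scope with E.
Bind Scope aexpr_scope with aexpr.
Notation "0" := ZeroE : aexpr_scope.
Notation "1" := OneE : aexpr_scope.
Notation "- x" := (OppE x) : aexpr_scope.
Notation "x + y" := (AddE x y) : aexpr_scope.
Notation "x - y" := (AddE x (OppE y)) : aexpr_scope.
Notation "x * y" := (MulE x y) : aexpr_scope.
Notation "c *: x" := (ScaleE c x) : aexpr_scope.

HB.instance Definition _ (K G : Type) := gen_eqMixin (aexpr K G).
HB.instance Definition _ (K G : Type) := gen_choiceMixin (aexpr K G).

Section Congruence.
Variables (K : fieldType) (G : Type) (rel : aexpr K G -> aexpr K G -> Prop).

Local Open Scope aexpr_scope.

Inductive acong : aexpr K G -> aexpr K G -> Prop :=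
| ac_rel x y : rel x y -> acong x y
| ac_refl x : acong x x
| ac_sym x y : acong x y -> acong y x
| ac_trans x y z : acong x y -> acong y z -> acong x z
| ac_opp x x' : acong x x' -> acong (- x) (- x')
| ac_add x x' y y' : acong x x' -> acong y y' -> acong (x + y) (x' + y')
| ac_mul x x' y y' : acong x x' -> acong y y' -> acong (x * y) (x' * y')
| ac_scale c x x' : acong x x' -> acong (c *: x) (c *: x')
| ac_addA x y z : acong (x + (y + z)) (x + y + z)
| ac_addC x y : acong (x + y) (y + x)
| ac_add0 x : acong (0 + x) x
| ac_addN x : acong (- x + x) 0
| ac_mulA x y z : acong (x * (y * z)) (x * y * z)
| ac_mul1l x : acong (1 * x) x
| ac_mul1r x : acong (x * 1) x
| ac_mulDl x y z : acong ((x + y) * z) (x * z + y * z)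
| ac_mulDr x y z : acong (x * (y + z)) (x * y + x * z)
| ac_scaleA c d x : acong (c *: (d *: x)) ((c * d)%R *: x)
| ac_scale1 x : acong (1%R *: x) x
| ac_scaleDr c x y : acong (c *: (x + y)) (c *: x + c *: y)
| ac_scaleDl c d x : acong ((c + d)%R *: x) (c *: x + d *: x)
| ac_scaleAl c x y : acong (c *: (x * y)) ((c *: x) * y)
| ac_scaleAr c x y : acong (c *: (x * y)) (x * (c *: y)).

Definition acongb (x y : aexpr K G) := `[< acong x y >].

Lemma acongb_equiv : equiv_class_of acongb.
Proof.
split; first by move=> x; apply/asboolP/ac_refl.
  by move=> x y; apply/asboolP/asboolP => /ac_sym.
by move=> y x z /asboolP xy /asboolP yz; apply/asboolP; apply: ac_trans xy yz.
Qed.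

Canonical acongb_equiv_rel := EquivRelPack acongb_equiv.

Definition pres := {eq_quot acongb}.

HB.instance Definition _ := Choice.on pres.
HB.instance Definition _ := EqQuotient.on pres.

Lemma pres_eqP x y : \pi_pres x = \pi_pres y <-> acong x y.
Proof.
by split=> [/eqP|xy]; [rewrite piE => /asboolP | apply/eqP; rewrite piE; apply/asboolP].
Qed.

Definition pzero : pres := \pi_pres (0)%E.
Definition pone : pres := \pi_pres (1)%E.
Definition popp (u : pres) : pres := \pi_pres (- repr u)%E.
Definition padd (u v : pres) : pres := \pi_pres (repr u + repr v)%E.
Definition pmul (u v : pres) : pres := \pi_pres (repr u * repr v)%E.
Definition pscale c (u : pres) : pres := \pi_pres (c *: repr u)%E.

Lemma reprE x : acong (repr (\pi_pres x)) x.
Proof. by apply/pres_eqP; rewrite reprK. Qed.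

Lemma poppE x : popp (\pi_pres x) = \pi_pres (- x).
Proof. by apply/pres_eqP/ac_opp/reprE. Qed.
Lemma paddE x y : padd (\pi_pres x) (\pi_pres y) = \pi_pres (x + y).
Proof. by apply/pres_eqP/ac_add; apply/reprE. Qed.
Lemma pmulE x y : pmul (\pi_pres x) (\pi_pres y) = \pi_pres (x * y).
Proof. by apply/pres_eqP/ac_mul; apply/reprE. Qed.
Lemma pscaleE c x : pscale c (\pi_pres x) = \pi_pres (c *: x).
Proof. by apply/pres_eqP/ac_scale/reprE. Qed.

Lemma pres_ind (P : pres -> Prop) : (forall x, P (\pi_pres x)) -> forall u, P u.
Proof. by move=> P_pi u; rewrite -[u]reprK. Qed.

Ltac pres_axiom rule :=
  repeat (elim/pres_ind => ?);
  rewrite ?(poppE, paddE, pmulE, pscaleE) -?/pzero; apply/pres_eqP; exact: rule.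

Lemma paddA : associative padd. Proof. pres_axiom ac_addA. Qed.
Lemma paddC : commutative padd. Proof. pres_axiom ac_addC. Qed.
Lemma padd0 : left_id pzero padd. Proof. pres_axiom ac_add0. Qed.
Lemma paddN : left_inverse pzero popp padd. Proof. pres_axiom ac_addN. Qed.
Lemma pmulA : associative pmul. Proof. pres_axiom ac_mulA. Qed.
Lemma pmul1l : left_id pone pmul. Proof. pres_axiom ac_mul1l. Qed.
Lemma pmul1r : right_id pone pmul. Proof. pres_axiom ac_mul1r. Qed.
Lemma pmulDl : left_distributive pmul padd. Proof. pres_axiom ac_mulDl. Qed.
Lemma pmulDr : right_distributive pmul padd. Proof. pres_axiom ac_mulDr. Qed.

HB.instance Definition _ := GRing.isZmodule.Build pres paddA paddC padd0 paddN.
HB.instance Definition _ :=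
  GRing.Zmodule_isPzRing.Build pres pmulA pmul1l pmul1r pmulDl pmulDr.

Lemma pscaleA c d (u : pres) : pscale c (pscale d u) = pscale (c * d)%R u.
Proof. move: c d u; move=> c d; pres_axiom ac_scaleA. Qed.
Lemma pscale1 : left_id 1%R pscale. Proof. pres_axiom ac_scale1. Qed.
Lemma pscaleDr : right_distributive pscale padd.
Proof. move=> c; pres_axiom ac_scaleDr. Qed.
Lemma pscaleDl u : {morph pscale^~ u : c d / (c + d)%R >-> padd c d}.
Proof. move=> c d; move: u; pres_axiom ac_scaleDl. Qed.

HB.instance Definition _ :=
  GRing.Zmodule_isLmodule.Build K pres pscaleA pscale1 pscaleDr pscaleDl.

Lemma pscaleAl (c : K) (u v : pres) : (c *: (u * v) = (c *: u) * v)%R.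
Proof. rewrite /GRing.scale /= /GRing.mul /=; move: u v; pres_axiom ac_scaleAl. Qed.
Lemma pscaleAr (c : K) (u v : pres) : (c *: (u * v) = u * (c *: v))%R.
Proof. rewrite /GRing.scale /= /GRing.mul /=; move: u v; pres_axiom ac_scaleAr. Qed.

Definition pgen (g : G) : pres := \pi_pres (Gen g)%E.

End Congruence.

Section Evaluation.
Variables (K : fieldType) (G : Type) (A : algType K).

Fixpoint aeval (f : G -> A) (x : aexpr K G) : A :=
  match x with
  | Gen g => f g
  | ZeroE => 0
  | OneE => 1
  | OppE x => - aeval f x
  | AddE x y => aeval f x + aeval f y
  | MulE x y => aeval f x * aeval f y
  | ScaleE c x => c *: aeval f x
  end.

Variable rel : aexpr K G -> aexpr K G -> Prop.

Definition respects (f : G -> A) := forall x y, rel x y -> aeval f x = aeval f y.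

Definition pres_hom (f : G -> A) (hf : respects f) (u : pres rel) : A :=
  aeval f (repr u).

Variables (f : G -> A) (hf : respects f).

Lemma aeval_cong x y : acong rel x y -> aeval f x = aeval f y.
Proof.
elim=> //=; try by move=> *; congruence.
- by move=> *; rewrite addrA.
- by move=> *; rewrite addrC.
- by move=> *; rewrite add0r.
- by move=> *; rewrite addNr.
- by move=> *; rewrite mulrA.
- by move=> *; rewrite mul1r.
- by move=> *; rewrite mulr1.
- by move=> *; rewrite mulrDl.
- by move=> *; rewrite mulrDr.
- by move=> *; rewrite scalerA.
- by move=> *; rewrite scale1r.
- by move=> *; rewrite scalerDr.
- by move=> *; rewrite scalerDl.
- by move=> *; rewrite scalerAl.
- by move=> *; rewrite scalerAr.
Qed.

Lemma pres_hom_pi x : pres_hom hf (\pi_(pres rel) x) = aeval f x.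
Proof. exact/aeval_cong/reprE. Qed.

Lemma pres_homE g : pres_hom hf (pgen rel g) = f g.
Proof. exact: pres_hom_pi. Qed.

Lemma pres_hom_linear : linear (pres_hom hf).
Proof.
move=> c; elim/pres_ind=> x; elim/pres_ind=> y.
rewrite /GRing.scale /= pscaleE /GRing.add /= paddE.
by rewrite !pres_hom_pi.
Qed.

Lemma pres_hom_monoid : monoid_morphism (pres_hom hf).
Proof.
split; first exact: pres_hom_pi.
elim/pres_ind=> x; elim/pres_ind=> y.
by rewrite /GRing.mul /= pmulE !pres_hom_pi.
Qed.

HB.instance Definition _ :=
  GRing.isLinear.Build K (pres rel) A _ (pres_hom hf) pres_hom_linear.
HB.instance Definition _ :=
  GRing.isMonoidMorphism.Build (pres rel) A (pres_hom hf) pres_hom_monoid.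

Lemma pres_ext (g h : pres rel -> A) :
  linear g -> monoid_morphism g -> linear h -> monoid_morphism h ->
  (forall x, g (pgen rel x) = h (pgen rel x)) -> g =1 h.
Proof.
move=> lg [g1 gM] lh [h1 hM] gh.
have gZ c u : g (c *: u) = c *: g u.
  have g0 : g 0 = 0 by have := lg (-1) 0 0; rewrite scaler0 addr0 scaleN1r addNr.
  by have := lg c u 0; rewrite !addr0 g0 addr0.
have hZ c u : h (c *: u) = c *: h u.
  have h0 : h 0 = 0 by have := lh (-1) 0 0; rewrite scaler0 addr0 scaleN1r addNr.
  by have := lh c u 0; rewrite !addr0 h0 addr0.
have gD u v : g (u + v) = g u + g v by have := lg 1 u v; rewrite !scale1r.
have hD u v : h (u + v) = h u + h v by have := lh 1 u v; rewrite !scale1r.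
elim/pres_ind; elim=> [x|||x IHx|x IHx y IHy|x IHx y IHy|c x IHx].
- exact: gh.
- by rewrite -[\pi_(pres rel) _]/(0 : pres rel) -(scale0r 0) gZ hZ !scale0r.
- by rewrite -[\pi_(pres rel) _]/(1 : pres rel) g1 h1.
- by rewrite -poppE -[popp _]/(- (_ : pres rel)) -scaleN1r gZ hZ IHx.
- by rewrite -paddE -[padd _ _]/((_ : pres rel) + _) gD hD IHx IHy.
- by rewrite -pmulE -[pmul _ _]/((_ : pres rel) * _) gM hM IHx IHy.
- by rewrite -pscaleE -[pscale _ _]/(_ *: (_ : pres rel)) gZ hZ IHx.
Qed.

Lemma pres_neq0 : (1 : pres rel) != 0.
Proof.
apply/eqP=> /(congr1 (pres_hom hf)); rewrite rmorph1 raddf0 => /eqP.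
by rewrite oner_eq0.
Qed.

End Evaluation.

(* The tensor product over K: formal sums of pure tensors modulo the smallest
   congruence that makes it a K-module in which [tens a b] is bilinear; its
   universal property is [tens_liftE] and [tens_ind_lin] below. *)

Inductive texpr (K A B : Type) : Type :=
| PureT of A & B
| ZeroT
| OppT of texpr K A B
| AddT of texpr K A B & texpr K A B
| ScaleT of K & texpr K A B.

Arguments PureT {K A B}.
Arguments ZeroT {K A B}.

HB.instance Definition _ (K A B : Type) := gen_eqMixin (texpr K A B).
HB.instance Definition _ (K A B : Type) := gen_choiceMixin (texpr K A B).

Section Tensor.
Variables (K : fieldType) (A B : lmodType K).

Inductive tcong : texpr K A B -> texpr K A B -> Prop :=
| tc_refl x : tcong x x
| tc_sym x y : tcong x y -> tcong y x
| tc_trans x y z : tcong x y -> tcong y z -> tcong x z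
| tc_opp x x' : tcong x x' -> tcong (OppT x) (OppT x')
| tc_add x x' y y' : tcong x x' -> tcong y y' -> tcong (AddT x y) (AddT x' y')
| tc_scale c x x' : tcong x x' -> tcong (ScaleT c x) (ScaleT c x')
| tc_addA x y z : tcong (AddT x (AddT y z)) (AddT (AddT x y) z)
| tc_addC x y : tcong (AddT x y) (AddT y x)
| tc_add0 x : tcong (AddT ZeroT x) x
| tc_addN x : tcong (AddT (OppT x) x) ZeroT
| tc_scaleA c d x : tcong (ScaleT c (ScaleT d x)) (ScaleT (c * d) x)
| tc_scale1 x : tcong (ScaleT 1 x) x
| tc_scaleDr c x y : tcong (ScaleT c (AddT x y)) (AddT (ScaleT c x) (ScaleT c y))
| tc_scaleDl c d x : tcong (ScaleT (c + d) x) (AddT (ScaleT c x) (ScaleT d x))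
| tc_pureDl a a' b : tcong (PureT (a + a') b) (AddT (PureT a b) (PureT a' b))
| tc_pureDr a b b' : tcong (PureT a (b + b')) (AddT (PureT a b) (PureT a b'))
| tc_pureZl c a b : tcong (PureT (c *: a) b) (ScaleT c (PureT a b))
| tc_pureZr c a b : tcong (PureT a (c *: b)) (ScaleT c (PureT a b)).

Definition tcongb (x y : texpr K A B) := `[< tcong x y >].

Lemma tcongb_equiv : equiv_class_of tcongb.
Proof.
split; first by move=> x; apply/asboolP/tc_refl.
  by move=> x y; apply/asboolP/asboolP => /tc_sym.
by move=> y x z /asboolP xy /asboolP yz; apply/asboolP; apply: tc_trans xy yz.
Qed.

Canonical tcongb_equiv_rel := EquivRelPack tcongb_equiv.

Definition tensor := {eq_quot tcongb}.

HB.instance Definition _ := Choice.on tensor.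
HB.instance Definition _ := EqQuotient.on tensor.

Lemma tensor_eqP x y : \pi_tensor x = \pi_tensor y <-> tcong x y.
Proof.
by split=> [/eqP|xy]; [rewrite piE => /asboolP | apply/eqP; rewrite piE; apply/asboolP].
Qed.

Definition tzero : tensor := \pi_tensor ZeroT.
Definition topp (u : tensor) : tensor := \pi_tensor (OppT (repr u)).
Definition tadd (u v : tensor) : tensor := \pi_tensor (AddT (repr u) (repr v)).
Definition tscale c (u : tensor) : tensor := \pi_tensor (ScaleT c (repr u)).

Lemma treprE x : tcong (repr (\pi_tensor x)) x.
Proof. by apply/tensor_eqP; rewrite reprK. Qed.

Lemma toppE x : topp (\pi_tensor x) = \pi_tensor (OppT x).
Proof. by apply/tensor_eqP/tc_opp/treprE. Qed.
Lemma taddE x y : tadd (\pi_tensor x) (\pi_tensor y) = \pi_tensor (AddT x y).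
Proof. by apply/tensor_eqP/tc_add; apply/treprE. Qed.
Lemma tscaleE c x : tscale c (\pi_tensor x) = \pi_tensor (ScaleT c x).
Proof. by apply/tensor_eqP/tc_scale/treprE. Qed.

Lemma tensor_ind (P : tensor -> Prop) :
  (forall x, P (\pi_tensor x)) -> forall u, P u.
Proof. by move=> P_pi u; rewrite -[u]reprK. Qed.

Ltac tens_axiom rule :=
  repeat (elim/tensor_ind => ?);
  rewrite ?(toppE, taddE, tscaleE) -?/tzero; apply/tensor_eqP; exact: rule.

Lemma taddA : associative tadd. Proof. tens_axiom tc_addA. Qed.
Lemma taddC : commutative tadd. Proof. tens_axiom tc_addC. Qed.
Lemma tadd0 : left_id tzero tadd. Proof. tens_axiom tc_add0. Qed.
Lemma taddN : left_inverse tzero topp tadd. Proof. tens_axiom tc_addN. Qed.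

HB.instance Definition _ := GRing.isZmodule.Build tensor taddA taddC tadd0 taddN.

Lemma tscaleA c d (u : tensor) : tscale c (tscale d u) = tscale (c * d) u.
Proof. move: c d u; move=> c d; tens_axiom tc_scaleA. Qed.
Lemma tscale1 : left_id 1 tscale. Proof. tens_axiom tc_scale1. Qed.
Lemma tscaleDr : right_distributive tscale tadd.
Proof. move=> c; tens_axiom tc_scaleDr. Qed.
Lemma tscaleDl u : {morph tscale^~ u : c d / c + d >-> tadd c d}.
Proof. move=> c d; move: u; tens_axiom tc_scaleDl. Qed.

HB.instance Definition _ :=
  GRing.Zmodule_isLmodule.Build K tensor tscaleA tscale1 tscaleDr tscaleDl.

Definition tens (a : A) (b : B) : tensor := \pi_tensor (PureT a b).

Section Lift.
Variable V : lmodType K.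

Definition is_bilinear (f : A -> B -> V) :=
  (forall b, linear (f^~ b)) /\ (forall a, linear (f a)).

Fixpoint teval (f : A -> B -> V) (x : texpr K A B) : V :=
  match x with
  | PureT a b => f a b
  | ZeroT => 0
  | OppT x => - teval f x
  | AddT x y => teval f x + teval f y
  | ScaleT c x => c *: teval f x
  end.

Definition tens_lift (f : A -> B -> V) (hf : is_bilinear f) (u : tensor) : V :=
  teval f (repr u).

Variables (f : A -> B -> V) (hf : is_bilinear f).

Lemma bilDl a a' b : f (a + a') b = f a b + f a' b.
Proof. by case: hf => /(_ b 1 a a'); rewrite !scale1r. Qed.
Lemma bilDr a b b' : f a (b + b') = f a b + f a b'.
Proof. by case: hf => _ /(_ a 1 b b'); rewrite !scale1r. Qed.
Lemma bil0l b : f 0 b = 0.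
Proof. by apply: (addrI (f 0 b)); rewrite -bilDl !addr0. Qed.
Lemma bil0r a : f a 0 = 0.
Proof. by apply: (addrI (f a 0)); rewrite -bilDr !addr0. Qed.
Lemma bilZl c a b : f (c *: a) b = c *: f a b.
Proof. by case: hf => /(_ b c a 0); rewrite !addr0 bil0l addr0. Qed.
Lemma bilZr c a b : f a (c *: b) = c *: f a b.
Proof. by case: hf => _ /(_ a c b 0); rewrite !addr0 bil0r addr0. Qed.

Lemma teval_cong x y : tcong x y -> teval f x = teval f y.
Proof.
elim=> //=; try by move=> *; congruence.
- by move=> *; rewrite addrA.
- by move=> *; rewrite addrC.
- by move=> *; rewrite add0r.
- by move=> *; rewrite addNr.
- by move=> *; rewrite scalerA.
- by move=> *; rewrite scale1r.
- by move=> *; rewrite scalerDr.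
- by move=> *; rewrite scalerDl.
- by move=> *; rewrite bilDl.
- by move=> *; rewrite bilDr.
- by move=> *; rewrite bilZl.
- by move=> *; rewrite bilZr.
Qed.

Lemma tens_lift_pi x : tens_lift hf (\pi_tensor x) = teval f x.
Proof. exact/teval_cong/treprE. Qed.

Lemma tens_liftE a b : tens_lift hf (tens a b) = f a b.
Proof. exact: tens_lift_pi. Qed.

Lemma tens_lift_linear : linear (tens_lift hf).
Proof.
move=> c; elim/tensor_ind=> x; elim/tensor_ind=> y.
rewrite /GRing.scale /= tscaleE /GRing.add /= taddE.
by rewrite !tens_lift_pi.
Qed.

HB.instance Definition _ :=
  GRing.isLinear.Build K tensor V _ (tens_lift hf) tens_lift_linear.

Lemma tens_lift0 : tens_lift hf 0 = 0.
Proof. exact: raddf0. Qed.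
Lemma tens_liftD u v : tens_lift hf (u + v) = tens_lift hf u + tens_lift hf v.
Proof. exact: raddfD. Qed.
Lemma tens_liftZ c u : tens_lift hf (c *: u) = c *: tens_lift hf u.
Proof. exact: linearZ. Qed.

End Lift.

Lemma tens_bilinear : is_bilinear tens.
Proof.
split=> [b c a a'|a c b b'].
  rewrite /GRing.scale /= tscaleE /GRing.add /= taddE; apply/tensor_eqP.
  by apply: tc_trans (tc_pureDl _ _ _) _; apply: tc_add (tc_pureZl _ _ _) (tc_refl _).
rewrite /GRing.scale /= tscaleE /GRing.add /= taddE; apply/tensor_eqP.
by apply: tc_trans (tc_pureDr _ _ _) _; apply: tc_add (tc_pureZr _ _ _) (tc_refl _).
Qed.

Definition tensDl := bilDl tens_bilinear.
Definition tensDr := bilDr tens_bilinear.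
Definition tens0l := bil0l tens_bilinear.
Definition tens0r := bil0r tens_bilinear.
Definition tensZl := bilZl tens_bilinear.
Definition tensZr := bilZr tens_bilinear.

Lemma tens_ind_lin (P : tensor -> Prop) :
  (forall a b, P (tens a b)) -> P 0 -> (forall u v, P u -> P v -> P (u + v)) ->
  (forall c u, P u -> P (c *: u)) -> forall u, P u.
Proof.
move=> Pp P0 PD PZ; elim/tensor_ind.
elim=> [a b||x IHx|x IHx y IHy|c x IHx].
- exact: Pp.
- exact: P0.
- by rewrite -toppE -[topp _]/(- (_ : tensor)) -scaleN1r; apply: PZ.
- by rewrite -taddE; apply: PD.
- by rewrite -tscaleE; apply: PZ.
Qed.

Lemma tens_ext (V : lmodType K) (f g : {linear tensor -> V}) :
  (forall a b, f (tens a b) = g (tens a b)) -> f =1 g.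
Proof.
move=> fg; apply: tens_ind_lin => //; first by rewrite !raddf0.
  by move=> u v fu fv; rewrite !raddfD /= fu fv.
by move=> c u fu; rewrite !linearZ /= fu.
Qed.

End Tensor.

Arguments tensor {K} (A B)%_type_scope.
Arguments tens {K A B} (a b)%_ring_scope.
Notation "A ⊗ B" := (tensor A B) (at level 40, left associativity) : type_scope.
Notation "a ⊗ b" := (tens a b) (at level 40, left associativity) : ring_scope.

Section TensorMap.
Variables (K : fieldType) (A A' B B' : lmodType K).
Variables (f : {linear A -> A'}) (g : {linear B -> B'}).

Lemma tens_map_bilinear : is_bilinear (fun a b => f a ⊗ g b).
Proof.
split=> [b c a a'|a c b b']; rewrite linearP.
  by rewrite tensDl tensZl.
by rewrite tensDr tensZr.
Qed.

Definition tens_map : A ⊗ B -> A' ⊗ B' := tens_lift tens_map_bilinear.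
HB.instance Definition _ := GRing.Linear.on tens_map.

Lemma tens_mapE a b : tens_map (a ⊗ b) = f a ⊗ g b.
Proof. exact: tens_liftE. Qed.

End TensorMap.

(* The algebra structure of A ⊗ B: (a ⊗ b)(c ⊗ d) = ac ⊗ bd. *)

Section Functional.
Variables (K : fieldType) (V : lmodType K) (e : V).
Hypothesis e_neq0 : e != 0.

Let subm (U : set V) :=
  (forall c u v, U u -> U v -> U (c *: u + v)) /\ ~ U e.

Lemma exists_functional : exists f : V -> K^o, linear f /\ f e = 1.
Proof.
have [F subF totF|U [[Ulin Ue] Umax]] := @Zorn_bigcup V subm.
  split=> [c u v [X FX Xu] [Y FY Yv]|[X FX Xe]]; last by case: (subF X FX).
  have [XY|YX] := totF X Y FX FY.
    by exists Y => //; apply: (subF Y FY).1 => //; apply: XY.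
  by exists X => //; apply: (subF X FX).1 => //; apply: YX.
have U0 : U 0.
  apply: contrapT => nU0; refine (Umax [set 0]%classic _ _); last first.
    by split=> [c u v -> ->|/= /eqP]; [rewrite scaler0 addr0 | rewrite (negPf e_neq0)].
  split=> [u Uu|/(_ 0 erefl)//]; case: nU0.
  by have := Ulin (-1) u u Uu Uu; rewrite scaleN1r addNr.
have UZ c u : U u -> U (c *: u) by move=> Uu; rewrite -[_ *: _]addr0; apply: Ulin.
have dec v : exists c : K, U (v - c *: e).
  have [Uv|nUv] := pselect (U v); first by exists 0; rewrite scale0r subr0.
  pose W : set V := fun w => exists c, U (w - c *: v).
  have [c We] : W e.
    apply: contrapT => nWe; refine (Umax W _ _); last first.
      split=> // c w w' [d Uw] [d' Uw']; exists (c * d + d').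
      have -> : c *: w + w' - (c * d + d') *: v
              = c *: (w - d *: v) + (w' - d' *: v).
        by rewrite scalerDl scalerBr scalerA opprD addrACA.
      exact: Ulin.
    split=> [u Uu|WU]; first by exists 0; rewrite scale0r subr0.
    by apply: nUv; apply: WU; exists 1; rewrite scale1r subrr.
  have c0 : c != 0 by apply: contra_notN Ue => /eqP c0; rewrite c0 scale0r subr0 in We.
  exists c^-1; have -> : v - c^-1 *: e = (- c^-1) *: (e - c *: v).
    by rewrite scalerBr scalerA mulNr mulVf // !scaleNr scale1r opprK addrC.
  exact: UZ.
have uniq_dec v c d : U (v - c *: e) -> U (v - d *: e) -> c = d.
  move=> Uc Ud; apply/eqP; rewrite -subr_eq0; apply: contra_notT Ue => cd.
  have Ue' : U ((c - d) *: e).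
    have := Ulin (-1) _ _ Uc Ud.
    by rewrite scaleN1r opprB addrA addrNK -scalerBl.
  by have := UZ (c - d)^-1 _ Ue'; rewrite scalerA mulVf // scale1r.
pose f v := projT1 (cid (dec v)).
have fP v : U (v - f v *: e) by rewrite /f; case: cid.
exists f; split=> [c u v|]; apply: uniq_dec (fP _) _; last first.
  by rewrite scale1r subrr.
have -> : c *: u + v - (c *: (f u : K^o) + f v) *: e
        = c *: (u - f u *: e) + (v - f v *: e).
  by rewrite scalerDl scalerBr scalerA opprD addrACA.
exact: Ulin.
Qed.

End Functional.

Section TensorAlgebra.
Variables (K : fieldType) (A B : algType K).

Lemma tmul_inner_bilinear (a : A) (b : B) :
  is_bilinear (fun (c : A) (d : B) => (a * c) ⊗ (b * d)).
Proof.
split=> [d k c c'|c k d d']; rewrite mulrDr -scalerAr.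
  by rewrite tensDl tensZl.
by rewrite tensDr tensZr.
Qed.

Definition tmul_inner (v : A ⊗ B) (a : A) (b : B) : A ⊗ B :=
  tens_lift (tmul_inner_bilinear a b) v.

Lemma tmul_innerE a b c d : tmul_inner (c ⊗ d) a b = (a * c) ⊗ (b * d).
Proof. exact: tens_liftE. Qed.

Lemma tmul_inner0 a b : tmul_inner 0 a b = 0.
Proof. exact: raddf0. Qed.
Lemma tmul_innerD u v a b :
  tmul_inner (u + v) a b = tmul_inner u a b + tmul_inner v a b.
Proof. exact: raddfD. Qed.
Lemma tmul_innerZ k u a b : tmul_inner (k *: u) a b = k *: tmul_inner u a b.
Proof. exact: linearZ. Qed.

Lemma tmul_outer_bilinear v : is_bilinear (tmul_inner v).
Proof.
split=> [b k a a'|a k b b']; elim/tens_ind_lin: v => [c d||u v IHu IHv|l u IHu].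
- by rewrite !tmul_innerE mulrDl -scalerAl tensDl tensZl.
- by rewrite !tmul_inner0 scaler0 addr0.
- by rewrite !tmul_innerD IHu IHv scalerDr addrACA.
- by rewrite !tmul_innerZ IHu scalerDr !scalerA mulrC.
- by rewrite !tmul_innerE mulrDl -scalerAl tensDr tensZr.
- by rewrite !tmul_inner0 scaler0 addr0.
- by rewrite !tmul_innerD IHu IHv scalerDr addrACA.
- by rewrite !tmul_innerZ IHu scalerDr !scalerA mulrC.
Qed.

Definition tmul (u v : A ⊗ B) : A ⊗ B := tens_lift (tmul_outer_bilinear v) u.

Lemma tmulE a b c d : tmul (a ⊗ b) (c ⊗ d) = (a * c) ⊗ (b * d).
Proof. by rewrite /tmul tens_liftE tmul_innerE. Qed.

Lemma tmulDl : left_distributive tmul +%R.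
Proof. by move=> u v w; rewrite /tmul raddfD. Qed.
Lemma tmulZl c u v : tmul (c *: u) v = c *: tmul u v.
Proof. by rewrite /tmul linearZ. Qed.
Lemma tmul0l v : tmul 0 v = 0.
Proof. by rewrite /tmul raddf0. Qed.
Lemma tmulDr : right_distributive tmul +%R.
Proof.
move=> u v w; elim/tens_ind_lin: u => [a b||u u' IH IH'|c u IH].
- by rewrite /tmul !tens_liftE /tmul_inner raddfD.
- by rewrite !tmul0l addr0.
- by rewrite !tmulDl IH IH' addrACA.
- by rewrite !tmulZl IH scalerDr.
Qed.
Lemma tmulZr c u v : tmul u (c *: v) = c *: tmul u v.
Proof.
elim/tens_ind_lin: u => [a b||u u' IH IH'|d u IH].
- by rewrite /tmul !tens_liftE /tmul_inner linearZ.
- by rewrite !tmul0l scaler0.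
- by rewrite !tmulDl IH IH' scalerDr.
- by rewrite !tmulZl IH !scalerA mulrC.
Qed.
Lemma tmul0r u : tmul u 0 = 0.
Proof. by rewrite -(scale0r 0) tmulZr !scale0r. Qed.

Lemma tmulA : associative tmul.
Proof.
move=> u v w; elim/tens_ind_lin: u => [a b||u u' IH IH'|k u IH]; first last.
- by rewrite !tmulZl IH.
- by rewrite !tmulDl IH IH'.
- by rewrite !tmul0l.
elim/tens_ind_lin: v => [c d||v v' IH IH'|k v IH]; first last.
- by rewrite tmulZl !tmulZr tmulZl IH.
- by rewrite tmulDl !tmulDr tmulDl IH IH'.
- by rewrite !tmul0l !tmul0r tmul0l.
elim/tens_ind_lin: w => [e f||w w' IH IH'|k w IH]; first last.
- by rewrite !tmulZr IH.
- by rewrite !tmulDr IH IH'.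
- by rewrite !tmul0r.
by rewrite !tmulE !mulrA.
Qed.

Lemma tmul1l : left_id (1 ⊗ 1) tmul.
Proof.
elim/tens_ind_lin => [a b||u u' IH IH'|k u IH].
- by rewrite tmulE !mul1r.
- by rewrite tmul0r.
- by rewrite tmulDr IH IH'.
- by rewrite tmulZr IH.
Qed.

Lemma tmul1r : right_id (1 ⊗ 1) tmul.
Proof.
elim/tens_ind_lin => [a b||u u' IH IH'|k u IH].
- by rewrite tmulE !mulr1.
- by rewrite tmul0l.
- by rewrite tmulDl IH IH'.
- by rewrite tmulZl IH.
Qed.

Lemma tens_neq0 : (1 : A) ⊗ (1 : B) != 0.
Proof.
have [f [flin f1]] := exists_functional (oner_neq0 A).
have [g [glin g1]] := exists_functional (oner_neq0 B).
have fg_bil : is_bilinear (fun a b => f a * g b : K^o).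
  split=> [b k a a'|a k b b']; first by rewrite flin mulrDl -scalerAl.
  by rewrite glin mulrDr -scalerAr.
apply/eqP=> /(congr1 (tens_lift fg_bil)).
rewrite tens_liftE f1 g1 raddf0 mulr1 => /eqP.
by rewrite oner_eq0.
Qed.

HB.instance Definition _ := GRing.Zmodule_isNzRing.Build (tensor A B)
  tmulA tmul1l tmul1r tmulDl tmulDr tens_neq0.

Lemma tscaleAl (c : K) (u v : A ⊗ B) : c *: (u * v) = (c *: u) * v.
Proof. by rewrite [RHS]tmulZl. Qed.
Lemma tscaleAr (c : K) (u v : A ⊗ B) : c *: (u * v) = u * (c *: v).
Proof. by rewrite [RHS]tmulZr. Qed.

HB.instance Definition _ :=
  GRing.Lmodule_isLalgebra.Build K (tensor A B) tscaleAl.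
HB.instance Definition _ :=
  GRing.Lalgebra_isAlgebra.Build K (tensor A B) tscaleAr.

Lemma tensM (a c : A) (b d : B) : (a ⊗ b) * (c ⊗ d) = (a * c) ⊗ (b * d).
Proof. exact: tmulE. Qed.

Lemma tens1 : (1 : A) ⊗ (1 : B) = 1.
Proof. by []. Qed.

End TensorAlgebra.

Section TensorMorphism.
Variables (K : fieldType) (A A' B B' : algType K).
Variables (f : {lrmorphism A -> A'}) (g : {lrmorphism B -> B'}).

Lemma tens_map_monoid : monoid_morphism (tens_map f g).
Proof.
split; first by rewrite -tens1 tens_mapE !rmorph1.
move=> u v; elim/tens_ind_lin: u => [a b||u u' IH IH'|k u IH]; first last.
- by rewrite -scalerAl !linearZ /= IH -scalerAl.
- by rewrite mulrDl !raddfD /= IH IH' mulrDl.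
- by rewrite mul0r !raddf0 mul0r.
elim/tens_ind_lin: v => [c d||v v' IH IH'|k v IH]; first last.
- by rewrite -scalerAr !linearZ /= IH -scalerAr.
- by rewrite mulrDr !raddfD /= IH IH' mulrDr.
- by rewrite mulr0 !raddf0 mulr0.
by rewrite tensM !tens_mapE !rmorphM tensM.
Qed.

HB.instance Definition _ :=
  GRing.isMonoidMorphism.Build (tensor A B) (tensor A' B') (tens_map f g) tens_map_monoid.

End TensorMorphism.

(* Module identities: reduces an equation between K-linear combinations of
   atoms to equations between the coefficients. *)

Module LinSolve.

Section Reflect.
Variables (K : fieldType) (V : lmodType K).

Inductive lexpr : Type :=
| LAtom of nat
| LZero
| LOpp of lexpr
| LAdd of lexpr & lexpr
| LScale of K & lexpr.

Fixpoint leval (s : seq V) (x : lexpr) : V :=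
  match x with
  | LAtom n => s`_n
  | LZero => 0
  | LOpp x => - leval s x
  | LAdd x y => leval s x + leval s y
  | LScale c x => c *: leval s x
  end.

Fixpoint lcoef (x : lexpr) (n : nat) : K :=
  match x with
  | LAtom m => if eqn m n then 1 else 0
  | LZero => 0
  | LOpp x => - lcoef x n
  | LAdd x y => lcoef x n + lcoef y n
  | LScale c x => c * lcoef x n
  end.

Fixpoint all_below (n : nat) (P : nat -> Prop) : Prop :=
  if n is n'.+1 then P n' /\ all_below n' P else True.

Lemma levalE s x : leval s x = \sum_(i < size s) lcoef x i *: s`_i.
Proof.
elim: x => [n||x IHx|x IHx y IHy|c x IHx]; rewrite [leval _ _]/=.
- under eq_bigr => i _ do rewrite /lcoef eqnE.
  have [ns|sn] := ltnP n (size s).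
    rewrite (bigD1 (Ordinal ns)) //= eqxx scale1r big1 ?addr0 // => i.
    by rewrite -val_eqE /= eq_sym => /negPf ->; rewrite scale0r.
  rewrite nth_default // big1 // => i _.
  by rewrite (gtn_eqF (leq_trans (ltn_ord i) sn)) scale0r.
- by rewrite big1 // => i _; rewrite scale0r.
- by rewrite IHx -sumrN; apply: eq_bigr => i _; rewrite scaleNr.
- by rewrite IHx IHy -big_split; apply: eq_bigr => i _; rewrite scalerDl.
- by rewrite IHx scaler_sumr; apply: eq_bigr => i _; rewrite scalerA.
Qed.

Lemma leval_eq s x y :
  all_below (size s) (fun n => lcoef x n = lcoef y n) -> leval s x = leval s y.
Proof.
rewrite !levalE => xy; apply: eq_bigr => i _; congr (_ *: _).
elim: (size s) xy {i}(val i) (ltn_ord i) => //= n IHn [xy_n xy] i.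
by rewrite ltnS leq_eqVlt => /orP[/eqP->//|]; apply: IHn.
Qed.

End Reflect.

Ltac insert v l :=
  match l with
  | nil => constr:(cons v l)
  | cons ?w _ => let _ := match goal with _ => unify v w end in l
  | cons ?w ?l' => let m := insert v l' in constr:(cons w m)
  end.
Ltac index v l :=
  match l with
  | cons ?w _ => let _ := match goal with _ => unify v w end in constr:(O)
  | cons _ ?l' => let n := index v l' in constr:(S n)
  end.
Ltac atoms t l :=
  lazymatch t with
  | (?a + ?b)%R => let l' := atoms a l in atoms b l'
  | (- ?a)%R => atoms a l
  | (_ *: ?a)%R => atoms a l
  | 0%R => l
  | ?v => insert v l
  end.
Ltac reify K t l :=
  lazymatch t with
  | (?a + ?b)%R =>
    let x := reify K a l in let y := reify K b l in constr:(@LAdd K x y)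
  | (- ?a)%R => let x := reify K a l in constr:(@LOpp K x)
  | (?c *: ?a)%R => let x := reify K a l in constr:(@LScale K c x)
  | 0%R => constr:(@LZero K)
  | ?v => let n := index v l in constr:(@LAtom K n)
  end.

Ltac linsolve K V :=
  match goal with
  | |- ?t = ?u =>
    let l0 := constr:(@nil V) in
    let l1 := atoms t l0 in
    let l := atoms u l1 in
    let x := reify K t l in
    let y := reify K u l in
    refine (@leval_eq K V l x y _); cbn [all_below size lcoef eqn];
    repeat split
  end.

End LinSolve.

Lemma sum2 (V : nmodType) (F : 'I_2 -> V) : \sum_k F k = F 0 + F 1.
Proof.
by rewrite !big_ord_recl big_ord0 addr0; congr (_ + F _); apply/val_inj.
Qed.

Lemma ord2P (P : 'I_2 -> Prop) : P 0 -> P 1 -> forall i, P i.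
Proof.
move=> P0 P1 [[|[|//]] lt_i2].
  by rewrite (_ : Ordinal _ = 0) //; apply/val_inj.
by rewrite (_ : Ordinal _ = 1) //; apply/val_inj.
Qed.

Section Opposite.
Variables (K : fieldType).

HB.instance Definition _ (A : lmodType K) :=
  GRing.Zmodule_isLmodule.Build K (A^c)
    (@scalerA K A) (@scale1r K A) (@scalerDr K A) (@scalerDl K A).

Lemma opp_scaleAl (A : algType K) (c : K) (u v : A^c) : c *: (u * v) = (c *: u) * v.
Proof. exact: (@scalerAr K A). Qed.
Lemma opp_scaleAr (A : algType K) (c : K) (u v : A^c) : c *: (u * v) = u * (c *: v).
Proof. exact: (@scalerAl K A). Qed.

HB.instance Definition _ (A : algType K) :=
  GRing.Lmodule_isLalgebra.Build K (A^c) (@opp_scaleAl A).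
HB.instance Definition _ (A : algType K) :=
  GRing.Lalgebra_isAlgebra.Build K (A^c) (@opp_scaleAr A).

End Opposite.

(* The algebra A[s^-1]: the generators [Some a] form a copy of A, and [None] is a
   two-sided inverse of s; it is automatically central when s is. *)

Section Localization.
Variables (K : fieldType) (A : algType K) (s : A).

Inductive loc_rel : aexpr K (option A) -> aexpr K (option A) -> Prop :=
| loc_rel1 : loc_rel (Gen (Some 1)) 1%E
| loc_relD a b : loc_rel (Gen (Some (a + b))) (Gen (Some a) + Gen (Some b))%E
| loc_relM a b : loc_rel (Gen (Some (a * b))) (Gen (Some a) * Gen (Some b))%E
| loc_relZ c a : loc_rel (Gen (Some (c *: a))) (c *: Gen (Some a))%E
| loc_relVr : loc_rel (Gen (Some s) * Gen None)%E 1%E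
| loc_relVl : loc_rel (Gen None * Gen (Some s))%E 1%E.

Definition loc := pres loc_rel.

Definition loc_gen (B : Type) (f : A -> B) (b : B) (g : option A) : B :=
  if g is Some a then f a else b.

Lemma loc_respects (B : algType K) (f : {lrmorphism A -> B}) (b : B) :
  f s * b = 1 -> b * f s = 1 -> respects loc_rel (loc_gen f b).
Proof.
move=> fsb bfs x y [|a a'|a a'|c a||] //=.
- exact: rmorph1.
- exact: raddfD.
- exact: rmorphM.
- exact: linearZ.
Qed.

End Localization.

Section QuantumMatrices.
Variables (K : fieldType) (q : K).

(* The indices 0 and 1 of 'I_2 stand for 1 and 2 in x_11, x_12, x_21, x_22. *)
Definition X (i j : 'I_2) : aexpr K ('I_2 * 'I_2) := Gen (i, j).
Arguments X (i j)%_ring_scope.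

Inductive Mq_rel : aexpr K ('I_2 * 'I_2) -> aexpr K ('I_2 * 'I_2) -> Prop :=
| Mq_rel1 : Mq_rel (X 0 0 * X 0 1)%E (q *: (X 0 1 * X 0 0))%E
| Mq_rel2 : Mq_rel (X 1 0 * X 1 1)%E (q *: (X 1 1 * X 1 0))%E
| Mq_rel3 : Mq_rel (X 0 0 * X 1 0)%E (q *: (X 1 0 * X 0 0))%E
| Mq_rel4 : Mq_rel (X 0 1 * X 1 1)%E (q *: (X 1 1 * X 0 1))%E
| Mq_rel5 : Mq_rel (X 0 1 * X 1 0)%E (X 1 0 * X 0 1)%E
| Mq_rel6 : Mq_rel (X 0 0 * X 1 1 - X 1 1 * X 0 0)%E
                   ((q - q^-1)%R *: (X 0 1 * X 1 0))%E.

Definition OMq := pres Mq_rel.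

HB.instance Definition _ := GRing.PzRing.on OMq.
HB.instance Definition _ := GRing.Lmodule.on OMq.

Definition is_qmatrix (A : algType K) (z : 'I_2 -> 'I_2 -> A) : Prop :=
  [/\ z 0 0 * z 0 1 = q *: (z 0 1 * z 0 0),
      z 1 0 * z 1 1 = q *: (z 1 1 * z 1 0),
      z 0 0 * z 1 0 = q *: (z 1 0 * z 0 0) &
      z 0 1 * z 1 1 = q *: (z 1 1 * z 0 1)] /\
  (z 0 1 * z 1 0 = z 1 0 * z 0 1 /\
   z 0 0 * z 1 1 - z 1 1 * z 0 0 = (q - q^-1) *: (z 0 1 * z 1 0)).

Lemma Mq_respects (A : algType K) (z : 'I_2 -> 'I_2 -> A) :
  is_qmatrix z -> respects Mq_rel (fun g => z g.1 g.2).
Proof. by move=> [[? ? ? ?] [? ?]] x y []. Qed.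

Lemma Mq_neq0 : (1 : OMq) != 0.
Proof.
apply: (@pres_neq0 K _ (K^o) _ (fun=> 0)); apply: Mq_respects (fun _ _ => 0) _.
by rewrite /is_qmatrix !mul0r !scaler0 subr0.
Qed.

HB.instance Definition _ := GRing.PzSemiRing_isNonZero.Build OMq Mq_neq0.
HB.instance Definition _ :=
  GRing.Lmodule_isLalgebra.Build K OMq (@pscaleAl K _ Mq_rel).
HB.instance Definition _ :=
  GRing.Lalgebra_isAlgebra.Build K OMq (@pscaleAr K _ Mq_rel).

Definition xM (i j : 'I_2) : OMq := pgen Mq_rel (i, j).

Lemma xM_qmatrix : is_qmatrix xM.
Proof.
have rel_eq a b : Mq_rel a b -> \pi_OMq a = \pi_OMq b.
  by move=> ab; apply/pres_eqP/ac_rel.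
by split; [split|split];
  rewrite -?[_ * _]/(pmul _ _) -?[- _]/(popp _) -?[_ + _]/(padd _ _)
          -?[_ *: _]/(pscale _ _) /xM /pgen !(pmulE, poppE, paddE, pscaleE);
  apply: rel_eq; constructor.
Qed.

End QuantumMatrices.

Section Ordering.
Variables (K : fieldType) (q : K).
Hypothesis q_neq0 : q != 0.
Variables (A : algType K) (z : 'I_2 -> 'I_2 -> A).
Hypothesis zP : is_qmatrix q z.

Lemma qmatrix_order :
  ((z 0 1 * z 0 0 = q^-1 *: (z 0 0 * z 0 1))%R *
   (z 1 0 * z 0 0 = q^-1 *: (z 0 0 * z 1 0))%R *
   (z 1 1 * z 0 1 = q^-1 *: (z 0 1 * z 1 1))%R *
   (z 1 1 * z 1 0 = q^-1 *: (z 1 0 * z 1 1))%R *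
   (z 1 0 * z 0 1 = z 0 1 * z 1 0)%R *
   (z 1 1 * z 0 0 = z 0 0 * z 1 1 + - ((q - q^-1) *: (z 0 1 * z 1 0)))%R)%type.
Proof.
case: zP => [[r1 r2 r3 r4] [r5 r6]].
by rewrite r1 r2 r3 r4 !scalerA mulVf // !scale1r -r6 opprB addrC addrNK -r5.
Qed.

Lemma qmatrix_orderA (u : A) :
  ((z 0 1 * (z 0 0 * u) = q^-1 *: (z 0 0 * (z 0 1 * u)))%R *
   (z 1 0 * (z 0 0 * u) = q^-1 *: (z 0 0 * (z 1 0 * u)))%R *
   (z 1 1 * (z 0 1 * u) = q^-1 *: (z 0 1 * (z 1 1 * u)))%R *
   (z 1 1 * (z 1 0 * u) = q^-1 *: (z 1 0 * (z 1 1 * u)))%R *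
   (z 1 0 * (z 0 1 * u) = z 0 1 * (z 1 0 * u))%R *
   (z 1 1 * (z 0 0 * u) =
      z 0 0 * (z 1 1 * u) + - ((q - q^-1) *: (z 0 1 * (z 1 0 * u))))%R)%type.
Proof.
rewrite !(mulrA (z _ _)) !qmatrix_order.
by rewrite mulrDl mulNr -!scalerAl.
Qed.

End Ordering.

Definition linE := (mulrDl, mulrDr, mulNr, mulrN,
  fun K (A : algType K) (c : K) (u v : A) => esym (scalerAl c u v),
  fun K (A : algType K) (c : K) (u v : A) => esym (scalerAr c u v)).

Section QuantumMatrices.
Variables (K : fieldType) (q : K).

Definition detM : OMq q := xM q 0 0 * xM q 1 1 - q *: (xM q 0 1 * xM q 1 0).

Section Lift.
Variables (A : algType K) (z : 'I_2 -> 'I_2 -> A) (hz : is_qmatrix q z).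

Definition Mq_hom : OMq q -> A := pres_hom (Mq_respects hz).
HB.instance Definition _ := GRing.RMorphism.on Mq_hom.
HB.instance Definition _ := GRing.Linear.on Mq_hom.

Lemma Mq_homE i j : Mq_hom (xM q i j) = z i j.
Proof. exact: (pres_homE (Mq_respects hz)). Qed.

Lemma Mq_hom_det : Mq_hom detM = z 0 0 * z 1 1 - q *: (z 0 1 * z 1 0).
Proof. by rewrite /detM raddfB [X in _ - X = _]linearZ /= !rmorphM /= !Mq_homE. Qed.

End Lift.

Definition OGLq := loc detM.

HB.instance Definition _ := GRing.PzRing.on OGLq.
HB.instance Definition _ := GRing.Lmodule.on OGLq.

Lemma ident_qmatrix : is_qmatrix q (fun i j => (i == j)%:R : K^o).
Proof. by rewrite /is_qmatrix /= !(mul0r, mulr0, mulr1) !scaler0 subrr. Qed.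

Lemma GLq_neq0 : (1 : OGLq) != 0.
Proof.
have f_det : Mq_hom ident_qmatrix detM * 1 = 1.
  by rewrite Mq_hom_det /= !(mul0r, mulr0, mulr1) scaler0 subr0.
apply: (pres_neq0 (loc_respects f_det _)).
by rewrite mulrC.
Qed.

HB.instance Definition _ := GRing.PzSemiRing_isNonZero.Build OGLq GLq_neq0.
HB.instance Definition _ :=
  GRing.Lmodule_isLalgebra.Build K OGLq (@pscaleAl K _ (loc_rel detM)).
HB.instance Definition _ :=
  GRing.Lalgebra_isAlgebra.Build K OGLq (@pscaleAr K _ (loc_rel detM)).

Definition iota (h : OMq q) : OGLq := pgen (loc_rel detM) (Some h).
Definition detV : OGLq := pgen (loc_rel detM) None.

Lemma loc_rel_eq a b : loc_rel detM a b -> \pi_OGLq a = \pi_OGLq b.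
Proof. by move=> ab; apply/pres_eqP/ac_rel. Qed.

Lemma iota_linear : linear iota.
Proof.
move=> c u v; transitivity (\pi_OGLq (AddE (Gen (Some (c *: u))) (Gen (Some v)))).
  exact/loc_rel_eq/loc_relD.
rewrite -[RHS]/(padd (pscale c (pgen _ _)) (pgen _ _)) pscaleE paddE.
apply/pres_eqP/ac_add; last exact: ac_refl.
exact/ac_rel/loc_relZ.
Qed.

Lemma iota_monoid : monoid_morphism iota.
Proof.
split=> [|u v]; first exact/loc_rel_eq/loc_rel1.
by rewrite -[RHS]/(pmul (pgen _ _) (pgen _ _)) pmulE; apply/loc_rel_eq/loc_relM.
Qed.

HB.instance Definition _ := GRing.isLinear.Build K (OMq q) OGLq _ iota iota_linear.
HB.instance Definition _ :=
  GRing.isMonoidMorphism.Build (OMq q) OGLq iota iota_monoid.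

Lemma detMV : iota detM * detV = 1.
Proof.
rewrite -[LHS]/(pmul (pgen _ _) (pgen _ _)) pmulE; exact/loc_rel_eq/loc_relVr.
Qed.
Lemma detVM : detV * iota detM = 1.
Proof.
rewrite -[LHS]/(pmul (pgen _ _) (pgen _ _)) pmulE; exact/loc_rel_eq/loc_relVl.
Qed.

Definition xG i j : OGLq := iota (xM q i j).

Lemma xG_qmatrix : is_qmatrix q xG.
Proof.
have [[r1 r2 r3 r4] [r5 r6]] := xM_qmatrix q.
split; first by split; rewrite -!rmorphM -linearZ; congr iota.
by rewrite /xG -!rmorphM -raddfB -linearZ; split; congr iota.
Qed.

Section LiftGL.
Variables (A : algType K) (f : {lrmorphism OMq q -> A}) (b : A).
Variables (fb : f detM * b = 1) (bf : b * f detM = 1).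

Definition GLq_hom : OGLq -> A := pres_hom (loc_respects fb bf).
HB.instance Definition _ := GRing.RMorphism.on GLq_hom.
HB.instance Definition _ := GRing.Linear.on GLq_hom.

Lemma GLq_hom_iota h : GLq_hom (iota h) = f h.
Proof. exact: (pres_homE (loc_respects fb bf)). Qed.
Lemma GLq_hom_detV : GLq_hom detV = b.
Proof. exact: (pres_homE (loc_respects fb bf)). Qed.

End LiftGL.

End QuantumMatrices.

Section TensorRules.
Variables (K : fieldType).

Lemma tensNl (A B : lmodType K) (a : A) (b : B) : (- a) ⊗ b = - (a ⊗ b).
Proof. by rewrite -!scaleN1r tensZl. Qed.
Lemma tensNr (A B : lmodType K) (a : A) (b : B) : a ⊗ (- b) = - (a ⊗ b).
Proof. by rewrite -!scaleN1r tensZr. Qed.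

Definition tnfE (A B : algType K) :=
  (@tensM K A B, @tensDl K A B, @tensDr K A B, @tensZl K A B, @tensZr K A B,
   @tensNl A B, @tensNr A B).

End TensorRules.

Section QMatrixIdentities.
Variables (K : fieldType) (q : K) (q_neq0 : q != 0).
Variables (A : algType K) (z : 'I_2 -> 'I_2 -> A) (zP : is_qmatrix q z).

Let ord := qmatrix_order q_neq0 zP.
Let ordA := qmatrix_orderA q_neq0 zP.

Definition qdet : A := z 0 0 * z 1 1 - q *: (z 0 1 * z 1 0).

Lemma qmatrix_tens :
  is_qmatrix q (fun i j => \sum_(k < 2) z i k ⊗ z k j).
Proof.
rewrite /is_qmatrix !sum2.
split; split;
 rewrite !linE !tnfE !ord ?linE ?tnfE;
 LinSolve.linsolve K (tensor A A); by field.
Qed.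

Lemma qdet_tens :
  (\sum_(k < 2) z 0 k ⊗ z k 0) * (\sum_(k < 2) z 1 k ⊗ z k 1)
  - q *: ((\sum_(k < 2) z 0 k ⊗ z k 1) * (\sum_(k < 2) z 1 k ⊗ z k 0))
  = qdet ⊗ qdet.
Proof.
rewrite /qdet !sum2 !linE !tnfE !ord ?linE ?tnfE.
LinSolve.linsolve K (tensor A A); by field.
Qed.

Lemma qdet_central i j : z i j * qdet = qdet * z i j.
Proof.
elim/ord2P: i; elim/ord2P: j; rewrite /qdet;
do 4! rewrite ?linE -?mulrA ?ord ?ordA;
LinSolve.linsolve K A; by field.
Qed.

Variables (d : A) (zd : forall i j, d * z i j = z i j * d).

Let zdA i j u : d * (z i j * u) = z i j * (d * u).
Proof. by rewrite !mulrA zd. Qed.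

Definition antipode_x (i j : 'I_2) : A :=
  if (i == 0) && (j == 0) then z 1 1 * d
  else if (i == 1) && (j == 1) then z 0 0 * d
  else if i == 0 then - (q^-1 *: (z 0 1 * d))
  else - (q *: (z 1 0 * d)).

Lemma antipode_x_qmatrix : is_qmatrix q (antipode_x : 'I_2 -> 'I_2 -> A^c).
Proof.
pose s := antipode_x.
suff : [/\ s 0 1 * s 0 0 = q *: (s 0 0 * s 0 1),
           s 1 1 * s 1 0 = q *: (s 1 0 * s 1 1),
           s 1 0 * s 0 0 = q *: (s 0 0 * s 1 0) &
           s 1 1 * s 0 1 = q *: (s 0 1 * s 1 1)] /\
       (s 1 0 * s 0 1 = s 0 1 * s 1 0 /\
        s 1 1 * s 0 0 - s 0 0 * s 1 1 = (q - q^-1) *: (s 1 0 * s 0 1)) by [].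
rewrite /s /antipode_x /=.
split; split;
 do 4! rewrite ?linE -?mulrA ?zd ?zdA ?ord ?ordA;
 LinSolve.linsolve K A; by field.
Qed.

Lemma antipode_x_det :
  antipode_x 1 1 * antipode_x 0 0 - q *: (antipode_x 1 0 * antipode_x 0 1)
  = qdet * (d * d).
Proof.
rewrite /qdet /antipode_x /=.
do 4! rewrite ?linE -?mulrA ?zd ?zdA ?ord ?ordA.
LinSolve.linsolve K A; by field.
Qed.

End QMatrixIdentities.

Section HopfStructure.
Variables (K : fieldType) (q : K) (q_neq0 : q != 0).

Definition Delta : OMq q -> OMq q ⊗ OMq q :=
  Mq_hom (qmatrix_tens q_neq0 (xM_qmatrix q)).
HB.instance Definition _ := GRing.RMorphism.on Delta.
HB.instance Definition _ := GRing.Linear.on Delta.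

Lemma Delta_xE i j : Delta (xM q i j) = \sum_(k < 2) xM q i k ⊗ xM q k j.
Proof. exact: Mq_homE. Qed.

Lemma Delta_det : Delta (detM q) = detM q ⊗ detM q.
Proof.
by rewrite /Delta Mq_hom_det; apply: (qdet_tens q_neq0 (xM_qmatrix q)).
Qed.

Definition Delta_iota : OMq q -> OGLq q ⊗ OGLq q :=
  tens_map (@iota K q) (@iota K q) \o Delta.
HB.instance Definition _ := GRing.RMorphism.on Delta_iota.
HB.instance Definition _ := GRing.Linear.on Delta_iota.

Lemma Delta_iota_detr : Delta_iota (detM q) * (detV q ⊗ detV q) = 1.
Proof. by rewrite /Delta_iota /= Delta_det tens_mapE tensM detMV. Qed.
Lemma Delta_iota_detl : (detV q ⊗ detV q) * Delta_iota (detM q) = 1.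
Proof. by rewrite /Delta_iota /= Delta_det tens_mapE tensM detVM. Qed.

Definition DeltaGL : OGLq q -> OGLq q ⊗ OGLq q :=
  GLq_hom Delta_iota_detr Delta_iota_detl.
HB.instance Definition _ := GRing.RMorphism.on DeltaGL.
HB.instance Definition _ := GRing.Linear.on DeltaGL.

Lemma DeltaGL_iota h : DeltaGL (iota h) = tens_map (@iota K q) (@iota K q) (Delta h).
Proof. exact: GLq_hom_iota. Qed.

Lemma DeltaGL_xE i j : DeltaGL (xG q i j) = \sum_(k < 2) xG q i k ⊗ xG q k j.
Proof.
rewrite DeltaGL_iota Delta_xE raddf_sum.
by apply: eq_bigr => k _; rewrite /= tens_mapE.
Qed.

Lemma detG_central i j : xG q i j * iota (detM q) = iota (detM q) * xG q i j.
Proof.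
rewrite /xG -!rmorphM; congr iota.
exact: (qdet_central q_neq0 (xM_qmatrix q)).
Qed.

Lemma detV_central i j : detV q * xG q i j = xG q i j * detV q.
Proof.
rewrite -[LHS]mulr1 -(detMV q) !mulrA -[_ * _ * iota _]mulrA detG_central.
by rewrite mulrA detVM mul1r.
Qed.

(* The antipode is an algebra map into the opposite algebra; [antipode_x] lists
   its values on the generators. *)
Definition antipode_iota : OMq q -> (OGLq q)^c :=
  Mq_hom (antipode_x_qmatrix q_neq0 (xG_qmatrix q) detV_central).
HB.instance Definition _ := GRing.RMorphism.on antipode_iota.
HB.instance Definition _ := GRing.Linear.on antipode_iota.

Lemma antipode_iota_det : antipode_iota (detM q) = detV q.
Proof.
rewrite /antipode_iota Mq_hom_det.
rewrite [LHS](antipode_x_det q_neq0 (xG_qmatrix q) detV_central).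
have -> : qdet q (xG q) = iota (detM q).
  by rewrite /qdet /xG -!rmorphM -linearZ -raddfB.
by rewrite mulrA detMV mul1r.
Qed.

Lemma antipode_detr : antipode_iota (detM q) * (iota (detM q) : (OGLq q)^c) = 1.
Proof. by rewrite antipode_iota_det; apply: detMV. Qed.
Lemma antipode_detl : (iota (detM q) : (OGLq q)^c) * antipode_iota (detM q) = 1.
Proof. by rewrite antipode_iota_det; apply: detVM. Qed.

Definition antipode : OGLq q -> OGLq q := GLq_hom antipode_detr antipode_detl.

Lemma antipode_linear : linear antipode.
Proof. exact: (linearP (GLq_hom antipode_detr antipode_detl)). Qed.
HB.instance Definition _ :=
  GRing.isLinear.Build K (OGLq q) (OGLq q) _ antipode antipode_linear.

Lemma antipode1 : antipode 1 = 1.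
Proof. exact: (rmorph1 (GLq_hom antipode_detr antipode_detl)). Qed.
Lemma antipodeM u v : antipode (u * v) = antipode v * antipode u.
Proof. exact: (rmorphM (GLq_hom antipode_detr antipode_detl)). Qed.

Lemma antipode_xE :
  [/\ antipode (xG q 0 0) = xG q 1 1 * detV q,
      antipode (xG q 1 1) = xG q 0 0 * detV q,
      antipode (xG q 0 1) = - (q^-1 *: (xG q 0 1 * detV q)) &
      antipode (xG q 1 0) = - (q *: (xG q 1 0 * detV q))].
Proof.
have SxE i j : antipode (xG q i j) = antipode_x q (xG q) (detV q) i j.
  by rewrite [LHS]GLq_hom_iota [LHS]Mq_homE.
by rewrite !SxE.
Qed.

(* In Sweedler notation, [Delta3 h] is the sum of the (h_1 ⊗ h_2) ⊗ h_3. *)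
Definition Delta3 (h : OMq q) : (OMq q ⊗ OMq q) ⊗ OMq q :=
  tens_map Delta idfun (Delta h).

Lemma beta3_bilinear (c : OMq q) :
  is_bilinear (fun a b : OMq q => b ⊗ (antipode (iota a) * iota c)).
Proof.
split=> [b k a a'|a k b b']; last by rewrite tensDl tensZl.
by rewrite !linearP mulrDl -scalerAl tensDr tensZr.
Qed.

Lemma beta_bilinear :
  is_bilinear (fun w (c : OMq q) => tens_lift (beta3_bilinear c) w).
Proof.
split=> [c|w k c c']; first exact: linearP.
elim/tens_ind_lin: w => [a b||u v IHu IHv|l u IHu].
- by rewrite !tens_liftE linearP mulrDr -scalerAr tensDr tensZr.
- by rewrite !tens_lift0 scaler0 addr0.
- by rewrite !tens_liftD IHu IHv scalerDr addrACA.
- by rewrite !tens_liftZ IHu scalerDr !scalerA mulrC.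
Qed.

Definition beta (h : OMq q) : OMq q ⊗ OGLq q :=
  tens_lift beta_bilinear (Delta3 h).

Lemma alpha3_bilinear (c : OMq q) :
  is_bilinear (fun a b : OMq q => b ⊗ (iota c * antipode (iota a))).
Proof.
split=> [b k a a'|a k b b']; last by rewrite tensDl tensZl.
by rewrite !linearP mulrDr -scalerAr tensDr tensZr.
Qed.

Lemma alpha_bilinear :
  is_bilinear (fun w (c : OMq q) => tens_lift (alpha3_bilinear c) w).
Proof.
split=> [c|w k c c']; first exact: linearP.
elim/tens_ind_lin: w => [a b||u v IHu IHv|l u IHu].
- by rewrite !tens_liftE linearP mulrDl -scalerAl tensDr tensZr.
- by rewrite !tens_lift0 scaler0 addr0.
- by rewrite !tens_liftD IHu IHv scalerDr addrACA.
- by rewrite !tens_liftZ IHu scalerDr !scalerA mulrC.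
Qed.

Definition alpha (h : OMq q) : OMq q ⊗ OGLq q :=
  tens_lift alpha_bilinear (Delta3 h).

Lemma beta_sweedler (I : Type) (r : seq I) (a b c : I -> OMq q) (h : OMq q) :
  Delta3 h = \sum_(i <- r) (a i ⊗ b i) ⊗ c i ->
  beta h = \sum_(i <- r) b i ⊗ (antipode (iota (a i)) * iota (c i)).
Proof.
by rewrite /beta => ->; rewrite raddf_sum; apply: eq_bigr => i _ /=; rewrite !tens_liftE.
Qed.

Lemma alpha_sweedler (I : Type) (r : seq I) (a b c : I -> OMq q) (h : OMq q) :
  Delta3 h = \sum_(i <- r) (a i ⊗ b i) ⊗ c i ->
  alpha h = \sum_(i <- r) b i ⊗ (iota (c i) * antipode (iota (a i))).
Proof.
by rewrite /alpha => ->; rewrite raddf_sum; apply: eq_bigr => i _ /=; rewrite !tens_liftE.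
Qed.

End HopfStructure.

Section Evaluation.
Variables (K : fieldType) (q : K) (xi : 'M[K]_2) (xi_diag : is_diag_mx xi).

Lemma diag_qmatrix : is_qmatrix q (fun i j => xi i j : K^o).
Proof.
have xi01 : xi 0 1 = 0 by apply/(is_diag_mxP xi_diag).
have xi10 : xi 1 0 = 0 by apply/(is_diag_mxP xi_diag).
rewrite /is_qmatrix xi01 xi10 !(mul0r, mulr0, scaler0).
by rewrite [xi 0 0 * xi 1 1]mulrC subrr.
Qed.

Definition ev : OMq q -> K^o := Mq_hom diag_qmatrix.
HB.instance Definition _ := GRing.RMorphism.on ev.
HB.instance Definition _ := GRing.Linear.on ev.

Lemma ev_xE i j : ev (xM q i j) = xi i j.
Proof. exact: Mq_homE. Qed.

(* [ev ⊗ id], with K ⊗ O(GL_q) identified with O(GL_q). *)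
Lemma ev_id_bilinear : is_bilinear (fun (a : OMq q) (b : OGLq q) => (ev a : K) *: b).
Proof.
split=> [b k a a'|a k b b']; first by rewrite linearP /= scalerDl scalerA.
by rewrite scalerDr !scalerA mulrC.
Qed.

Definition ev_id : OMq q ⊗ OGLq q -> OGLq q := tens_lift ev_id_bilinear.

Variable q_neq0 : q != 0.

Definition beta_orbit (h : OMq q) : OGLq q := ev_id (beta q_neq0 h).
Definition alpha_orbit (h : OMq q) : OGLq q := ev_id (alpha q_neq0 h).

End Evaluation.

(* O(D) = K[t_1^±1, t_2^±1]; [(i, true)] stands for t_i and [(i, false)] for its
   inverse. *)

Section Torus.
Variables (K : fieldType) (q : K).

Inductive torus_rel :
    aexpr K ('I_2 * bool) -> aexpr K ('I_2 * bool) -> Prop :=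
| torus_relC g h : torus_rel (Gen g * Gen h)%E (Gen h * Gen g)%E
| torus_relV i : torus_rel (Gen (i, true) * Gen (i, false))%E 1%E.

Definition OD := pres torus_rel.

HB.instance Definition _ := GRing.PzRing.on OD.
HB.instance Definition _ := GRing.Lmodule.on OD.

Lemma OD_neq0 : (1 : OD) != 0.
Proof.
apply: (@pres_neq0 K _ (K^o) _ (fun=> 1)) => x y [g h|i] //=.
by rewrite mulr1.
Qed.

HB.instance Definition _ := GRing.PzSemiRing_isNonZero.Build OD OD_neq0.
HB.instance Definition _ :=
  GRing.Lmodule_isLalgebra.Build K OD (@pscaleAl K _ torus_rel).
HB.instance Definition _ :=
  GRing.Lalgebra_isAlgebra.Build K OD (@pscaleAr K _ torus_rel).

Definition tD (i : 'I_2) : OD := pgen torus_rel (i, true).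
Definition tDV (i : 'I_2) : OD := pgen torus_rel (i, false).

Lemma torusC g h :
  pgen torus_rel g * pgen torus_rel h = pgen torus_rel h * pgen torus_rel g.
Proof.
rewrite -[LHS]/(pmul _ _) -[RHS]/(pmul _ _) !pmulE.
exact/pres_eqP/ac_rel/torus_relC.
Qed.

Lemma tVr i : tD i * tDV i = 1.
Proof.
by rewrite -[LHS]/(pmul _ _) pmulE; apply/pres_eqP/ac_rel/torus_relV.
Qed.

Lemma torus_qmatrix : is_qmatrix q (fun i j => (i == j)%:R * tD i).
Proof.
rewrite /is_qmatrix /= !(mul0r, mulr0, mul1r) !scaler0; split; split=> //.
by rewrite torusC subrr.
Qed.

Definition piD_iota : OMq q -> OD := Mq_hom torus_qmatrix.
HB.instance Definition _ := GRing.RMorphism.on piD_iota.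
HB.instance Definition _ := GRing.Linear.on piD_iota.

Lemma piD_det : piD_iota (detM q) = tD 0 * tD 1.
Proof. by rewrite /piD_iota Mq_hom_det /= !(mul0r, mul1r) scaler0 subr0. Qed.

Lemma piD_detr : piD_iota (detM q) * (tDV 1 * tDV 0) = 1.
Proof. by rewrite piD_det mulrA -(mulrA (tD 0)) tVr mulr1 tVr. Qed.
Lemma piD_detl : (tDV 1 * tDV 0) * piD_iota (detM q) = 1.
Proof.
by rewrite piD_det mulrA -(mulrA (tDV 1)) [tDV 0 * tD 0]torusC tVr mulr1 torusC tVr.
Qed.

Definition piD : OGLq q -> OD := GLq_hom piD_detr piD_detl.
HB.instance Definition _ := GRing.RMorphism.on piD.
HB.instance Definition _ := GRing.Linear.on piD.

Lemma piD_xE i j : piD (xG q i j) = (i == j)%:R * tD i.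
Proof. by rewrite [LHS]GLq_hom_iota [LHS]Mq_homE. Qed.

Variable q_neq0 : q != 0.

Definition lambdaD (f : OGLq q) : OD ⊗ OGLq q :=
  tens_map piD idfun (DeltaGL q_neq0 f).

Definition OD_GLq : set (OGLq q) := [set f | lambdaD f = 1 ⊗ f].

End Torus.

Definition subalgebra (K : fieldType) (A : algType K) (B : set A) : Prop :=
  [/\ B 1, forall c u v, B u -> B v -> B (c *: u + v) &
      forall u v, B u -> B v -> B (u * v)].

Section QuantumGL2.
Variables (K : fieldType) (q : K) (q_neq0 : q != 0).

Definition tau1 : OMq q := q ^- 2 *: xM q 0 0 + q ^- 4 *: xM q 1 1.
Definition tau2 : OMq q := q ^- 6 *: detM q.
Definition sigma1 : OMq q := xM q 0 0 + xM q 1 1.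
Definition sigma2 : OMq q := detM q.

(* B ⊗ O(GL_q) is taken inside O(GL_q) ⊗ O(GL_q). *)
Definition right_coideal_subalgebra (B : set (OGLq q)) : Prop :=
  subalgebra B /\
  forall b, B b ->
  exists r : seq (OGLq q * OGLq q),
    (forall p, p \in r -> B p.1) /\
    DeltaGL q_neq0 b = \sum_(p <- r) p.1 ⊗ p.2.

End QuantumGL2.

Section Ideals.
Variable A : pzRingType.

Definition right_ideal (I : set A) : Prop :=
  [/\ I 0, forall u v, I u -> I v -> I (u - v) & forall u a, I u -> I (u * a)].

Definition left_ideal (I : set A) : Prop :=
  [/\ I 0, forall u v, I u -> I v -> I (u - v) & forall u a, I u -> I (a * u)].

Definition right_ideal_gen (S : set A) : set A :=
  \bigcap_(I in [set I | right_ideal I /\ S `<=` I]) I.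

Definition left_ideal_gen (S : set A) : set A :=
  \bigcap_(I in [set I | left_ideal I /\ S `<=` I]) I.

End Ideals.

(* Main.v *)
(* The co-orbit map is h |-> 1.h for the right action of O(M_q) on O(GL_q) with
   Z.x_ij = sum_k xi_kk S(x_ik) Z x_kj.  Put D = det_q^-1, z = x12 x21 D,
   p = x11 x21 D and r = x12 x22 D.  The coinvariants O(D\GL_q) are the sum of
   the lines K[z] r^m and K[z] p^m; these have distinct weights for the right
   torus, and z is transcendental.  Modulo the right ideal J of the theorem,
   O(M_q) is spanned by the x12^m f(x11) and x21^m f(x11).  Since 1.x12^m and
   1.x21^m are nonzero multiples of r^m and p^m, and x11 acts on each line by
   raising the degree in z by exactly one (the leading coefficients are nonzero
   because xi11 q^(-2k) <> xi22 for k >= 0), the map sends x12^m f(x11) to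
   g(z) r^m with deg g = deg f.  This gives surjectivity and the kernel at once.
   The map alpha^xi is beta^xi' composed with an anti-automorphism of O(M_q)
   exchanging x11 and x22 up to scalars, with xi' = diag(xi22, q^2 xi11). *)

From HB Require Import structures.
Require Import Defs.
From mathcomp Require Import all_boot all_order all_algebra.
From mathcomp Require Import ring zify.
From mathcomp Require Import boolp classical_sets reals complex.

Set Implicit Arguments.
Unset Strict Implicit.
Unset Printing Implicit Defensive.

Import GRing.Theory.
Local Open Scope classical_set_scope.
Local Open Scope ring_scope.
Local Open Scope complex_scope.

(* These names clash with [matrix.detM], [matrix.detV] and [seq.iota]. *)
Local Notation detM := Defs.detM.
Local Notation detV := Defs.detV.
Local Notation iota := Defs.iota.

(** * Graded sums of subspaces *)

(** No basis of [O(GL_q)] is constructed. Upper bounds come from spanning sets closed under right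
    multiplication by the generators, lower bounds from algebra maps out of the presentations. Torus
    coinvariance and the separation of the lines are both turned into eigenvalue statements, by
    evaluating a torus at points whose coordinates are 1 and a scalar [u] with pairwise distinct
    powers. Transcendence of z is tested in matrix representations in which z acts as the square of
    a nilpotent shift, of size depending on the polynomial.

    The obstacle on the side of [O(M_q)] is that J is only a right ideal: a relation modulo J may be
    applied at the left end of a product and nowhere else, so factors must be carried there before
    they are replaced. The entry x22 does not q-commute with x11; it is handled through x11 x22 =
    det_q + q x12 x21, where both terms can be carried to the left. *)

Section Span.
Variables (K : fieldType) (V : lmodType K).
Implicit Types (S T : set V).

Inductive span S : set V :=
| span0 : span S 0
| span_gen v : S v -> span S v
| span_lin c u v : span S u -> span S v -> span S (c *: u + v).

Lemma spanD S u v : span S u -> span S v -> span S (u + v).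
Proof. by move=> Su Sv; rewrite -[u]scale1r; apply: span_lin. Qed.

Lemma spanZ S c u : span S u -> span S (c *: u).
Proof. by move=> Su; rewrite -[_ *: _]addr0; apply: span_lin => //; apply: span0. Qed.

Lemma span_sub_span S T : (forall s, S s -> span T s) -> span S `<=` span T.
Proof.
move=> ST u; elim=> [|v Sv|c v w _ IHv _ IHw]; first exact: span0.
  exact: ST.
exact: span_lin.
Qed.

Lemma span_sub (B : set V) S :
  B 0 -> (forall c u v, B u -> B v -> B (c *: u + v)) -> S `<=` B -> span S `<=` B.
Proof. by move=> B0 BP SB u; elim=> [|v /SB|c v w _ IHv _ IHw] //; apply: BP. Qed.

Lemma span_linear (W : lmodType K) (f : {linear V -> W}) S (B : set W) :
  B 0 -> (forall c u v, B u -> B v -> B (c *: u + v)) -> (forall s, S s -> B (f s)) ->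
  forall u, span S u -> B (f u).
Proof.
move=> B0 BP SB u; elim=> [|v /SB|c v w _ IHv _ IHw] //; first by rewrite raddf0.
by rewrite linearP; apply: BP.
Qed.

(** Collecting the summands index by index leaves one vector for each subspace, the form that
    [eigen_free] and [sphere_line_free] require. *)
Lemma span_bigcup (I : eqType) (S : I -> set V) :
  (forall i, S i 0) -> (forall i c u v, S i u -> S i v -> S i (c *: u + v)) ->
  forall u, span [set v | exists i, S i v] u ->
  exists (r : seq I) (F : I -> V),
    [/\ uniq r, forall i, S i (F i) & u = \sum_(i <- r) F i].
Proof.
move=> S0 SP u; elim=> [|v [i Siv]|c v w _ [r [F [r_uniq SF ->]]] _ [r' [F' [r'_uniq SF' ->]]]].
- by exists [::], (fun=> 0); rewrite big_nil.
- exists [:: i], (fun j => if j == i then v else 0); split=> // [j|].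
    by case: eqP => // ->.
  by rewrite big_seq1 eqxx.
pose ind (s : seq I) (G : I -> V) i := if i \in s then G i else 0.
have indE (s s' : seq I) G : uniq s -> uniq s' -> {subset s <= s'} ->
    \sum_(i <- s') ind s G i = \sum_(i <- s) G i.
  move=> s_uniq s'_uniq ss'; rewrite -big_mkcond -big_filter.
  apply/perm_big/uniq_perm => //; first exact: filter_uniq.
  by move=> i; rewrite mem_filter; apply: andb_idr => /ss'.
have Sind i s G : (forall j, S j (G j)) -> S i (ind s G i) by rewrite /ind; case: ifP.
exists (undup (r ++ r')), (fun i => c *: ind r F i + ind r' F' i); split.
- exact: undup_uniq.
- by move=> i; apply: SP; apply: Sind.
rewrite big_split -scaler_sumr /= !indE ?undup_uniq //.
  by move=> i ir'; rewrite mem_undup mem_cat ir' orbT.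
by move=> i ir; rewrite mem_undup mem_cat ir.
Qed.

Variable f : {linear V -> V}.

(** Applying [f - e j] to the sum kills the term at [j] and multiplies every other term by the
    nonzero scalar [e i - e j]. *)
Lemma eigen_free (I : eqType) (r : seq I) (e : I -> K) (g : I -> V) :
  uniq r -> {in r &, injective e} -> (forall i, f (g i) = e i *: g i) ->
  \sum_(i <- r) g i = 0 -> {in r, forall i, g i = 0}.
Proof.
elim: r g => //= j r IHr g /andP[jr r_uniq] e_inj fg sum0.
have g_r : {in r, forall i, g i = 0}.
  move=> i ir; have: (e i - e j) *: g i = 0.
    apply: (IHr (fun i => (e i - e j) *: g i)) => //.
    - by move=> k l kr lr; apply: e_inj; rewrite inE (kr, lr) orbT.
    - by move=> k; rewrite linearZ /= fg !scalerA mulrC.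
    transitivity (f (\sum_(i <- j :: r) g i) - e j *: \sum_(i <- j :: r) g i).
      rewrite raddf_sum scaler_sumr -sumrB big_cons /= fg subrr add0r.
      by apply: eq_bigr => k _; rewrite scalerBl fg.
    by rewrite sum0 raddf0 scaler0 subrr.
  move/eqP; rewrite scaler_eq0 subr_eq0 => /orP[/eqP eij|/eqP//].
  have ij : i = j by apply: e_inj eij; rewrite inE ?eqxx ?ir ?orbT.
  by rewrite -ij ir in jr.
move=> i; rewrite inE => /predU1P[->|/g_r//].
by move: sum0; rewrite big_cons big_seq big1 ?addr0.
Qed.

(** Grouping the generators by eigenvalue, all components of [u] outside the eigenvalue 1 must
    vanish, so [u] is its own component at 1. *)
Lemma span_fixed S :
  (forall s, S s -> exists e, f s = e *: s) ->
  forall u, span S u -> f u = u -> span (S `&` [set s | f s = s]) u.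
Proof.
move=> S_eigen u Su fu.
pose E e : set V := span (S `&` [set s | f s = e *: s]).
have [e|e c v w||r [F [r_uniq EF uE]]] := @span_bigcup K E _ _ u.
- exact: span0.
- exact: span_lin.
- apply: span_sub_span Su => s Ss; apply: span_gen.
  by have [e fs] := S_eigen s Ss; exists e; apply: span_gen.
have fE e v : E e v -> f v = e *: v.
  elim=> [|w [_ //]|c w w' _ IHw _ IHw']; first by rewrite raddf0 scaler0.
  by rewrite linearP IHw IHw' scalerDr !scalerA mulrC.
pose r1 := undup (1 :: r).
(* Moving [u] into its decomposition as a term of eigenvalue 1 gives a vanishing sum of
   eigenvectors; [r1] contains 1 even if no component has that eigenvalue. *)
pose F1 e := (if e \in r then F e else 0) - (if e == 1 then u else 0).
have F1E e : f (F1 e) = e *: F1 e.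
  rewrite raddfB /= scalerBr; congr (_ - _); last first.
    by case: eqP => [->|_]; rewrite ?fu ?scale1r // raddf0 scaler0.
  by case: ifP => _; [apply: fE | rewrite raddf0 scaler0].
have F1_sum : \sum_(e <- r1) F1 e = 0.
  rewrite sumrB -!big_mkcond -(big_filter _ (mem r)) -(big_filter _ (pred1 1)) /=.
  rewrite (perm_big r); last first.
    apply: uniq_perm; rewrite ?filter_uniq ?undup_uniq // => e.
    by rewrite mem_filter mem_undup inE; apply: andb_idr => er; apply/orP; right.
  rewrite [X in _ - X](perm_big [:: 1]); first by rewrite -uE big_seq1 subrr.
  apply: uniq_perm; rewrite ?filter_uniq ?undup_uniq // => e.
  by rewrite mem_filter mem_undup !inE; apply: andb_idr => /= ->.
have r11 : 1 \in r1 by rewrite mem_undup inE eqxx.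
have /eqP := eigen_free (undup_uniq _) (in2W (@inj_id K)) F1E F1_sum r11.
rewrite /F1 eqxx subr_eq0 => /eqP <-; case: ifP => _; last exact: span0.
apply: span_sub_span (EF 1) => s [Ss fs]; apply: span_gen.
by rewrite /= scale1r in fs.
Qed.

End Span.

(** * q-commuting elements *)

Section Dilation.
Variable K : fieldType.
Implicit Types (f : {poly K}) (l : K).

(** This is what happens to a polynomial in [z] when an element that commutes with [z] up to the
    factor [l] passes it. *)
Definition dilate l f : {poly K} := f \Po (l *: 'X).

Lemma dilate1 f : dilate 1 f = f.
Proof. by rewrite /dilate scale1r comp_polyXr. Qed.

Lemma size_dilate l f : l != 0 -> size (dilate l f) = size f.
Proof. by move=> l0; rewrite size_comp_poly2 // size_scale // size_polyX. Qed.

Lemma lead_coef_dilate l f : l != 0 ->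
  lead_coef (dilate l f) = lead_coef f * l ^+ (size f).-1.
Proof.
move=> l0; rewrite lead_coef_comp ?size_scale ?size_polyX //.
by rewrite lead_coefZ lead_coefX mulr1.
Qed.

Lemma dilate_neq0 l f : l != 0 -> f != 0 -> dilate l f != 0.
Proof. by move=> l0; rewrite -!size_poly_gt0 size_dilate. Qed.

(** The top coefficient is that of [f] times [y l^n - w], where [n] is the degree of [f]; the part
    with [x] has smaller degree. *)
Lemma size_dilate_shift l (x y w : K) f :
  l != 0 -> (forall n, y * l ^+ n != w) -> f != 0 ->
  size (dilate l f * (x%:P + y *: 'X) - (w *: 'X) * f) = (size f).+1.
Proof.
move=> l0 ylw f0; pose g := y *: dilate l f - w *: f.
have -> : dilate l f * (x%:P + y *: 'X) - (w *: 'X) * f = g * 'X + x *: dilate l f.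
  by rewrite -!mul_polyC /g -!mul_polyC; ring.
have sg_le : (size g <= size f)%N.
  rewrite (leq_trans (size_polyD _ _)) // size_polyN geq_max.
  by rewrite !(leq_trans (size_scale_leq _ _)) // size_dilate.
have sg : size g = size f.
  apply/eqP; rewrite eqn_leq sg_le /= -(@prednK (size f)) ?size_poly_gt0 //.
  rewrite ltnNge; apply: (contraNN (fun le_gf => introT eqP (nth_default 0 le_gf))).
  rewrite coefB !coefZ -{1}(size_dilate f l0) -!lead_coefE.
  rewrite lead_coef_dilate // mulrCA [w * _]mulrC -mulrBr mulf_neq0 ?lead_coef_eq0 //.
  by rewrite subr_eq0.
have g0 : g != 0 by rewrite -size_poly_gt0 sg size_poly_gt0.
rewrite size_polyDl size_mulX // sg // ltnS.
by rewrite (leq_trans (size_scale_leq _ _)) // size_dilate.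
Qed.

End Dilation.

Section QCommutation.
Variables (K : fieldType) (A : algType K).
Implicit Types (x y z : A) (l : K) (f : {poly K}).

Lemma qcommXr l x y m : x * y = l *: (y * x) -> x * y ^+ m = l ^+ m *: (y ^+ m * x).
Proof.
move=> xy; elim: m => [|m IHm]; first by rewrite mulr1 mul1r scale1r.
by rewrite exprS mulrA xy -scalerAl -[y * x * _]mulrA IHm -scalerAr scalerA mulrA -!exprS.
Qed.

Lemma qcommXl l x y m : x * y = l *: (y * x) -> x ^+ m * y = l ^+ m *: (y * x ^+ m).
Proof.
move=> xy; elim: m => [|m IHm]; first by rewrite mulr1 mul1r scale1r.
by rewrite exprS -mulrA IHm -scalerAr !mulrA xy -scalerAl scalerA -mulrA -!exprSr.
Qed.

Lemma qcommV l x y : l != 0 -> x * y = l *: (y * x) -> y * x = l^-1 *: (x * y).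
Proof. by move=> l0 ->; rewrite scalerA mulVf // scale1r. Qed.

Lemma exprM_qcomm l x y m : l != 0 -> y * x = l *: (x * y) ->
  exists2 k, k != 0 & (x * y) ^+ m = k *: (x ^+ m * y ^+ m).
Proof.
move=> l0 yx; elim: m => [|m [k k0 IHm]].
  by exists 1; rewrite ?oner_neq0 // scale1r mulr1.
exists (k * l ^+ m); first by rewrite mulf_neq0 ?expf_neq0.
rewrite exprSr IHm -scalerAl mulrA -[_ * _ * x]mulrA (qcommXl m yx).
by rewrite -scalerAr -scalerAl scalerA !mulrA -exprSr -mulrA -exprSr.
Qed.

Lemma horner_algZ z l f : horner_alg z (l *: f) = l *: horner_alg z f.
Proof. by rewrite -mul_polyC rmorphM /= horner_algC mulr_algl. Qed.

Lemma horner_algZX z l : horner_alg z (l *: 'X) = l *: z.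
Proof. by rewrite horner_algZ horner_algX. Qed.

Lemma horner_alg_qcomm l x z f : x * z = l *: (z * x) ->
  x * horner_alg z f = horner_alg z (dilate l f) * x.
Proof.
move=> xz; elim/poly_ind: f => [|f c IHf]; first by rewrite /dilate comp_poly0 !raddf0 mulr0 mul0r.
rewrite /dilate comp_poly_MXaddC !rmorphD !rmorphM /= -/(dilate l f).
rewrite horner_algZX horner_algX !horner_algC mulrDr mulrDl.
by rewrite [x * (_ * z)]mulrA IHf -[_ * x * z]mulrA xz !(mulr_algl, mulr_algr) -!scalerAr -!scalerAl mulrA.
Qed.

Lemma horner_alg_comm x z f : GRing.comm x z -> GRing.comm x (horner_alg z f).
Proof.
move=> xz; rewrite /GRing.comm -[in RHS](dilate1 f).
by apply: horner_alg_qcomm; rewrite scale1r.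
Qed.

Lemma horner_alg_qcommr l x z f : z * x = l *: (x * z) ->
  horner_alg z f * x = x * horner_alg z (dilate l f).
Proof.
move=> zx; elim/poly_ind: f => [|f c IHf]; first by rewrite /dilate comp_poly0 !raddf0 mulr0 mul0r.
rewrite /dilate comp_poly_MXaddC !rmorphD !rmorphM /= -/(dilate l f).
rewrite horner_algZX horner_algX !horner_algC mulrDr mulrDl.
by rewrite -[_ * z * x]mulrA zx -scalerAr [_ * (x * z)]mulrA IHf !(mulr_algl, mulr_algr) -!scalerAr -!mulrA.
Qed.

(** Multiplication by [y ^+ m] turns [x ^+ m] into a nonzero polynomial in [z], which reduces the
    claim to the integral domain [{poly K}]. *)
Lemma horner_alg_mulX_inj l x y z g m f :
  injective (horner_alg z) -> l != 0 -> x * z = l *: (z * x) ->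
  g != 0 -> x * y = horner_alg z g ->
  horner_alg z f * x ^+ m = 0 -> f = 0.
Proof.
move=> z_inj l0 xz g0 xy fxm.
have [h h0 xym] : exists2 h, h != 0 & x ^+ m * y ^+ m = horner_alg z h.
  elim: m {fxm} => [|m [h h0 IHm]].
    by exists 1; rewrite ?oner_neq0 // rmorph1 mulr1.
  exists (dilate (l ^+ m) g * h).
    by rewrite mulf_neq0 // dilate_neq0 // expf_neq0.
  rewrite exprSr exprS mulrA -[_ * x * y]mulrA xy.
  by rewrite (horner_alg_qcomm _ (qcommXl m xz)) -mulrA IHm rmorphM.
have : f * h = 0.
  by apply: z_inj; rewrite raddf0 rmorphM /= -xym mulrA fxm mul0r.
by move/eqP; rewrite mulf_eq0 (negPf h0) orbF => /eqP.
Qed.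

End QCommutation.

(** * The quantum sphere *)

Section QuantumSphere.
Variables (K : fieldType) (q : K) (q_neq0 : q != 0).
Variables (A : algType K) (x : 'I_2 -> 'I_2 -> A) (xP : is_qmatrix q x).
Variables (D : A) (xD : forall i j, D * x i j = x i j * D) (detD : qdet q x * D = 1).

Let ord := qmatrix_order q_neq0 xP.
Let ordA := qmatrix_orderA q_neq0 xP.
Let xDA i j u : D * (x i j * u) = x i j * (D * u).
Proof. by rewrite !mulrA xD. Qed.

Local Notation a := (x 0 0).
Local Notation b := (x 0 1).
Local Notation c := (x 1 0).
Local Notation d := (x 1 1).
Local Notation det := (qdet q x).

(** Both sides are expanded in ordered monomials in [a], [b], [c], [d], with [D] last, and the
    coefficients are compared. *)
Ltac qnormal :=
  do 4! rewrite ?linE -?mulrA ?xD ?xDA ?ord ?ordA;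
  LinSolve.linsolve K A; by field.

Definition sphz : A := b * c * D.
Definition sphp : A := a * c * D.
Definition sphr : A := b * d * D.

Lemma D_det : D * det = 1.
Proof. rewrite -detD /qdet; qnormal. Qed.

Lemma D_comm i j : GRing.comm D (x i j). Proof. exact: xD. Qed.
Lemma D_comm_z : GRing.comm D sphz. Proof. by do ?apply: commrM. Qed.
Lemma D_comm_p : GRing.comm D sphp. Proof. by do ?apply: commrM. Qed.
Lemma D_comm_r : GRing.comm D sphr. Proof. by do ?apply: commrM. Qed.

Lemma mul_adD : a * d * D = 1 + q *: sphz.
Proof. rewrite -detD /qdet /sphz; qnormal. Qed.
Lemma mul_daD : d * a * D = 1 + q^-1 *: sphz.
Proof. rewrite -detD /qdet /sphz; qnormal. Qed.

Lemma qcomm_dz : d * sphz = q ^- 2 *: (sphz * d).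
Proof. rewrite /sphz; qnormal. Qed.
Lemma comm_bz : GRing.comm b sphz.
Proof. rewrite /GRing.comm /sphz; qnormal. Qed.
Lemma comm_cz : GRing.comm c sphz.
Proof. rewrite /GRing.comm /sphz; qnormal. Qed.
(** Together with [qcomm_pz], [mul_rp] and [mul_pr] this gives, up to rescaling, the relations of
    the standard Podles sphere. *)
Lemma qcomm_rz : sphr * sphz = q ^- 2 *: (sphz * sphr).
Proof. rewrite /sphz /sphr; qnormal. Qed.
Lemma qcomm_pz : sphp * sphz = q ^+ 2 *: (sphz * sphp).
Proof. rewrite /sphz /sphp; qnormal. Qed.
Lemma qcomm_dr : d * sphr = q^-1 *: (sphr * d).
Proof. rewrite /sphr; qnormal. Qed.
Lemma qcomm_br : b * sphr = q *: (sphr * b).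
Proof. rewrite /sphr; qnormal. Qed.
Lemma qcomm_pa : sphp * a = q^-1 *: (a * sphp).
Proof. rewrite /sphp; qnormal. Qed.
Lemma qcomm_pc : sphp * c = q *: (c * sphp).
Proof. rewrite /sphp; qnormal. Qed.
Lemma mul_rp : sphr * sphp = horner_alg sphz ('X * (1 + q^-1 *: 'X)).
Proof.
rewrite rmorphM rmorphD /= horner_algZX horner_algX rmorph1 -mul_daD.
rewrite /sphr /sphz /sphp; qnormal.
Qed.
Lemma mul_pr : sphp * sphr = horner_alg sphz (q ^+ 2 *: 'X * (1 + q *: 'X)).
Proof.
rewrite rmorphM rmorphD /= !horner_algZX rmorph1 -mul_adD.
rewrite /sphr /sphz /sphp; qnormal.
Qed.

(* The co-orbit map satisfies [beta (h x_ij) = coad xi i j (beta h)]. *)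
Definition coad (xi : 'M[K]_2) (i j : 'I_2) (u : A) : A :=
  \sum_k xi k k *: (antipode_x q x D i k * u * x k j).

Variable xi : 'M[K]_2.
Local Notation xi0 := (xi 0 0).
Local Notation xi1 := (xi 1 1).

Lemma coadE i j u : GRing.comm D u ->
  coad xi i j u = if i == 0 then xi0 *: (d * u * x 0 j * D) - (q^-1 * xi1) *: (b * u * x 1 j * D)
                  else xi1 *: (a * u * x 1 j * D) - (q * xi0) *: (c * u * x 0 j * D).
Proof.
move=> Du; have DuE k v : v * D * u * x k j = v * u * x k j * D.
  by rewrite -!mulrA; congr (v * _); rewrite mulrA Du -!mulrA xD.
elim/ord2P: i; rewrite /coad sum2 /antipode_x /= ?mulNr -!scalerAl !DuE.
  by rewrite scalerN scalerA mulrC.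
by rewrite addrC scalerN scalerA [q * _]mulrC.
Qed.

Section CoadLine.
Variables (e : A) (u v w : K).
Hypothesis De : GRing.comm D e.
Hypothesis eda : d * e * a * D = horner_alg sphz (u%:P + v *: 'X) * e.
Hypothesis ebc : b * e * c * D = w *: (sphz * e).

(** Of the two terms in [coadE], the one with [d] dilates [f] by q^-2, because [d] passes z with
    that factor, and the one with [b] leaves [f] alone, because [b] commutes with z. *)
Lemma coad_line f :
  coad xi 0 0 (horner_alg sphz f * e) =
  horner_alg sphz (dilate (q ^- 2) f * ((xi0 * u)%:P + (xi0 * v) *: 'X)
                   - ((q^-1 * xi1 * w) *: 'X) * f) * e.
Proof.
have Df := horner_alg_comm f D_comm_z.
rewrite coadE ?eqxx; last exact: commrM.
set F := horner_alg sphz f.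
have -> : d * (F * e) * a * D = horner_alg sphz (dilate (q ^- 2) f) * (d * e * a * D).
  by rewrite !mulrA (horner_alg_qcomm f qcomm_dz).
have -> : b * (F * e) * c * D = F * (b * e * c * D).
  by rewrite !mulrA (horner_alg_comm f comm_bz).
have -> : dilate (q ^- 2) f * ((xi0 * u)%:P + (xi0 * v) *: 'X) - ((q^-1 * xi1 * w) *: 'X) * f
    = xi0 *: (dilate (q ^- 2) f * (u%:P + v *: 'X)) - (q^-1 * xi1 * w) *: (f * 'X).
  by rewrite -!mul_polyC !polyCM; ring.
rewrite eda ebc raddfB /= !horner_algZ !rmorphM /= horner_algX mulrBl -!scalerAl -!mulrA.
by rewrite -scalerAr scalerA -!mulrA.
Qed.

End CoadLine.

Hypothesis xi_gen : forall n, xi0 * (q ^- 2) ^+ n != xi1.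

(* [coad xi 0 0] acts on the line [K[z] e] as a triangular operator with nonzero
   diagonal: this is where the genericity of [xi] enters. *)
Definition coad_raises (e : A) := forall f, exists2 g,
  coad xi 0 0 (horner_alg sphz f * e) = horner_alg sphz g * e &
  size g = ((f != 0%R) + size f)%N.

Lemma coad_raisesP e u v w : GRing.comm D e ->
  d * e * a * D = horner_alg sphz (u%:P + v *: 'X) * e ->
  b * e * c * D = w *: (sphz * e) ->
  (forall n, xi0 * v * (q ^- 2) ^+ n != q^-1 * xi1 * w) -> coad_raises e.
Proof.
move=> De eda ebc gen f; have [-> /=|f0] := eqVneq f 0.
  exists 0; last by rewrite ?eqxx size_poly0.
  rewrite (coad_line De eda ebc) /dilate comp_poly0 mul0r mulr0 subr0 raddf0 //.
exists (dilate (q ^- 2) f * ((xi0 * u)%:P + (xi0 * v) *: 'X) - ((q^-1 * xi1 * w) *: 'X) * f).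
  exact: coad_line.
by rewrite size_dilate_shift // invr_neq0 // expf_neq0.
Qed.

Lemma q_exprV m : q ^+ m * (q ^- 2) ^+ m = q^-1 ^+ m.
Proof. by rewrite -exprMn; congr (_ ^+ _); field. Qed.

(** The scalars [u], [v], [w] arise from carrying r^m to the left past [d] and [b] and then past z.
    Since v = q^-1 q^(-2m) w, the condition at [n] is [xi_gen] at [m + n]. *)
Lemma coad_raises_r m : coad_raises (sphr ^+ m).
Proof.
have Dr := commrX m D_comm_r.
apply: (@coad_raisesP _ (q^-1 ^+ m) (q^-1 ^+ m * q^-1 * (q ^- 2) ^+ m) (q^-1 ^+ m)) => //.
- have -> : d * sphr ^+ m * a * D = q^-1 ^+ m *: (sphr ^+ m * (d * a * D)).
    by rewrite (qcommXr m qcomm_dr) -!scalerAl !mulrA.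
  rewrite mul_daD mulrDr mulr1 -scalerAr (qcommXl m qcomm_rz) rmorphD /= horner_algC horner_algZX mulrDl mulr_algl -scalerAl.
  by rewrite scalerDr !scalerA.
- have -> : b * sphr ^+ m * c * D = q ^+ m *: (sphr ^+ m * sphz).
    by rewrite (qcommXr m qcomm_br) -!scalerAl [in RHS]/sphz !mulrA.
  rewrite (qcommXl m qcomm_rz).
  by rewrite scalerA q_exprV.
move=> n; have -> : xi0 * (q^-1 ^+ m * q^-1 * (q ^- 2) ^+ m) * (q ^- 2) ^+ n
    = (q^-1 * q^-1 ^+ m) * (xi0 * (q ^- 2) ^+ (m + n)) by rewrite exprD; ring.
have -> : q^-1 * xi1 * q^-1 ^+ m = (q^-1 * q^-1 ^+ m) * xi1 by ring.
by rewrite (inj_eq (mulfI _)) // mulf_neq0 ?expf_neq0 ?invr_neq0.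
Qed.

(** Now p^m is carried to the right, past [a] and [c], and never meets z. The ratio of [v] to [w] is
    again q^-1 q^(-2m). *)
Lemma coad_raises_p m : coad_raises (sphp ^+ m).
Proof.
have Dp := commrX m D_comm_p.
have pD : sphp ^+ m * D = D * sphp ^+ m by [].
apply: (@coad_raisesP _ (q^-1 ^+ m) (q^-1 ^+ m * q^-1) (q ^+ m)) => //.
- have -> : d * sphp ^+ m * a * D = q^-1 ^+ m *: (d * a * D * sphp ^+ m).
    by rewrite -!mulrA [_ * (a * D)]mulrA (qcommXl m qcomm_pa) -scalerAl -[a * _ * D]mulrA pD -scalerAr !mulrA.
  rewrite mul_daD rmorphD /= horner_algC horner_algZX !mulrDl.
  by rewrite mulr_algl mul1r scalerDr -!scalerAl scalerA.
- by rewrite -!mulrA [_ * (c * D)]mulrA (qcommXl m qcomm_pc) -scalerAl -[c * _ * D]mulrA pD -scalerAr !mulrA.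
move=> n; have -> : xi0 * (q^-1 ^+ m * q^-1) * (q ^- 2) ^+ n
    = (q^-1 * q ^+ m) * (xi0 * (q ^- 2) ^+ (m + n)) by rewrite exprD -q_exprV; ring.
have -> : q^-1 * xi1 * q ^+ m = (q^-1 * q ^+ m) * xi1 by ring.
by rewrite (inj_eq (mulfI _)) // mulf_neq0 ?expf_neq0 ?invr_neq0.
Qed.

(** The factor is a power of q times xi0 q^(-2m) - xi1, nonzero by [xi_gen]; the same difference
    appears in [coad10_p]. *)
Lemma coad01_r m : exists2 k, k != 0 & coad xi 0 1 (sphr ^+ m) = k *: sphr ^+ m.+1.
Proof.
have rD := esym (commrX m D_comm_r : D * _ = _ * D).
have dbD : d * b * D = q^-1 *: sphr by rewrite /sphr; qnormal.
exists (q^-1 * q ^+ m * (xi0 * (q ^- 2) ^+ m - xi1)).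
  by rewrite !mulf_neq0 ?expf_neq0 ?invr_neq0 // subr_eq0.
rewrite coadE ?eqxx; last exact: commrX D_comm_r.
rewrite (qcommXr m qcomm_dr) (qcommXr m qcomm_br) -!scalerAl.
have mulrA3 u v w : sphr ^+ m * u * v * w = sphr ^+ m * (u * v * w) by rewrite !mulrA.
rewrite !mulrA3 dbD -/sphr -!scalerAr -exprSr !scalerA -scalerBl.
by congr (_ *: _); rewrite -q_exprV; ring.
Qed.

Lemma coad10_p m : exists2 k, k != 0 & coad xi 1 0 (sphp ^+ m) = k *: sphp ^+ m.+1.
Proof.
have pD : sphp ^+ m * D = D * sphp ^+ m := esym (commrX m D_comm_p).
have caD : c * a * D = q^-1 *: sphp by rewrite /sphp; qnormal.
exists (- q ^+ m * (xi0 * (q ^- 2) ^+ m - xi1)).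
  by rewrite !mulf_neq0 ?oppr_eq0 ?expf_neq0 // subr_eq0.
rewrite coadE /=; last exact: commrX D_comm_p.
have mulpD y y' l : sphp * y' = l *: (y' * sphp) ->
    y * sphp ^+ m * y' * D = l ^+ m *: (y * y' * D * sphp ^+ m).
  by move=> py; rewrite -!mulrA [_ * (y' * D)]mulrA (qcommXl m py) -scalerAl -[y' * _ * D]mulrA pD -scalerAr.
rewrite (mulpD _ _ _ qcomm_pa) (mulpD _ _ _ qcomm_pc) caD -/sphp -!scalerAl -exprS !scalerA -scalerBl.
by congr (_ *: _); rewrite -q_exprV; field.
Qed.

(** The products [a d], [d a] and [b c] are polynomials in z times [det], so one letter of each pair
    is enough. The factor [det ^+ m * D ^+ n] encodes the integer power m - n of [det]. Each
    monomial is a weight vector for the left torus ([torus_act_mono]). *)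
Definition sphere_mono (s t : bool) (i j : nat) (f : {poly K}) (m n : nat) : A :=
  (if s then a else d) ^+ i * (if t then b else c) ^+ j * horner_alg sphz f
  * (det ^+ m * D ^+ n).

Definition sphere_monos : set A :=
  [set u | exists s t i j f m n, u = sphere_mono s t i j f m n].

Lemma det_comm i j : GRing.comm (x i j) det.
Proof. exact: qdet_central. Qed.

Lemma sphere_monos_D u : sphere_monos u -> sphere_monos (u * D).
Proof.
move=> [s [t [i [j [f [m [n ->]]]]]]]; exists s, t, i, j, f, m, n.+1.
by rewrite /sphere_mono exprSr !mulrA.
Qed.

Lemma sphere_mono_mulx s t i j f m n k l :
  sphere_mono s t i j f m n * x k l
  = sphere_mono s t i j f 0 0 * x k l * (det ^+ m * D ^+ n).
Proof.
have xDm : GRing.comm (x k l) (det ^+ m * D ^+ n).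
  by apply: commrM; apply: commrX; [apply: det_comm | apply/commr_sym/D_comm].
by rewrite /sphere_mono !mulr1 -[_ * x k l]mulrA -xDm mulrA.
Qed.

Lemma sphere_monos_central u m n : sphere_monos u -> sphere_monos (u * (det ^+ m * D ^+ n)).
Proof.
move=> [s [t [i [j [f [m' [n' ->]]]]]]]; exists s, t, i, j, f, (m' + m)%N, (n' + n)%N.
have Ddet : GRing.comm D det by rewrite /GRing.comm detD D_det.
rewrite /sphere_mono !exprD -!mulrA; do 3!congr (_ * _).
by rewrite !mulrA; congr (_ * _); rewrite -!mulrA; congr (_ * _); apply/commrX/commr_sym/commrX.
Qed.

(** The new letter is carried left to its block. The same letter raises the exponent there; the
    opposite letter cancels against one of the block into [det] times a polynomial in z, or takes
    over the block if it is empty. *)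
Lemma sphere_monos_x u k l : sphere_monos u -> sphere_monos (u * x k l).
Proof.
move=> [s [t [i [j [f [m [n ->]]]]]]]; rewrite sphere_mono_mulx.
apply: sphere_monos_central => {m n}; rewrite /sphere_mono !mulr1.
pose y s : A := if s then a else d; pose w t : A := if t then b else c.
pose ly s : K := if s then q^-1 else q.
have ly_neq0 r : ly r != 0 by case: r; rewrite /= ?invr_neq0.
have wz r : GRing.comm (w r) sphz by case: r; [apply: comm_bz | apply: comm_cz].
have wy r r' : w r * y r' = ly r' *: (y r' * w r).
  by case: r; case: r'; rewrite /w /y /=; qnormal.
have zy r : sphz * y r = ly r ^+ 2 *: (y r * sphz).
  by case: r; rewrite /y /sphz /=; qnormal.
have detDK v : v * D * det = v by rewrite -mulrA D_det mulr1.
have det_z : GRing.comm det sphz.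
  by do ?apply: commrM; do ?exact/commr_sym/det_comm; rewrite /GRing.comm detD D_det.
have yy r : y (~~ r) * y r = (1 + ly r *: sphz) * det.
  by case: r; rewrite /y /= -?mul_daD -?mul_adD detDK.
have ww r : w r * w (~~ r) = sphz * det.
  by rewrite /sphz detDK; case: r; rewrite /w /= ?ord.
have step_w r : sphere_monos (y s ^+ i * w t ^+ j * horner_alg sphz f * w r).
  rewrite -mulrA -(horner_alg_comm f (wz r)) mulrA.
  have [->|tr] := eqVneq r t.
    by exists s, t, i, j.+1, f, 0, 0; rewrite /sphere_mono !mulr1 exprSr !mulrA.
  have {tr}-> : r = ~~ t by move: tr; case: r t => [] [].
  case: j => [|j]; first by exists s, (~~ t), i, 1, f, 0, 0; rewrite /sphere_mono !mulr1.
  exists s, t, i, j, ('X * f), 1, 0.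
  rewrite /sphere_mono mulr1 rmorphM /= horner_algX exprSr expr1.
  have mulrA4 v1 v2 v F : v1 * (v2 * w t) * v * F = v1 * v2 * (w t * v) * F by rewrite !mulrA.
  rewrite mulrA4 ww -[LHS]mulrA -[RHS]mulrA; congr (_ * _).
  by rewrite -[LHS]mulrA -[RHS]mulrA (horner_alg_comm f det_z).
have step_y r : sphere_monos (y s ^+ i * w t ^+ j * horner_alg sphz f * y r).
  rewrite -mulrA (horner_alg_qcommr f (zy r)) mulrA -[_ * _ * y r]mulrA (qcommXl j (wy t r)).
  set g := dilate _ f.
  rewrite -scalerAr mulrA -!scalerAl -[_ * horner_alg _ _]mulrA.
  rewrite [_ *: _]scalerAr [_ *: _]scalerAr -horner_algZ.
  set h := _ *: g; rewrite mulrA.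
  have [->|sr] := eqVneq r s.
    by exists s, t, i.+1, j, h, 0, 0; rewrite /sphere_mono !mulr1 -exprSr.
  have {sr}-> : r = ~~ s by move: sr; case: (r); case: (s).
  case: i {step_w} => [|i]; first by exists (~~ s), t, 1, j, h, 0, 0; rewrite /sphere_mono !mulr1 mul1r.
  exists s, t, i, j, ((1 + ly (~~ s) *: 'X) * h), 1, 0.
  have ysy : y s * y (~~ s) = (1 + ly (~~ s) *: sphz) * det by rewrite -yy negbK.
  rewrite /sphere_mono mulr1 expr1 rmorphM rmorphD /= rmorph1 horner_algZX.
  rewrite exprSr -[_ * y s * _]mulrA ysy -/(y s) -/(w t).
  have : GRing.comm (w t ^+ j) (1 + ly (~~ s) *: sphz).
    apply: commrD; first exact: commr1.
    by rewrite /GRing.comm -scalerAr -scalerAl; congr (_ *: _); apply/commr_sym/commrX/commr_sym.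
  have : GRing.comm det (w t ^+ j).
    by apply: commrX; rewrite /w; case: (t); apply/commr_sym/det_comm.
  have := horner_alg_comm h det_z; rewrite /GRing.comm.
  move: (horner_alg sphz h) (1 + _) (w t ^+ j) => H L W dH dW WL.
  by rewrite -!mulrA [det * (W * _)]mulrA dW -mulrA dH [L * (W * _)]mulrA -WL -!mulrA.
elim/ord2P: k; elim/ord2P: l.
- exact: (step_y true).
- exact: (step_w true).
- exact: (step_w false).
- exact: (step_y false).
Qed.

(** The index is the right torus weight ([rtorus_line]). As [Negz m] denotes -(m+1), the line of
    polynomials in z occurs only at index 0. *)
Definition sphere_line (i : int) : set A :=
  [set u | exists f, u = horner_alg sphz f * (if i is Posz m then sphr ^+ m
                                              else sphp ^+ `|i|)].

Definition sphere : set A := span [set u | exists i, sphere_line i u].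

Lemma sphere_line_r f m : sphere (horner_alg sphz f * sphr ^+ m).
Proof. by apply: span_gen; exists (Posz m), f. Qed.

Lemma sphere_line_p f m : sphere (horner_alg sphz f * sphp ^+ m).
Proof.
apply: span_gen; case: m => [|m]; first by exists 0, f.
by exists (Negz m), f.
Qed.

Lemma detX_DX m i : det ^+ m * D ^+ (i + m) = D ^+ i.
Proof.
have detD' : det * D = 1 by [].
have comm_D : GRing.comm det D by rewrite /GRing.comm detD D_det.
by rewrite addnC exprD mulrA -exprMn_comm // detD' expr1n mul1r.
Qed.

(** These are monomials of left weight zero: the surplus [D ^+ i] pairs off with [i] letters [y] and
    [i] letters [w]. The scalar [k] comes from reordering (y w)^i, the dilation from carrying f(z)
    to the left. *)
Lemma mono_diag (y w : A) l l' i f m :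
  GRing.comm D y -> GRing.comm D w -> l != 0 -> w * y = l *: (y * w) ->
  y * w * D * sphz = l' *: (sphz * (y * w * D)) ->
  exists g, y ^+ i * w ^+ i * horner_alg sphz f * (det ^+ m * D ^+ (i + m))
            = horner_alg sphz g * (y * w * D) ^+ i.
Proof.
move=> Dy Dw l0 wy ez; have [k k0 ywi] := exprM_qcomm i l0 wy.
exists (k^-1 *: dilate (l' ^+ i) f).
have Fi : GRing.comm (horner_alg sphz f) (D ^+ i).
  by apply/commrX/commr_sym/horner_alg_comm/D_comm_z.
rewrite detX_DX -mulrA Fi horner_algZ -scalerAl -(horner_alg_qcomm _ (qcommXl i ez)).
rewrite exprMn_comm; last exact/commr_sym/commrM.
by rewrite ywi -!scalerAl scalerA mulVf // scale1r !mulrA.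
Qed.

Lemma sphere_mono_p i f m : sphere (sphere_mono true false i i f m (i + m)).
Proof.
have [||g e] := @mono_diag a c q^-1 (q ^+ 2) i f m (D_comm _ _) (D_comm _ _) _ _ qcomm_pz.
- by rewrite invr_neq0.
- by rewrite ord.
by rewrite /sphere_mono e; apply: sphere_line_p.
Qed.

Lemma sphere_mono_r i f m : sphere (sphere_mono false true i i f m (i + m)).
Proof.
have dbD : d * b * D = q^-1 *: sphr by rewrite /sphr; qnormal.
have [||g e] := @mono_diag d b q (q ^- 2) i f m (D_comm _ _) (D_comm _ _) q_neq0.
- by rewrite ord scalerA mulfV // scale1r.
- by rewrite dbD -scalerAl qcomm_rz -!scalerAr !scalerA mulrC.
rewrite /sphere_mono e dbD exprZn -scalerAr scalerAl -horner_algZ.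
exact: sphere_line_r.
Qed.

Lemma sphere_mono_z s t f m : sphere (sphere_mono s t 0 0 f m m).
Proof. by have := sphere_mono_p 0 f m; rewrite /sphere_mono. Qed.


End QuantumSphere.

(** * The co-orbit maps as module actions *)

Section Generation.
Variables (K : fieldType) (q : K).

Lemma pres_alg_ind (G : Type) (rel : aexpr K G -> aexpr K G -> Prop) (P : pres rel -> Prop) :
  (forall g, P (pgen rel g)) -> P 1 -> (forall c u v, P u -> P v -> P (c *: u + v)) ->
  (forall u v, P u -> P v -> P (u * v)) -> forall u, P u.
Proof.
move=> Pg P1 PL PM; have P0 : P 0 by have := PL (-1) 1 1 P1 P1; rewrite scaleN1r addNr.
elim/pres_ind; elim=> [g|||x IHx|x IHx y IHy|x IHx y IHy|c x IHx].
- exact: Pg.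
- exact: P0.
- exact: P1.
- rewrite -poppE -[popp _]/(- (_ : pres rel)) -[- _]addr0 -scaleN1r; exact: PL.
- by rewrite -paddE -[padd _ _]/((_ : pres rel) + _) -[X in X + _]scale1r; apply: PL.
- by rewrite -pmulE -[pmul _ _]/((_ : pres rel) * _); apply: PM.
- by rewrite -pscaleE -[pscale _ _]/(_ *: (_ : pres rel)) -[_ *: _]addr0; apply: PL.
Qed.

Lemma Mq_ind (P : OMq q -> Prop) :
  (forall i j, P (xM q i j)) -> P 1 -> (forall c u v, P u -> P v -> P (c *: u + v)) ->
  (forall u v, P u -> P v -> P (u * v)) -> forall u, P u.
Proof. by move=> Px P1 PL PM; apply: pres_alg_ind => // -[i j]; apply: Px. Qed.

Lemma GLq_ind (P : OGLq q -> Prop) :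
  (forall i j, P (xG q i j)) -> P (detV q) -> P 1 ->
  (forall c u v, P u -> P v -> P (c *: u + v)) ->
  (forall u v, P u -> P v -> P (u * v)) -> forall u, P u.
Proof.
move=> Px PD P1 PL PM; apply: pres_alg_ind => // -[h|]; last exact: PD.
rewrite -/(iota h); elim/Mq_ind: h => [i j||c u v Pu Pv|u v Pu Pv].
- exact: Px.
- by rewrite rmorph1.
- by rewrite linearP; apply: PL.
- by rewrite rmorphM; apply: PM.
Qed.

Lemma Mq_mulr_ind (P : OMq q -> Prop) :
  P 1 -> P 0 -> (forall c u v, P u -> P v -> P (c *: u + v)) ->
  (forall u i j, P u -> P (u * xM q i j)) -> forall u, P u.
Proof.
move=> P1 P0 PL Px u; rewrite -[u]mul1r; move: 1 P1.
elim/Mq_ind: u => [i j v /Px//|v|c u v IHu IHv w Pw|u v IHu IHv w Pw].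
- by rewrite mulr1.
- by rewrite mulrDr -scalerAr; apply: PL; [apply: IHu | apply: IHv].
- by rewrite mulrA; apply/IHv/IHu.
Qed.

Lemma GLq_mulr_ind (P : OGLq q -> Prop) :
  P 1 -> (forall c u v, P u -> P v -> P (c *: u + v)) ->
  (forall u i j, P u -> P (u * xG q i j)) -> (forall u, P u -> P (u * detV q)) ->
  forall u, P u.
Proof.
move=> P1 PL Px PD u; rewrite -[u]mul1r; move: 1 P1.
elim/GLq_ind: u => [i j v /Px//|v /PD//|v|c u v IHu IHv w Pw|u v IHu IHv w Pw].
- by rewrite mulr1.
- by rewrite mulrDr -scalerAr; apply: PL; [apply: IHu | apply: IHv].
- by rewrite mulrA; apply/IHv/IHu.
Qed.

Lemma qdet_xG : qdet q (xG q) = iota (detM q).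
Proof. by rewrite /qdet /xG -!rmorphM -linearZ -raddfB. Qed.

Lemma qdet_detV : qdet q (xG q) * detV q = 1.
Proof. by rewrite qdet_xG Defs.detMV. Qed.

End Generation.

Section CoOrbitMaps.
Variables (K : fieldType) (q : K) (q_neq0 : q != 0).
Variables (xi : 'M[K]_2) (xi_diag : is_diag_mx xi).

Local Notation beta_xi := (beta_orbit xi_diag q_neq0).
Local Notation alpha_xi := (alpha_orbit xi_diag q_neq0).
Local Notation S := (antipode q_neq0).

Lemma Delta3_linear : linear (Delta3 q_neq0).
Proof. by move=> c u v; rewrite /Delta3 [Delta _ _]linearP [LHS]linearP. Qed.

Lemma beta_orbit_linear : linear beta_xi.
Proof.
move=> c u v; rewrite /beta_orbit /beta Delta3_linear /ev_id.
by rewrite !tens_liftD !tens_liftZ.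
Qed.
HB.instance Definition _ :=
  GRing.isLinear.Build K (OMq q) (OGLq q) _ (beta_orbit xi_diag q_neq0) beta_orbit_linear.

Lemma alpha_orbit_linear : linear alpha_xi.
Proof.
move=> c u v; rewrite /alpha_orbit /alpha Delta3_linear /ev_id.
by rewrite !tens_liftD !tens_liftZ.
Qed.
HB.instance Definition _ :=
  GRing.isLinear.Build K (OMq q) (OGLq q) _ (alpha_orbit xi_diag q_neq0) alpha_orbit_linear.

Lemma antipode_xG i j : S (xG q i j) = antipode_x q (xG q) (detV q) i j.
Proof. by rewrite [LHS]GLq_hom_iota [LHS]Mq_homE. Qed.

Let beta_of (w : (OMq q ⊗ OMq q) ⊗ OMq q) : OGLq q :=
  ev_id xi_diag (tens_lift (beta_bilinear q_neq0) w).
Let alpha_of (w : (OMq q ⊗ OMq q) ⊗ OMq q) : OGLq q :=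
  ev_id xi_diag (tens_lift (alpha_bilinear q_neq0) w).

Let beta_ofE (a b c : OMq q) :
  beta_of ((a ⊗ b) ⊗ c) = (ev xi_diag b : K) *: (S (iota a) * iota c).
Proof. by rewrite /beta_of !tens_liftE /ev_id tens_liftE. Qed.
Let alpha_ofE (a b c : OMq q) :
  alpha_of ((a ⊗ b) ⊗ c) = (ev xi_diag b : K) *: (iota c * S (iota a)).
Proof. by rewrite /alpha_of !tens_liftE /ev_id tens_liftE. Qed.

Let beta_of_lin : linear beta_of.
Proof. by move=> k u v; rewrite /beta_of /ev_id !tens_liftD !tens_liftZ. Qed.
Let alpha_of_lin : linear alpha_of.
Proof. by move=> k u v; rewrite /alpha_of /ev_id !tens_liftD !tens_liftZ. Qed.

Lemma tens3_ind (P : (OMq q ⊗ OMq q) ⊗ OMq q -> Prop) :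
  (forall a b c, P ((a ⊗ b) ⊗ c)) -> P 0 ->
  (forall k u v, P u -> P v -> P (k *: u + v)) -> forall u, P u.
Proof.
move=> Pp P0 PL; elim/tens_ind_lin=> [w c||u v Pu Pv|k u Pu] //.
- elim/tens_ind_lin: w => [a b||u v Pu Pv|k u Pu] //.
  + by rewrite tens0l.
  + by rewrite tensDl -[_ ⊗ _]scale1r; apply: PL.
  + by rewrite tensZl -[_ *: _]addr0; apply: PL.
- by rewrite -[u]scale1r; apply: PL.
- by rewrite -[_ *: _]addr0; apply: PL.
Qed.

Lemma Delta3_x i j :
  Delta3 q_neq0 (xM q i j) = \sum_k \sum_l (xM q i l ⊗ xM q l k) ⊗ xM q k j.
Proof.
rewrite /Delta3 Delta_xE raddf_sum; apply: eq_bigr => k _ /=.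
by rewrite tens_mapE [X in X ⊗ _]Delta_xE !sum2 tensDl.
Qed.

Lemma Delta3M u v : Delta3 q_neq0 (u * v) = Delta3 q_neq0 u * Delta3 q_neq0 v.
Proof. by rewrite /Delta3 !rmorphM. Qed.

Let beta_of0 : beta_of 0 = 0.
Proof. by rewrite /beta_of /ev_id !tens_lift0. Qed.
Let alpha_of0 : alpha_of 0 = 0.
Proof. by rewrite /alpha_of /ev_id !tens_lift0. Qed.
Let beta_ofD u v : beta_of (u + v) = beta_of u + beta_of v.
Proof. by rewrite -[u]scale1r beta_of_lin !scale1r. Qed.
Let alpha_ofD u v : alpha_of (u + v) = alpha_of u + alpha_of v.
Proof. by rewrite -[u]scale1r alpha_of_lin !scale1r. Qed.

(** Since S(a'a) = S(a)S(a'), a factor on the right wraps around the previous value. In [alpha_ofM]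
    it is a factor on the left that does so, whence a right ideal for beta and a left ideal for
    alpha. *)
Let beta_ofM (u : (OMq q ⊗ OMq q) ⊗ OMq q) (a b c : OMq q) :
  beta_of (u * ((a ⊗ b) ⊗ c)) = (ev xi_diag b : K) *: (S (iota a) * beta_of u * iota c).
Proof.
elim/tens3_ind: u => [a' b' c'||k u v IHu IHv].
- rewrite !tensM !beta_ofE !rmorphM /= antipodeM.
  by rewrite -scalerAr -scalerAl scalerA mulrC !mulrA.
- by rewrite mul0r beta_of0 mulr0 mul0r scaler0.
- rewrite mulrDl -scalerAl !beta_of_lin IHu IHv mulrDr mulrDl scalerDr.
  by rewrite -scalerAr -scalerAl !scalerA [in LHS]mulrC.
Qed.

Let alpha_ofM (u : (OMq q ⊗ OMq q) ⊗ OMq q) (a b c : OMq q) :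
  alpha_of (((a ⊗ b) ⊗ c) * u) = (ev xi_diag b : K) *: (iota c * alpha_of u * S (iota a)).
Proof.
elim/tens3_ind: u => [a' b' c'||k u v IHu IHv].
- rewrite !tensM !alpha_ofE !rmorphM /= antipodeM.
  by rewrite -scalerAr -scalerAl scalerA !mulrA.
- by rewrite mulr0 alpha_of0 mulr0 mul0r scaler0.
- rewrite mulrDr -scalerAr !alpha_of_lin IHu IHv mulrDr mulrDl scalerDr.
  by rewrite -scalerAr -scalerAl !scalerA [in LHS]mulrC.
Qed.

Lemma xi_off : (xi 0 1 = 0) * (xi 1 0 = 0).
Proof. by split; apply/(is_diag_mxP xi_diag). Qed.

Lemma beta_orbitMx h i j :
  beta_xi (h * xM q i j) = coad q (xG q) (detV q) xi i j (beta_xi h).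
Proof.
rewrite -[LHS]/(beta_of (Delta3 q_neq0 (h * xM q i j))) Delta3M Delta3_x !sum2.
rewrite !mulrDr !beta_ofD !beta_ofM !ev_xE !xi_off !scale0r addr0 add0r.
by rewrite /coad sum2 -!antipode_xG.
Qed.

Lemma alpha_orbitMx h i j :
  alpha_xi (xM q i j * h) =
  \sum_k xi k k *: (xG q k j * alpha_xi h * antipode_x q (xG q) (detV q) i k).
Proof.
rewrite -[LHS]/(alpha_of (Delta3 q_neq0 (xM q i j * h))) Delta3M Delta3_x !sum2.
rewrite !mulrDl !alpha_ofD !alpha_ofM !ev_xE !xi_off !scale0r addr0 add0r.
by rewrite -!antipode_xG.
Qed.

Lemma Delta3_det : Delta3 q_neq0 (detM q) = (detM q ⊗ detM q) ⊗ detM q.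
Proof. by rewrite /Delta3 Delta_det tens_mapE [X in X ⊗ _]Delta_det. Qed.

Lemma Delta3_1 : Delta3 q_neq0 1 = (1 ⊗ 1) ⊗ 1.
Proof. by rewrite /Delta3 !rmorph1. Qed.

Lemma beta_orbit1 : beta_xi 1 = 1.
Proof.
rewrite -[LHS]/(beta_of (Delta3 q_neq0 1)) Delta3_1 beta_ofE.
by rewrite !rmorph1 antipode1 mulr1 scale1r.
Qed.

Lemma alpha_orbit1 : alpha_xi 1 = 1.
Proof.
rewrite -[LHS]/(alpha_of (Delta3 q_neq0 1)) Delta3_1 alpha_ofE.
by rewrite !rmorph1 antipode1 mulr1 scale1r.
Qed.

(** The quantum determinant is group-like, and S(det) cancels against det. *)
Lemma beta_orbit_det : beta_xi (detM q) = (ev xi_diag (detM q) : K)%:A.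
Proof.
rewrite -[LHS]/(beta_of (Delta3 q_neq0 (detM q))) Delta3_det beta_ofE.
have -> : S (iota (detM q)) = detV q.
  exact: etrans (GLq_hom_iota _ _ _) (antipode_iota_det _).
by rewrite Defs.detVM.
Qed.

End CoOrbitMaps.

(** * Torus coinvariants *)

Section TorusCoinvariants.
Variables (K : fieldType) (q : K) (q_neq0 : q != 0).

Local Notation lambda := (lambdaD q_neq0).
Local Notation x := (xG q).
Local Notation D := (detV q).
Local Notation mono := (sphere_mono q (xG q) (detV q)).

(** z, p and r are all of the form x_0i x_1j D, one entry from each row. Used for the coinvariants
    and again for the coideal property. *)
Lemma subalgebra_sphere (B : set (OGLq q)) : subalgebra B ->
  (forall i j, B (x 0 i * x 1 j * D)) -> sphere x D `<=` B.
Proof.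
move=> [B1 BL BM] Bx; have B0 : B 0 by have := BL (-1) 1 1 B1 B1; rewrite scaleN1r addNr.
have BX g m : B g -> B (g ^+ m).
  by move=> Bg; elim: m => [|m IHm]; rewrite ?expr0 // exprS; apply: BM.
apply: span_sub => // _ [i [f ->]]; apply: (BM); last by case: i => m; apply/BX/Bx.
elim/poly_ind: f => [|f k Bf]; first by rewrite raddf0.
rewrite rmorphD rmorphM /= horner_algX horner_algC addrC.
by apply: BL => //; apply: BM => //; apply: Bx.
Qed.

Lemma lambdaD_linear : linear lambda.
Proof.
have DL c u v : DeltaGL q_neq0 (c *: u + v) = c *: DeltaGL q_neq0 u + DeltaGL q_neq0 v.
  exact: linearP.
by move=> c u v; rewrite /lambdaD DL /tens_map tens_liftD tens_liftZ.
Qed.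

Lemma lambdaDM u v : lambda (u * v) = lambda u * lambda v.
Proof. by rewrite /lambdaD [DeltaGL _ _]rmorphM [LHS]rmorphM. Qed.

Lemma lambdaD1 : lambda 1 = 1 ⊗ 1.
Proof. by rewrite /lambdaD [DeltaGL _ _]rmorph1 [LHS]rmorph1. Qed.

Definition weight (th : OD K) (g : OGLq q) : Prop := lambda g = th ⊗ g.

Lemma weight1 : weight 1 1. Proof. exact: lambdaD1. Qed.

Lemma weightM th th' g g' : weight th g -> weight th' g' -> weight (th * th') (g * g').
Proof. by rewrite /weight lambdaDM => -> ->; rewrite tensM. Qed.

Lemma weightX th g n : weight th g -> weight (th ^+ n) (g ^+ n).
Proof.
move=> thg; elim: n => [|n IHn]; first exact: weight1.
by rewrite !exprS; apply: weightM.
Qed.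

Lemma weight_lin th c g g' : weight th g -> weight th g' -> weight th (c *: g + g').
Proof. by rewrite /weight lambdaD_linear => -> ->; rewrite tensDr tensZr. Qed.

Lemma weight_horner g f : weight 1 g -> weight 1 (horner_alg g f).
Proof.
move=> wg; have w0 : weight 1 0 by have := weight_lin (-1) weight1 weight1; rewrite scaleN1r addNr.
elim/poly_ind: f => [|f c IHf]; first by rewrite raddf0.
rewrite rmorphD rmorphM /= horner_algX horner_algC addrC.
apply: weight_lin; first exact: weight1.
by rewrite -[1]mul1r; apply: weightM.
Qed.

Lemma weight_x i j : weight (tD K i) (x i j).
Proof.
rewrite /weight /lambdaD DeltaGL_xE raddf_sum sum2 /= !tens_mapE /= !piD_xE.
by elim/ord2P: i; rewrite /= mul0r mul1r tens0l ?addr0 ?add0r.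
Qed.

Lemma DeltaGL_detV : DeltaGL q_neq0 D = D ⊗ D.
Proof. exact: GLq_hom_detV. Qed.

Lemma weight_detV : weight (tDV K 1 * tDV K 0) D.
Proof.
rewrite /weight /lambdaD DeltaGL_detV tens_mapE /=.
by congr (_ ⊗ _); apply: GLq_hom_detV.
Qed.

Lemma weight_det : weight (tD K 0 * tD K 1) (qdet q x).
Proof.
rewrite qdet_xG /weight /lambdaD DeltaGL_iota Delta_det !tens_mapE /=.
by congr (_ ⊗ _); apply: etrans (GLq_hom_iota _ _ _) (piD_det q).
Qed.

Lemma weight_sphere_gen i j : weight 1 (x 0 i * x 1 j * D).
Proof.
have -> : 1 = tD K 0 * tD K 1 * (tDV K 1 * tDV K 0).
  by rewrite mulrA -(mulrA (tD K 0)) tVr mulr1 tVr.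
by do !apply: weightM; [apply: weight_x | apply: weight_x | apply: weight_detV].
Qed.

Lemma OD_GLq_subalgebra : subalgebra (OD_GLq q_neq0).
Proof.
split=> [|c u v|u v]; first exact: weight1.
  exact: weight_lin.
by move=> u1 v1; have := weightM u1 v1; rewrite mulr1.
Qed.

Lemma sphere_OD : sphere x D `<=` OD_GLq q_neq0.
Proof. exact: subalgebra_sphere OD_GLq_subalgebra weight_sphere_gen. Qed.

Section Character.
Variables (u0 u1 : K) (u0_neq0 : u0 != 0) (u1_neq0 : u1 != 0).

Let ch_gen (g : 'I_2 * bool) : K^o :=
  let u := if g.1 == 0 then u0 else u1 in if g.2 then u else u^-1.

Lemma ch_respects : respects (@torus_rel K) ch_gen.
Proof.
move=> ? ? [g h|i] /=; first exact: (@mulrC K).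
by rewrite /ch_gen /=; case: ifP => _; apply: (@mulfV K).
Qed.

Definition torus_char : OD K -> K^o := pres_hom ch_respects.
HB.instance Definition _ := GRing.RMorphism.on torus_char.
HB.instance Definition _ := GRing.Linear.on torus_char.

Lemma torus_act_bilinear :
  is_bilinear (fun (th : OD K) (g : OGLq q) => (torus_char th : K) *: g).
Proof.
split=> [b k a a'|a k b b']; first by rewrite linearP /= scalerDl scalerA.
by rewrite scalerDr !scalerA mulrC.
Qed.

(** Evaluating the coaction at the point (u0, u1) of the torus makes coinvariants into fixed vectors
    of a linear operator. *)
Definition torus_act (g : OGLq q) : OGLq q := tens_lift torus_act_bilinear (lambda g).

Lemma torus_act_linear : linear torus_act.
Proof. by move=> c u v; rewrite /torus_act lambdaD_linear tens_liftD tens_liftZ. Qed.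
HB.instance Definition _ :=
  GRing.isLinear.Build K (OGLq q) (OGLq q) _ torus_act torus_act_linear.

Lemma torus_actE th g : weight th g -> torus_act g = (torus_char th : K) *: g.
Proof. by rewrite /torus_act => ->; rewrite tens_liftE. Qed.

Lemma torus_char_tD i : torus_char (tD K i) = if i == 0 then u0 else u1.
Proof. exact: pres_homE. Qed.
Lemma torus_char_tDV i : torus_char (tDV K i) = (if i == 0 then u0 else u1)^-1.
Proof. exact: pres_homE. Qed.

Lemma torus_act_mono s t i j f m n :
  torus_act (mono s t i j f m n) =
  ((if s then u0 else u1) ^+ i * (if t then u0 else u1) ^+ j
   * ((u0 * u1) ^+ m * (u1^-1 * u0^-1) ^+ n)) *: mono s t i j f m n.
Proof.
pose th (r : bool) := if r then tD K 0 else tD K 1.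
rewrite (@torus_actE (th s ^+ i * th t ^+ j * 1
                      * ((tD K 0 * tD K 1) ^+ m * (tDV K 1 * tDV K 0) ^+ n))).
  rewrite mulr1 !rmorphM !rmorphXn !rmorphM /= !torus_char_tD !torus_char_tDV /=.
  by rewrite /th !(fun_if torus_char) !torus_char_tD.
do !apply: weightM; do ?apply: weightX.
- by rewrite /th; case: s; apply: weight_x.
- by rewrite /th; case: t; apply: weight_x.
- exact/weight_horner/weight_sphere_gen.
- exact: weight_det.
- exact: weight_detV.
Qed.

End Character.

Let xD := detV_central q_neq0.
Let xP := xG_qmatrix q.
Let detD := qdet_detV q.

Lemma GLq_span_monos g : span (sphere_monos q x D) g.
Proof.
elim/GLq_mulr_ind: g => [|c u v|u i j|u].
- by apply: span_gen; exists true, true, 0, 0, 1, 0, 0; rewrite /sphere_mono rmorph1 !mulr1.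
- exact: span_lin.
- elim=> [|v Sv|c v w _ IHv _ IHw]; first by rewrite mul0r; apply: span0.
    exact/span_gen/sphere_monos_x.
  by rewrite mulrDl -scalerAl; apply: span_lin.
- elim=> [|v Sv|c v w _ IHv _ IHw]; first by rewrite mul0r; apply: span0.
    exact/span_gen/sphere_monos_D.
  by rewrite mulrDl -scalerAl; apply: span_lin.
Qed.

Lemma OD_torus_act u0 u1 (u0_neq0 : u0 != 0) (u1_neq0 : u1 != 0) g :
  OD_GLq q_neq0 g -> torus_act u0_neq0 u1_neq0 g = g.
Proof. by move=> Og; rewrite (torus_actE _ _ (Og : weight 1 g)) rmorph1 scale1r. Qed.

Variable u : K.
Hypothesis u_free : injective (GRing.exp u).

Let u_neq0 : u != 0.
Proof. by apply/eqP=> u0; have := @u_free 1 2; rewrite u0 expr1 expr0n => /(_ erefl). Qed.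

Let u_weight (s t : bool) i j m n :
  (if s then u else 1) ^+ i * (if t then u else 1) ^+ j * (u ^+ m * u^-1 ^+ n) = 1 ->
  (s * i + t * j + m = n)%N.
Proof.
have uE (r : bool) : (if r then u else 1) = u ^+ r by case: r.
rewrite !uE -!exprM => e1; apply: u_free; rewrite !exprD -[RHS]mul1r -e1 -!mulrA.
by rewrite -exprMn mulVf // expr1n mulr1.
Qed.

(** Coinvariants are fixed at the points (u, 1) and (1, u). Two uses of [span_fixed] leave monomials
    of degree zero in each row: i = j = 0 if both letters lie in one row, and i = j otherwise. *)
Lemma OD_GLqE : OD_GLq q_neq0 = sphere x D.
Proof.
apply/seteqP; split; last exact: sphere_OD.
move=> g Og; have fix1 := OD_torus_act u_neq0 (oner_neq0 K) Og.
have fix2 := OD_torus_act (oner_neq0 K) u_neq0 Og.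
have mono_eigen v0 v1 (v0_neq0 : v0 != 0) (v1_neq0 : v1 != 0) h :
    sphere_monos q x D h -> exists e, torus_act v0_neq0 v1_neq0 h = e *: h.
  by move=> [s [t [i [j [f [m [n ->]]]]]]]; rewrite torus_act_mono; eexists.
have Sg := span_fixed (mono_eigen _ _ u_neq0 (oner_neq0 K)) (GLq_span_monos g) fix1.
have {}Sg := span_fixed _ Sg fix2.
have {Sg} := Sg (fun h Sh => mono_eigen _ _ (oner_neq0 K) u_neq0 h (proj1 Sh)).
apply: span_sub_span => _ [[[s [t [i [j [f [m [n ->]]]]]]] /= h1] h2].
have [->|h0] := eqVneq (mono s t i j f m n) 0; first exact: span0.
move: h1 h2; rewrite !torus_act_mono => h1 h2.
have cancel e : e *: mono s t i j f m n = mono s t i j f m n -> e = 1.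
  move/eqP; rewrite -subr_eq0 -{2}[mono _ _ _ _ _ _ _]scale1r -scalerBl scaler_eq0.
  by rewrite (negPf h0) orbF subr_eq0 => /eqP.
move/cancel: h1; move/cancel: h2 => {cancel h0}.
rewrite !invr1 !(mul1r, mulr1) => h2 /u_weight e1.
have {h2}/u_weight e2 : (if ~~ s then u else 1) ^+ i * (if ~~ t then u else 1) ^+ j
    * (u ^+ m * u^-1 ^+ n) = 1 by rewrite !if_neg.
case: s t e1 e2 => [] []; rewrite ?mul1n ?mul0n ?add0n => e1 e2.
- have [-> ->] : i = 0%N /\ j = 0%N by lia.
  by rewrite e2; apply: sphere_mono_z.
- have -> : j = i by lia.
  by rewrite -e1 addn0; apply: sphere_mono_p.
- have -> : j = i by lia.
  by rewrite -e2 addn0; apply: sphere_mono_r.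
- have [-> ->] : i = 0%N /\ j = 0%N by lia.
  by rewrite e1; apply: sphere_mono_z.
Qed.

End TorusCoinvariants.

(** * Linear independence in O(GL_q) *)

Section Transcendence.
Variables (K : fieldType) (q : K) (q_neq0 : q != 0).

Lemma horner_alg_sum (A : algType K) (y : A) (f : {poly K}) :
  horner_alg y f = \sum_(k < size f) f`_k *: y ^+ k.
Proof.
rewrite -{1}[f]coefK poly_def raddf_sum; apply: eq_bigr => k _ /=.
by rewrite horner_algZ rmorphXn /= horner_algX.
Qed.

Section ScalarBorel.
Variables (A : algType K) (a a' E : A).
Hypotheses (aa' : a * a' = 1) (a'a : a' * a = 1) (aE : a * E = q *: (E * a)).

(** Both off-diagonal entries are [E], so that x12 x21 becomes [E * E]; the last entry is solved
    from det = 1. *)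
Definition borel_qmatrix (i j : 'I_2) : A :=
  if i == 0 then (if j == 0 then a else E) else (if j == 0 then E else a' * (1 + q *: (E * E))).

Let Ea' : E * a' = q *: (a' * E).
Proof.
transitivity (a' * (a * E) * a'); first by rewrite mulrA a'a mul1r.
by rewrite aE -scalerAr -scalerAl -!mulrA aa' mulr1.
Qed.

Lemma borel_qmatrixP : is_qmatrix q borel_qmatrix.
Proof.
have Ed : E * (a' * (1 + q *: (E * E))) = q *: (a' * (1 + q *: (E * E)) * E).
  by rewrite mulrA Ea' -scalerAl !mulrDr !mulrDl !mulr1 -!scalerAr -!scalerAl !mulrA.
split; rewrite /borel_qmatrix /=; split=> //.
rewrite mulrA aa' mul1r.
have aEE : a * (E * E) = q ^+ 2 *: (E * E * a).
  by rewrite [LHS]mulrA aE -scalerAl -[E * a * E]mulrA aE -scalerAr scalerA -expr2 mulrA.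
have EEa := qcommV (expf_neq0 2 q_neq0) aEE.
rewrite -mulrA mulrDl mul1r -scalerAl EEa scalerA mulrDr a'a -scalerAr [a' * _]mulrA a'a mul1r.
by rewrite opprD addrACA subrr add0r -scalerBl; congr (_ *: _); field.
Qed.

Lemma qdet_borel : qdet q borel_qmatrix = 1.
Proof. by rewrite /qdet /borel_qmatrix /= mulrA aa' mul1r addrK. Qed.

End ScalarBorel.

Section Shift.
Variable n : nat.

Definition shift_mx : 'M[K]_n.+1 := \matrix_(i, j) (j == i.+1 :> nat)%:R.

Lemma shift_mxX k i j : (shift_mx ^+ k) i j = (j == (i + k)%N :> nat)%:R.
Proof.
elim: k j => [|k IHk] j; first by rewrite expr0 mxE addn0 eq_sym.
rewrite exprSr mxE; case: j => -[|j] lt_j.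
  rewrite big1 ?addnS // => l _.
  by rewrite [shift_mx _ _]mxE mulr0.
have lt_j' := ltnW lt_j.
rewrite (bigD1 (Ordinal lt_j')) //= big1 ?addr0 => [|l lj].
  by rewrite IHk [shift_mx _ _]mxE /= eqxx mulr1 addnS eqSS.
rewrite [shift_mx _ _]mxE /= eqSS.
case: eqP => [jl|_]; last by rewrite mulr0.
by case/eqP: lj; apply/val_inj.
Qed.

Definition qdiag_mx (l : K) : 'M[K]_n.+1 := diag_mx (\row_i l ^+ i).

Lemma qdiag_mxM l l' : l * l' = 1 -> qdiag_mx l * qdiag_mx l' = 1.
Proof.
move=> ll'; apply/matrixP=> i j.
rewrite [qdiag_mx l * _]mul_diag_mx !mxE; case: eqP => [->|_]; last by rewrite mulr0.
by rewrite -exprMn ll' expr1n.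
Qed.

Lemma qdiag_shift : qdiag_mx q^-1 * shift_mx = q *: (shift_mx * qdiag_mx q^-1).
Proof.
apply/matrixP=> i j; rewrite [qdiag_mx _ * _]mul_diag_mx [shift_mx * _]mul_mx_diag !mxE.
case: eqP => [->|_]; last by rewrite mulr0 mul0r mulr0.
by rewrite mulr1 mul1r exprS mulrA mulfV // mul1r.
Qed.

End Shift.

(** In the representation by [borel_qmatrix] z acts as the square of the shift [E], and distinct
    powers of [E] live on distinct diagonals. With [n] twice the size of [f], the entry (0, 2k) of
    f(z) is the [k]-th coefficient of [f]. *)
Lemma sphz_transcendental : injective (horner_alg (sphz (xG q) (detV q))).
Proof.
suff z_inj f : horner_alg (sphz (xG q) (detV q)) f = 0 -> f = 0.
  by move=> f g fg; apply/eqP; rewrite -subr_eq0; apply/eqP/z_inj; rewrite raddfB /= fg subrr.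
move=> fz; pose n := (size f).*2; pose E := shift_mx n.
have qq : q * q^-1 = 1 by rewrite mulfV.
have qq' : q^-1 * q = 1 by rewrite mulVf.
pose hM := Mq_hom (borel_qmatrixP (qdiag_mxM n qq') (qdiag_mxM n qq) (qdiag_shift n)).
have hM_det : hM (detM q) * 1 = 1.
  by rewrite mulr1 [hM _]Mq_hom_det; apply/qdet_borel/qdiag_mxM.
have hM_det' : 1 * hM (detM q) = 1 by rewrite mul1r -[LHS]mulr1.
pose h : {lrmorphism OGLq q -> 'M[K]_n.+1} := GLq_hom hM_det hM_det'.
have hz : h (sphz (xG q) (detV q)) = E * E.
  have hx i j : h (xG q i j) = borel_qmatrix (qdiag_mx n q^-1) (qdiag_mx n q) E i j.
    by rewrite [LHS]GLq_hom_iota [LHS]Mq_homE.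
  have hD : h (detV q) = 1 by apply: GLq_hom_detV.
  by rewrite /sphz !rmorphM /= !hx hD mulr1.
have hZX (l : K) y k : h (l *: y ^+ k) = l *: h y ^+ k.
  by rewrite -rmorphXn; apply: linearZ.
have : \sum_(k < size f) f`_k *: (E * E) ^+ k = 0.
  transitivity (h (horner_alg (sphz (xG q) (detV q)) f)); last by rewrite fz raddf0.
  rewrite horner_alg_sum raddf_sum; apply: eq_bigr => k _.
  by apply/esym; rewrite -hz; apply: hZX.
move/matrixP=> sum0; apply/polyP=> k; rewrite coef0.
have [lt_k|] := ltnP k (size f); last exact: nth_default.
have lt_kn : (k.*2 < n.+1)%N by rewrite ltnS leq_double ltnW.
have := sum0 0 (Ordinal lt_kn); rewrite summxE mxE (bigD1 (Ordinal lt_k)) //= big1 => [|l lk].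
  by rewrite mxE -expr2 -exprM shift_mxX /= add0n mul2n eqxx mulr1 addr0.
rewrite mxE -expr2 -exprM shift_mxX /= add0n mul2n.
case: eqP => [/double_inj kl|]; last by rewrite mulr0.
by case/eqP: lk; apply/val_inj.
Qed.

End Transcendence.

(** * Right torus weights of the lines *)

Section RightTorus.
Variables (K : fieldType) (q : K) (q_neq0 : q != 0) (v : K) (v_neq0 : v != 0).

Let vx (i j : 'I_2) : OGLq q := (if j == 0 then 1 else v) *: xG q i j.

Lemma rtorus_qmatrix : is_qmatrix q vx.
Proof.
have [[r1 r2 r3 r4] [r5 r6]] := xG_qmatrix q.
rewrite /is_qmatrix /vx /= !scale1r -!scalerAr -!scalerAl -scalerBr r1 r2 r3 r4 r6 r5.
by split; split=> //; rewrite !scalerA; congr (_ *: _); ring.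
Qed.

Let rM := Mq_hom rtorus_qmatrix.

Let rM_det : rM (detM q) = v *: iota (detM q).
Proof.
rewrite [LHS]Mq_hom_det /vx /= !scale1r -!scalerAr -!scalerAl -qdet_xG /qdet scalerBr.
by rewrite !scalerA mulrC.
Qed.

Let rM_detr : rM (detM q) * (v^-1 *: detV q) = 1.
Proof. by rewrite rM_det -scalerAr -scalerAl scalerA Defs.detMV mulVf // scale1r. Qed.
Let rM_detl : (v^-1 *: detV q) * rM (detM q) = 1.
Proof. by rewrite rM_det -scalerAr -scalerAl scalerA Defs.detVM mulfV // scale1r. Qed.

(** Right translation by diag(1, v). The factor v^-1 of [detV] shifts the column degrees 0, 1, 2 of
    x_0i x_1j to the weights -1, 0, 1 of p, z, r. *)
Definition rtorus : OGLq q -> OGLq q := GLq_hom rM_detr rM_detl.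
HB.instance Definition _ := GRing.RMorphism.on rtorus.
HB.instance Definition _ := GRing.Linear.on rtorus.

Lemma rtorus_x i j : rtorus (xG q i j) = (if j == 0 then 1 else v) *: xG q i j.
Proof. by rewrite [LHS]GLq_hom_iota [LHS]Mq_homE. Qed.

Lemma rtorus_detV : rtorus (detV q) = v^-1 *: detV q.
Proof. exact: GLq_hom_detV. Qed.

Let rtorus_gen k i j : (if i == 0 then 1 else v) * (if j == 0 then 1 else v) = k * v ->
  rtorus (xG q 0 i * xG q 1 j * detV q) = k *: (xG q 0 i * xG q 1 j * detV q).
Proof.
move=> kv; rewrite !rmorphM /= !rtorus_x rtorus_detV -!scalerAl -!scalerAr -!scalerAl.
by rewrite !scalerA [_ * (if j == 0 then _ else _)]mulrAC kv mulfK.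
Qed.

Let rtorusZX (l : K) y k : rtorus (l *: y ^+ k) = l *: rtorus y ^+ k.
Proof. by rewrite -rmorphXn; apply: linearZ. Qed.

Lemma rtorus_line i g : sphere_line (xG q) (detV q) i g -> rtorus g = v ^ i *: g.
Proof.
have rtorus_z f : rtorus (horner_alg (sphz (xG q) (detV q)) f) = horner_alg (sphz (xG q) (detV q)) f.
  have z_fix : rtorus (sphz (xG q) (detV q)) = sphz (xG q) (detV q).
    by rewrite [LHS](@rtorus_gen 1) ?scale1r //= mulrC.
  rewrite horner_alg_sum raddf_sum; apply: eq_bigr => k _.
  by rewrite -[in RHS]z_fix; apply: rtorusZX.
move=> [f ->]; rewrite rmorphM /= rtorus_z; case: i => m; rewrite rmorphXn /=.
  by rewrite [rtorus _](@rtorus_gen v) // exprZn -scalerAr.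
rewrite [rtorus _](@rtorus_gen v^-1) ?mulVf ?mul1r // exprZn -scalerAr.
by rewrite exprVn.
Qed.

End RightTorus.

Section LineIndependence.
Variables (K : fieldType) (q : K) (q_neq0 : q != 0).
Variables (u : K) (u_free : injective (GRing.exp u)).

Let u_neq0 : u != 0.
Proof. by apply/eqP=> u0; have := @u_free 1 2; rewrite u0 expr1 expr0n => /(_ erefl). Qed.

Let u_zfree : injective (exprz u).
Proof.
have u_pos m n : u ^+ m != u ^- n.+1.
  apply/eqP=> umn; suff /u_free : u ^+ (m + n.+1) = u ^+ 0 by rewrite addnS.
  by rewrite exprD umn mulVf // expf_neq0.
move=> [m|m] [n|n] uij; first by rewrite (u_free uij).
- by case/eqP: (u_pos m n).
- by case/eqP: (u_pos n m).
- by have [->] := u_free (invr_inj uij).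
Qed.

Lemma sphere_line_free (r : seq int) (g : int -> OGLq q) :
  uniq r -> (forall i, sphere_line (xG q) (detV q) i (g i)) ->
  \sum_(i <- r) g i = 0 -> {in r, forall i, g i = 0}.
Proof.
move=> r_uniq gP; apply: (@eigen_free _ _ (rtorus u_neq0) _ _ (exprz u)) => //.
  exact: in2W.
by move=> i; apply: rtorus_line.
Qed.

Let xD := detV_central q_neq0.
Let xP := xG_qmatrix q.
Let detD := qdet_detV q.

Let linear_neq0 (l : K) : 1 + l *: 'X != 0 :> {poly K}.
Proof.
apply/eqP=> /(congr1 (fun f => f.[0])); rewrite !hornerE ?mulr0 ?addr0 => /eqP.
by rewrite oner_eq0.
Qed.

Lemma sphere_r_inj f m :
  horner_alg (sphz (xG q) (detV q)) f * sphr (xG q) (detV q) ^+ m = 0 -> f = 0.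
Proof.
apply: (horner_alg_mulX_inj (sphz_transcendental q_neq0) _ (qcomm_rz q_neq0 xP xD) _
          (mul_rp q_neq0 xP xD detD)).
  by rewrite invr_neq0 // expf_neq0.
by rewrite mulf_neq0 ?polyX_eq0.
Qed.

Lemma sphere_p_inj f m :
  horner_alg (sphz (xG q) (detV q)) f * sphp (xG q) (detV q) ^+ m = 0 -> f = 0.
Proof.
apply: (horner_alg_mulX_inj (sphz_transcendental q_neq0) _ (qcomm_pz q_neq0 xP xD) _
          (mul_pr q_neq0 xP xD detD)).
  by rewrite expf_neq0.
by rewrite mulf_neq0 // scaler_eq0 negb_or expf_neq0 // polyX_eq0.
Qed.

End LineIndependence.

(** * Spanning O(M_q) modulo the ideal *)

Section CoordinateLines.
Variables (K : fieldType) (q : K) (q_neq0 : q != 0).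

Local Notation a := (xM q 0 0).
Local Notation b := (xM q 0 1).
Local Notation c := (xM q 1 0).
Local Notation d := (xM q 1 1).

Let ord := qmatrix_order q_neq0 (xM_qmatrix q).

(** Indexed so that beta maps it into the [sphere_line] of the same index. *)
Definition mline (i : int) : set (OMq q) :=
  [set u | exists f, u = (if i is Posz m then b ^+ m else c ^+ `|i|) * horner_alg a f].

Variables (t1 t2 : K) (J : set (OMq q)) (J_ideal : right_ideal J).
Hypothesis J1 : J (tau1 q - t1%:A).
Hypothesis J2 : J (tau2 q - t2%:A).

Let JM u v : J u -> J (u * v). Proof. by case: J_ideal => _ _; apply. Qed.
Let J0 : J 0. Proof. by case: J_ideal. Qed.
Let JB u v : J u -> J v -> J (u - v). Proof. by case: J_ideal => _ + _; apply. Qed.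
Let JZ k u : J u -> J (k *: u).
Proof. by move=> Ju; rewrite -[u]mulr1 scalerAr; apply: JM. Qed.
Definition mspan : set (OMq q) := span [set u | J u \/ exists i, mline i u].

(** [J] absorbs factors on the right only, so just the leftmost factor may be replaced by a
    congruent one. *)
Let mspan_mod u v y : J (u - v) -> mspan (v * y) -> mspan (u * y).
Proof.
move=> Juv Svy; rewrite -[u](subrK v) mulrDl; apply: spanD => //.
by apply: span_gen; left; apply: JM.
Qed.

Let mspan_b m f : mspan (b ^+ m * horner_alg a f).
Proof. by apply: span_gen; right; exists (Posz m), f. Qed.
Let mspan_c m f : mspan (c ^+ m * horner_alg a f).
Proof.
apply: span_gen; right; case: m => [|m]; first by exists 0, f.
by exists (Negz m), f.
Qed.

Let J_d : J (d - horner_alg a ((q ^+ 4 * t1)%:P - q ^+ 2 *: 'X)).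
Proof.
have -> : d - horner_alg a ((q ^+ 4 * t1)%:P - q ^+ 2 *: 'X) = q ^+ 4 *: (tau1 q - t1%:A).
  rewrite raddfB /= horner_algC horner_algZX /tau1 !(scalerBr, scalerDr, scalerA).
  rewrite mulfV ?expf_neq0 // scale1r (_ : q ^+ 4 * q ^- 2 = q ^+ 2); last by field.
  by rewrite opprB addrA [d + _]addrC.
exact: JZ.
Qed.

Let J_det : J (detM q - (q ^+ 6 * t2)%:A).
Proof.
have -> : detM q - (q ^+ 6 * t2)%:A = q ^+ 6 *: (tau2 q - t2%:A).
  by rewrite /tau2 scalerBr !scalerA mulfV ?expf_neq0 // scale1r.
exact: JZ.
Qed.

(** Modulo [J], [d] is affine in [a] and det is a scalar. Writing b c = q d a - q det, with [d] in
    front of [a], puts the factor to be replaced on the left. *)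
Let bc_poly : exists g, J (b * c - horner_alg a g).
Proof.
pose h := (q ^+ 4 * t1)%:P - q ^+ 2 *: 'X : {poly K}.
exists (q *: (h * 'X) - (q * (q ^+ 6 * t2))%:P).
have -> : b * c - horner_alg a (q *: (h * 'X) - (q * (q ^+ 6 * t2))%:P)
   = q *: ((d - horner_alg a h) * a) - q *: (detM q - (q ^+ 6 * t2)%:A).
  have -> : b * c = q *: (d * a) - q *: detM q.
    by rewrite /Defs.detM ord; LinSolve.linsolve K (OMq q); field.
  rewrite [horner_alg a (_ - _)]raddfB /= horner_algC horner_algZ rmorphM /= horner_algX mulrBl !scalerBr !scalerA.
  have abelian (x y z e : OMq q) : x - y - (z - e) = x - z - (y - e).
    by LinSolve.linsolve K (OMq q); ring.
  exact: abelian.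
apply: JB; apply: JZ => //; exact: JM.
Qed.

(** [w] and [w'] stand for [b] and [c] in either order. *)
Section Line.
Variables (w w' : OMq q).
Hypothesis aw : a * w = q *: (w * a).
Hypothesis aw' : a * w' = q *: (w' * a).
Hypothesis wd : w * d = q *: (d * w).
Hypothesis ww' : w * w' = b * c.
Hypothesis w_det : GRing.comm w (detM q).
Hypothesis w_bc : GRing.comm w (b * c).
Hypothesis w_mspan : forall m f, mspan (w ^+ m * horner_alg a f).
Hypothesis w'_mspan : forall f, mspan (w' * horner_alg a f).

Let awX m := qcommXr m aw.
Let a_bc : a * (b * c) = q ^+ 2 *: (b * c * a).
Proof.
rewrite mulrA (_ : a * b = q *: (b * a)); last by rewrite ord scalerA mulfV // scale1r.
rewrite -scalerAl -[b * a * c]mulrA (_ : a * c = q *: (c * a)); last by rewrite ord scalerA mulfV // scale1r.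
by rewrite -scalerAr scalerA mulrA.
Qed.

Lemma mspan_mula m f : mspan (w ^+ m * horner_alg a f * a).
Proof.
have -> : w ^+ m * horner_alg a f * a = w ^+ m * horner_alg a (f * 'X).
  by rewrite rmorphM /= horner_algX mulrA.
exact: w_mspan.
Qed.

Lemma mspan_mulw m f : mspan (w ^+ m * horner_alg a f * w).
Proof. by rewrite -mulrA (horner_alg_qcommr f aw) mulrA -exprSr. Qed.

Lemma mspan_bc m f : mspan (b * c * (w ^+ m * horner_alg a f)).
Proof.
have [g Jg] := bc_poly; apply: (mspan_mod Jg).
rewrite mulrA (horner_alg_qcommr g (awX m)) -mulrA -rmorphM.
exact: w_mspan.
Qed.

Lemma mspan_mulw' m f : mspan (w ^+ m * horner_alg a f * w').
Proof.
rewrite -mulrA (horner_alg_qcommr f aw') mulrA.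
case: m => [|m]; first by rewrite mul1r.
rewrite exprSr -[w ^+ m * w * w']mulrA ww' -(commrX m (commr_sym w_bc)) -mulrA.
exact: mspan_bc.
Qed.

(** [f] is split into a multiple of 'X and its constant term. In the constant part [d] passes
    [w ^+ m] to the left; in the other part a d = det + q b c, and det and b c can be carried to the
    left. *)
Lemma mspan_muld m f : mspan (w ^+ m * horner_alg a f * d).
Proof.
elim/poly_ind: f => [|f k _]; first by rewrite raddf0 mulr0 mul0r; apply: span0.
rewrite rmorphD rmorphM /= horner_algX horner_algC mulrDr mulrDl mulr_algr -scalerAl.
apply: spanD; last first.
  rewrite (qcommXl m wd); apply/spanZ/spanZ/(mspan_mod J_d).
  by rewrite (horner_alg_qcommr _ (awX m)); apply: w_mspan.
have -> : w ^+ m * (horner_alg a f * a) * d =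
    detM q * (w ^+ m * horner_alg a f)
    + q *: (b * c * (w ^+ m * horner_alg a (dilate (q ^+ 2) f))).
  have ad : a * d = detM q + q *: (b * c) by rewrite /Defs.detM subrK.
  have det_comm : GRing.comm (w ^+ m * horner_alg a f) (detM q).
    apply/commr_sym/commrM; first exact/commrX/commr_sym.
    exact/horner_alg_comm/commr_sym/(qdet_central q_neq0 (xM_qmatrix q)).
  rewrite [w ^+ m * (_ * a)]mulrA -[_ * a * d]mulrA ad mulrDr det_comm -scalerAr -[w ^+ m * _ * _]mulrA.
  by rewrite (horner_alg_qcommr _ a_bc) [w ^+ m * (_ * _)]mulrA -(commrX m (commr_sym w_bc)) -mulrA.
apply: spanD; last exact/spanZ/mspan_bc.
by apply: (mspan_mod J_det); rewrite mulr_algl; apply/spanZ/w_mspan.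
Qed.

End Line.

Lemma mspanT u : mspan u.
Proof.
have bc_cb : c * b = b * c by rewrite ord.
have ab : a * b = q *: (b * a) by rewrite ord scalerA mulfV // scale1r.
have ac : a * c = q *: (c * a) by rewrite ord scalerA mulfV // scale1r.
have bd : b * d = q *: (d * b) by rewrite ord scalerA mulfV // scale1r.
have cd : c * d = q *: (d * c) by rewrite ord scalerA mulfV // scale1r.
have b_bc : GRing.comm b (b * c) by rewrite /GRing.comm -mulrA bc_cb.
have c_bc : GRing.comm c (b * c) by rewrite /GRing.comm mulrA bc_cb.
have b_det : GRing.comm b (detM q) := qdet_central q_neq0 (xM_qmatrix q) 0 1.
have c_det : GRing.comm c (detM q) := qdet_central q_neq0 (xM_qmatrix q) 1 0.
elim/Mq_mulr_ind: u => [|||u i j].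
- by have := mspan_b 0 1; rewrite rmorph1 mulr1.
- exact: span0.
- exact: span_lin.
elim=> [|v [Jv|[n [f ->]]]|k v v' _ IHv _ IHv'].
- by rewrite mul0r; apply: span0.
- by apply: span_gen; left; apply: JM.
- have b1 f' : mspan (b * horner_alg a f') := mspan_b 1 f'.
  have c1 f' : mspan (c * horner_alg a f') := mspan_c 1 f'.
  case: n => m; elim/ord2P: i; elim/ord2P: j.
  + exact: mspan_mula.
  + exact: mspan_mulw.
  + exact: mspan_mulw'.
  + exact: mspan_muld.
  + exact: (mspan_mula mspan_c).
  + exact: (mspan_mulw' ac ab bc_cb c_bc mspan_c).
  + exact: (mspan_mulw ac mspan_c).
  + exact: (mspan_muld ac cd c_det c_bc mspan_c).
by rewrite mulrDl -scalerAl; apply: span_lin.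
Qed.

End CoordinateLines.

(** * The map beta *)

Section Triangular.
Variable K : fieldType.

(** [P] contains a polynomial of every degree, and subtracting multiples of these lowers the degree
    of [f]. *)
Lemma poly_span_ind (P : {poly K} -> Prop) :
  (forall c f g, P f -> P g -> P (c *: f + g)) -> P 1 ->
  (forall f, f != 0 -> P f -> exists2 g, P g & size g = (size f).+1) ->
  forall f, P f.
Proof.
move=> PL P1 PS; have P0 : P 0 by have := PL (-1) 1 1 P1 P1; rewrite scaleN1r addNr.
have top n : exists2 g, P g & size g = n.+1.
  elim: n => [|n [g Pg sg]]; first by exists 1; rewrite ?size_poly1.
  by rewrite -sg; apply: PS => //; rewrite -size_poly_gt0 sg.
move=> f; have [n] := ubnP (size f); elim: n f => // n IHn f; rewrite ltnS => sf.
have [->//|f0] := eqVneq f 0.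
have [g Pg sg] := top (size f).-1; rewrite prednK ?size_poly_gt0 // in sg.
have g0 : g != 0 by rewrite -size_poly_gt0 sg size_poly_gt0.
pose k := lead_coef f / lead_coef g.
rewrite -[f](subrK (k *: g)) addrC; apply: PL => //; apply: IHn.
apply: leq_trans sf; rewrite -(@prednK (size f)) ?size_poly_gt0 // ltnS.
apply/leq_sizeP => j; rewrite leq_eqVlt => /predU1P[<-|lt_j].
  by rewrite coefB coefZ -{2}sg -!lead_coefE /k divfK ?subrr // lead_coef_eq0.
rewrite prednK ?size_poly_gt0 // in lt_j.
by rewrite coefB coefZ !nth_default ?sg // mulr0 subrr.
Qed.

End Triangular.

Section RightIdeals.
Variables (A : pzRingType) (S : set A).

Lemma right_ideal_genP : right_ideal (right_ideal_gen S).
Proof.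
split=> [I [[]] //|u v Iu Iv I SI|u x Iu I SI].
  by have [[_ IB _] _] := SI; apply: IB (Iu I SI) (Iv I SI).
by have [[_ _ IM] _] := SI; apply: IM (Iu I SI).
Qed.

Lemma left_ideal_genP : left_ideal (left_ideal_gen S).
Proof.
split=> [I [[]] //|u v Iu Iv I SI|u x Iu I SI].
  by have [[_ IB _] _] := SI; apply: IB (Iu I SI) (Iv I SI).
by have [[_ _ IM] _] := SI; apply: IM (Iu I SI).
Qed.

Lemma sub_right_ideal_gen : S `<=` right_ideal_gen S.
Proof. by move=> s Ss I [_]; apply. Qed.

Lemma sub_left_ideal_gen : S `<=` left_ideal_gen S.
Proof. by move=> s Ss I [_]; apply. Qed.

Lemma right_ideal_gen_sub (I : set A) : right_ideal I -> S `<=` I -> right_ideal_gen S `<=` I.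
Proof. by move=> I_ideal SI u /(_ I); apply. Qed.

Lemma left_ideal_gen_sub (I : set A) : left_ideal I -> S `<=` I -> left_ideal_gen S `<=` I.
Proof. by move=> I_ideal SI u /(_ I); apply. Qed.

End RightIdeals.

Section BetaOrbit.
Variables (K : fieldType) (q : K) (q_neq0 : q != 0).
Variables (xi : 'M[K]_2) (xi_diag : is_diag_mx xi).
Hypothesis xi_gen : forall n, xi 0 0 * (q ^- 2) ^+ n != xi 1 1.

Local Notation beta_xi := (beta_orbit xi_diag q_neq0).
Local Notation a := (xM q 0 0).
Local Notation x := (xG q).
Local Notation D := (detV q).
Local Notation z := (sphz x D).
Local Notation J := (right_ideal_gen [set tau1 q - (ev xi_diag (tau1 q) : K)%:A;
                                          tau2 q - (ev xi_diag (tau2 q) : K)%:A]).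

Let xD := detV_central q_neq0.
Let xP := xG_qmatrix q.
Let detD := qdet_detV q.

Let beta0 : beta_xi 0 = 0. Proof. exact: raddf0. Qed.
Let betaD u v : beta_xi (u + v) = beta_xi u + beta_xi v. Proof. exact: raddfD. Qed.
Let betaB u v : beta_xi (u - v) = beta_xi u - beta_xi v. Proof. exact: raddfB. Qed.
Let betaZ k u : beta_xi (k *: u) = k *: beta_xi u. Proof. exact: linearZ. Qed.

Lemma coad_linear i j : linear (coad q x D xi i j).
Proof.
move=> k u v; rewrite /coad !sum2 !mulrDr !mulrDl !scalerDr addrACA.
by rewrite -!scalerAr -!scalerAl !scalerA ![k * _]mulrC.
Qed.

Lemma beta_orbit_a : beta_xi (xM q 0 0) = xi 0 0 *: (1 + q^-1 *: z) - (q^-1 * xi 1 1) *: z.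
Proof.
rewrite -[xM _ _ _]mul1r beta_orbitMx beta_orbit1 (coadE q xD) ?eqxx; last exact: commr1.
by rewrite !mulr1 (mul_daD q_neq0 xP detD).
Qed.

Lemma beta_orbit_d : beta_xi (xM q 1 1) = xi 1 1 *: (1 + q *: z) - (q * xi 0 0) *: z.
Proof.
rewrite -[xM _ _ _]mul1r beta_orbitMx beta_orbit1 (coadE q xD) /=; last exact: commr1.
by rewrite !mulr1 (mul_adD detD) (qmatrix_order q_neq0 xP).
Qed.

(** The z-terms of the images of x11 and x22 are q^-1 (xi11 - xi22) z and q (xi22 - xi11) z; they
    cancel for weights in the ratio 1 : q^-2, as in [tau1]. *)
Lemma beta_orbit_tau1 : beta_xi (tau1 q) = (ev xi_diag (tau1 q) : K)%:A.
Proof.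
have -> : ev xi_diag (tau1 q) = q ^- 2 * xi 0 0 + q ^- 4 * xi 1 1 :> K.
  by rewrite /tau1 raddfD /= !linearZ /= !ev_xE.
rewrite /tau1 betaD !betaZ beta_orbit_a beta_orbit_d scalerDl.
LinSolve.linsolve K (OGLq q); by field.
Qed.

Lemma beta_orbit_tau2 : beta_xi (tau2 q) = (ev xi_diag (tau2 q) : K)%:A.
Proof. by rewrite /tau2 betaZ [ev _ _]linearZ beta_orbit_det scalerA. Qed.

Lemma beta_orbit_kerM u v : beta_xi u = 0 -> beta_xi (u * v) = 0.
Proof.
elim/Mq_ind: v u => [i j u u0|u u0|k v w IHv IHw u u0|v w IHv IHw u u0].
- by rewrite beta_orbitMx u0 /coad sum2 !mulr0 !mul0r !scaler0 addr0.
- by rewrite mulr1.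
- by rewrite mulrDr -scalerAr beta_orbit_linear IHv // IHw // scaler0 addr0.
- by rewrite mulrA; apply/IHw/IHv.
Qed.

Lemma ideal_sub_ker : J `<=` [set h | beta_xi h = 0].
Proof.
apply: right_ideal_gen_sub => [|_ [->|->] /=].
- split=> /= [|u v u0 v0|u v]; first exact: beta0.
    by rewrite betaB u0 v0 subrr.
  exact: beta_orbit_kerM.
- by rewrite betaB [X in _ - X]betaZ beta_orbit1 beta_orbit_tau1 subrr.
- by rewrite betaB [X in _ - X]betaZ beta_orbit1 beta_orbit_tau2 subrr.
Qed.

(** The induction follows the Horner scheme: one more factor [a] raises both sizes by one. Equality
    of sizes is what makes beta injective on each line. *)
Lemma beta_orbit_line w e :
  (exists2 k, k != 0 & beta_xi w = k *: e) -> coad_raises q x D xi e ->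
  forall f, exists2 g, beta_xi (w * horner_alg a f) = horner_alg z g * e & size g = size f.
Proof.
move=> [k k0 wk] e_raises; elim/poly_ind => [|f l [g fg sg]].
  by exists 0; rewrite // !raddf0 mulr0 mul0r beta0.
have [g' gg' sg'] := e_raises g; exists (g' + (k * l)%:P).
  rewrite rmorphD rmorphM /= horner_algX horner_algC mulrDr mulr_algr mulrA.
  rewrite betaD betaZ beta_orbitMx fg gg' wk rmorphD /= horner_algC mulrDl.
  by rewrite mulr_algl scalerA mulrC.
have g0 : (g == 0) = (f == 0) by rewrite -!size_poly_eq0 sg.
rewrite size_MXaddC; have [f0|f0] := eqVneq f 0.
  move: sg'; rewrite g0 f0 eqxx sg f0 size_poly0 => /eqP; rewrite size_poly_eq0 => /eqP ->.
  by rewrite add0r size_polyC mulf_eq0 (negPf k0) /=; case: eqP.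
rewrite sg g0 f0 /= in sg'; rewrite size_polyDl ?sg' // size_polyC ltnS.
by apply: leq_trans (leq_b1 _) _; rewrite size_poly_gt0.
Qed.

Lemma beta_orbit_b m :
  exists2 k, k != 0 & beta_xi (xM q 0 1 ^+ m) = k *: sphr x D ^+ m.
Proof.
elim: m => [|m [k k0 IHm]]; first by exists 1; rewrite ?oner_neq0 // beta_orbit1 scale1r.
have [l l0 rl] := coad01_r q_neq0 xP xD xi_gen m.
exists (k * l); first exact: mulf_neq0.
rewrite exprSr beta_orbitMx IHm -[k *: _]addr0 coad_linear rl scalerA.
by rewrite [coad _ _ _ _ _ _ 0]/coad sum2 !(mulr0, mul0r, scaler0) !addr0.
Qed.

Lemma beta_orbit_c m :
  exists2 k, k != 0 & beta_xi (xM q 1 0 ^+ m) = k *: sphp x D ^+ m.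
Proof.
elim: m => [|m [k k0 IHm]]; first by exists 1; rewrite ?oner_neq0 // beta_orbit1 scale1r.
have [l l0 rl] := coad10_p q_neq0 xP xD xi_gen m.
exists (k * l); first exact: mulf_neq0.
rewrite exprSr beta_orbitMx IHm -[k *: _]addr0 coad_linear rl scalerA.
by rewrite [coad _ _ _ _ _ _ 0]/coad sum2 !(mulr0, mul0r, scaler0) !addr0.
Qed.

Let b_line m := beta_orbit_line (beta_orbit_b m) (coad_raises_r q_neq0 xP xD detD xi_gen m).
Let c_line m := beta_orbit_line (beta_orbit_c m) (coad_raises_p q_neq0 xP xD detD xi_gen m).

Lemma beta_orbit_mline i u : mline i u -> sphere_line x D i (beta_xi u).
Proof.
move=> [f ->]; case: i => m.
  by have [g -> _] := b_line m f; exists g.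
by have [g -> _] := c_line m.+1 f; exists g.
Qed.

Variables (u : K) (u_free : injective (GRing.exp u)).

Lemma beta_orbit_mline_inj i v : mline i v -> beta_xi v = 0 -> v = 0.
Proof.
move=> [f ->]; have f0 (g : {poly K}) : g = 0 -> size g = size f -> f = 0.
  by move=> -> /esym/eqP; rewrite size_poly0 size_poly_eq0 => /eqP.
case: i => m.
  have [g -> sg] := b_line m f => /(sphere_r_inj q_neq0)/f0/(_ sg) ->.
  by rewrite raddf0 mulr0.
have [g -> sg] := c_line m.+1 f => /(sphere_p_inj q_neq0)/f0/(_ sg) ->.
by rewrite raddf0 mulr0.
Qed.

Let Jtau1 : J (tau1 q - (ev xi_diag (tau1 q) : K)%:A).
Proof. by apply: sub_right_ideal_gen; left. Qed.
Let Jtau2 : J (tau2 q - (ev xi_diag (tau2 q) : K)%:A).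
Proof. by apply: sub_right_ideal_gen; right. Qed.

(** Modulo [J] an element of the kernel is a sum of vectors from distinct lines. Their images lie in
    independent lines, hence each image vanishes, and beta is injective on each line. *)
Lemma beta_orbit_ker : [set h | beta_xi h = 0] = J.
Proof.
apply/seteqP; split; last exact: ideal_sub_ker.
have [J0 JB JM] := right_ideal_genP [set tau1 q - (ev xi_diag (tau1 q) : K)%:A;
                                         tau2 q - (ev xi_diag (tau2 q) : K)%:A].
move=> h /= h0.
have [j [s [Jj Ss hE]]] : exists j s, [/\ J j, span [set v | exists i, mline i v] s & h = j + s].
  elim: (mspanT q_neq0 (right_ideal_genP _) Jtau1 Jtau2 h)
    => {h h0} [|v [Jv|mv]|k v w _ [j [s [Jj Ss ->]]] _ [j' [s' [Jj' Ss' ->]]]].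
  - by exists 0, 0; rewrite addr0; split=> //; apply: span0.
  - by exists v, 0; rewrite addr0; split=> //; apply: span0.
  - by exists 0, v; rewrite add0r; split=> //; apply: span_gen.
  exists (k *: j + j'), (k *: s + s'); rewrite scalerDr addrACA; split=> //.
    rewrite -[j']opprK -[- j']sub0r; apply: (JB) => //; last exact: JB.
    by rewrite -[j]mulr1 scalerAr; apply: JM.
  exact: span_lin.
have s0 : beta_xi s = 0.
  by have := ideal_sub_ker Jj; rewrite /= -[j](addrK s) -hE betaB h0 sub0r => /eqP; rewrite oppr_eq0 => /eqP.
have [i|i k v w [f ->] [g ->]|r [F [r_uniq mF sE]]] := span_bigcup _ _ Ss.
- by exists 0; rewrite raddf0 mulr0.
- by exists (k *: f + g); rewrite raddfD /= horner_algZ mulrDr -scalerAr.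
have sum0 : \sum_(i <- r) beta_xi (F i) = 0 by rewrite -raddf_sum -sE.
have F0 := sphere_line_free u_free r_uniq (fun i => beta_orbit_mline (mF i)) sum0.
rewrite hE sE big_seq big1 ?addr0 // => i ir.
exact: beta_orbit_mline_inj (mF i) (F0 i ir).
Qed.

Lemma beta_orbit_range : range beta_xi = sphere x D.
Proof.
apply/seteqP; split=> [_ [h _ <-]|].
  have JT := mspanT q_neq0 (right_ideal_genP _) Jtau1 Jtau2 h.
  apply: (span_linear (f := beta_xi) _ _ _ JT) => [|k v w|v [/ideal_sub_ker /= ->|[i mv]]].
  - exact: span0.
  - exact: span_lin.
  - exact: span0.
  - by apply: span_gen; exists i; apply: beta_orbit_mline.
apply: span_sub => [|k _ _ [v _ <-] [w _ <-]|_ [i [f ->]]].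
- by exists 0.
- by exists (k *: v + w); rewrite // betaD betaZ.
set e := (X in _ * X).
have [w [k k0 wE] e_raises] : exists2 w, exists2 k, k != 0 & beta_xi w = k *: e
    & coad_raises q x D xi e.
  rewrite /e; case: i {e} => m.
    exists (xM q 0 1 ^+ m); [exact: beta_orbit_b | exact: coad_raises_r].
  exists (xM q 1 0 ^+ m.+1); [exact: beta_orbit_c | exact: coad_raises_p].
(* The [f] with f(z) [e] in the range form a subspace; multiplying a preimage by x11 produces the
   next degree. *)
elim/poly_span_ind: f => [l f g [v _ vE] [v' _ v'E]||f f0 [v _ vE]].
- by exists (l *: v + v'); rewrite // betaD betaZ vE v'E raddfD /= horner_algZ mulrDl -scalerAl.
- by exists (k^-1 *: w); rewrite // betaZ wE scalerA mulVf // scale1r rmorph1 mul1r.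
have [g gE sg] := e_raises f; exists g; last by rewrite sg f0.
by exists (v * xM q 0 0); rewrite // beta_orbitMx vE gE.
Qed.

End BetaOrbit.

(** * Reduction of alpha to beta *)

Section AlphaOrbit.
Variables (K : fieldType) (q : K) (q_neq0 : q != 0).

Local Notation a := (xM q 0 0).
Local Notation b := (xM q 0 1).
Local Notation c := (xM q 1 0).
Local Notation d := (xM q 1 1).
Local Notation x := (xG q).
Local Notation D := (detV q).

Section Reversal.
Variables (l m n : K) (lmn : l * m = n ^+ 2).

(** These values extend to an algebra map into the opposite algebra because [l * m = n ^+ 2], which
    matches the two sides of the relation for x11 x22 - x22 x11. *)
Definition reversal_x (i j : 'I_2) : OMq q :=
  if i == j then (if i == 0 then l *: d else m *: a) else n *: xM q i j.

Lemma reversal_qmatrix : is_qmatrix q (reversal_x : 'I_2 -> 'I_2 -> (OMq q)^c).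
Proof.
pose s := reversal_x.
suff : [/\ s 0 1 * s 0 0 = q *: (s 0 0 * s 0 1),
           s 1 1 * s 1 0 = q *: (s 1 0 * s 1 1),
           s 1 0 * s 0 0 = q *: (s 0 0 * s 1 0) &
           s 1 1 * s 0 1 = q *: (s 0 1 * s 1 1)] /\
       (s 1 0 * s 0 1 = s 0 1 * s 1 0 /\
        s 1 1 * s 0 0 - s 0 0 * s 1 1 = (q - q^-1) *: (s 1 0 * s 0 1)) by [].
have [[r1 r2 r3 r4] [r5 r6]] := xM_qmatrix q.
rewrite /s /reversal_x /= -!scalerAl -!scalerAr r1 r2 r3 r4 -r5 !scalerA.
split; split=> //; do ?by congr (_ *: _); ring.
by rewrite [m * l]mulrC -scalerBr r6 lmn !scalerA mulrC.
Qed.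

Definition reversal : OMq q -> OMq q := Mq_hom reversal_qmatrix.

Lemma reversal_linear : linear reversal.
Proof. exact: (linearP (Mq_hom reversal_qmatrix)). Qed.
HB.instance Definition _ :=
  GRing.isLinear.Build K (OMq q) (OMq q) _ reversal reversal_linear.

Lemma reversal1 : reversal 1 = 1.
Proof. exact: (rmorph1 (Mq_hom reversal_qmatrix)). Qed.
Lemma reversalM u v : reversal (u * v) = reversal v * reversal u.
Proof. exact: (rmorphM (Mq_hom reversal_qmatrix)). Qed.
Lemma reversal_xE i j : reversal (xM q i j) = reversal_x i j.
Proof. exact: (Mq_homE reversal_qmatrix). Qed.

End Reversal.

Lemma reversalK l m n l' m' n' (e : l * m = n ^+ 2) (e' : l' * m' = n' ^+ 2) :
  l * m' = 1 -> l' * m = 1 -> n * n' = 1 -> cancel (reversal e) (reversal e').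
Proof.
move=> lm ml nn u; elim/Mq_ind: u => [i j||k u v uK vK|u v uK vK].
- rewrite !reversal_xE /reversal_x; elim/ord2P: i; elim/ord2P: j;
  by rewrite /= [reversal _ _]linearZ /= reversal_xE /reversal_x /= scalerA ?lm ?nn ?[m * _]mulrC ?ml scale1r.
- by rewrite !reversal1.
- by rewrite !reversal_linear uK vK.
- by rewrite !reversalM uK vK.
Qed.

(** The constants make [alpha_orbitMx] for [xi] agree entry by entry with [coad] for [twisted_xi];
    those of [psi_eq] give the inverse map. *)
Let phi_eq : q ^- 2 * 1 = (- q^-1) ^+ 2. Proof. by field. Qed.
Let psi_eq : 1 * q ^+ 2 = (- q) ^+ 2. Proof. by ring. Qed.

Local Notation phi := (reversal phi_eq).
Local Notation psi := (reversal psi_eq).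

Let phiK : cancel phi psi.
Proof. by apply: reversalK; rewrite ?mulVf ?mulr1 ?mulrNN ?mulVf ?expf_neq0. Qed.
Let psiK : cancel psi phi.
Proof. by apply: reversalK; rewrite ?mulVf ?mulr1 ?mulrNN ?mulfV ?expf_neq0. Qed.

Variables (xi : 'M[K]_2) (xi_diag : is_diag_mx xi).

Definition twisted_xi : 'M[K]_2 :=
  diag_mx (\row_j if j == 0 then xi 1 1 else q ^+ 2 * xi 0 0).

Lemma twisted_xi_diag : is_diag_mx twisted_xi.
Proof. exact: diag_mx_is_diag. Qed.

Lemma twisted_xiE : (twisted_xi 0 0 = xi 1 1) * (twisted_xi 1 1 = q ^+ 2 * xi 0 0).
Proof. by split; rewrite !mxE. Qed.

Local Notation alpha_xi := (alpha_orbit xi_diag q_neq0).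
Local Notation beta_xi' := (beta_orbit twisted_xi_diag q_neq0).

Lemma detV_comm g : GRing.comm D g.
Proof.
elim/GLq_ind: g => [i j|||k u v Du Dv|u v Du Dv] //.
- exact: detV_central.
- exact: commr1.
- by rewrite /GRing.comm mulrDr mulrDl -scalerAr -scalerAl Du Dv.
- exact: commrM.
Qed.

Lemma alpha_orbit_step h i j :
  alpha_xi h = beta_xi' (phi h) ->
  alpha_xi (xM q i j * h) = beta_xi' (phi (xM q i j * h)).
Proof.
move=> hE; rewrite reversalM reversal_xE alpha_orbitMx hE.
have betaZ k i' j' : beta_xi' (phi h * (k *: xM q i' j'))
    = k *: coad q x D twisted_xi i' j' (beta_xi' (phi h)).
  by rewrite -scalerAr [LHS]linearZ /= beta_orbitMx.
rewrite sum2; move: (beta_xi' (phi h)) betaZ => Z betaZ.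
elim/ord2P: i; elim/ord2P: j; rewrite /reversal_x /antipode_x /= betaZ;
  rewrite (coadE q (detV_central q_neq0)) ?twisted_xiE /= ?mulrN -?scalerAr ?mulrA;
  try exact: detV_comm; LinSolve.linsolve K (OGLq q); by field.
Qed.

Lemma alpha_orbitE h : alpha_xi h = beta_xi' (phi h).
Proof.
rewrite -[h]mulr1; have : alpha_xi 1 = beta_xi' (phi 1).
  by rewrite alpha_orbit1 reversal1 beta_orbit1.
move: (1 : OMq q); elim/Mq_ind: h => [i j v|v|k u v IHu IHv w wE|u v IHu IHv w wE].
- exact: alpha_orbit_step.
- by rewrite mul1r.
- rewrite mulrDl -scalerAl alpha_orbit_linear reversal_linear beta_orbit_linear.
  by rewrite IHu // IHv.
- by rewrite -mulrA; apply/IHu/IHv.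
Qed.

Hypothesis xi_gen : forall n, xi 1 1 * (q ^- 2) ^+ n != q ^+ 2 * xi 0 0.
Variables (u : K) (u_free : injective (GRing.exp u)).

Let xi_gen' n : twisted_xi 0 0 * (q ^- 2) ^+ n != twisted_xi 1 1.
Proof. by rewrite !twisted_xiE. Qed.

Lemma alpha_orbit_range : range alpha_xi = sphere x D.
Proof.
rewrite -(beta_orbit_range q_neq0 twisted_xi_diag xi_gen'); apply/seteqP; split=> _ [h _ <-].
  by exists (phi h); rewrite -?alpha_orbitE.
by exists (psi h); rewrite // alpha_orbitE psiK.
Qed.

Local Notation s1 := (ev xi_diag (sigma1 q) : K).
Local Notation s2 := (ev xi_diag (sigma2 q) : K).
Local Notation t1 := (ev twisted_xi_diag (tau1 q) : K).
Local Notation t2 := (ev twisted_xi_diag (tau2 q) : K).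

Let ev_det (zeta : 'M[K]_2) (zeta_diag : is_diag_mx zeta) :
  ev zeta_diag (detM q) = zeta 0 0 * zeta 1 1 :> K.
Proof.
by rewrite [LHS]Mq_hom_det !(xi_off zeta_diag) mul0r scaler0 subr0.
Qed.

(** [phi] sends x11 + x22 to x11 + q^-2 x22, which accounts for the different weights in [sigma1]
    and [tau1]. *)
Let phi_sigma1 : phi (sigma1 q - s1%:A) = q ^+ 2 *: (tau1 q - t1%:A).
Proof.
have -> : s1 = xi 0 0 + xi 1 1 by rewrite /sigma1 raddfD /= !ev_xE.
have -> : t1 = q ^- 2 * xi 1 1 + q ^- 4 * (q ^+ 2 * xi 0 0).
  by rewrite /tau1 raddfD /= ![X in X + _]linearZ ![X in _ + X]linearZ /= !ev_xE !twisted_xiE.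
have -> k : phi (sigma1 q - k%:A) = phi a + phi d - k%:A.
  by rewrite /sigma1 !raddfD /= raddfN /= linearZ /= reversal1.
rewrite !reversal_xE /reversal_x /= /tau1.
by LinSolve.linsolve K (OMq q); field.
Qed.

Let phi_sigma2 : phi (sigma2 q - s2%:A) = q ^+ 4 *: (tau2 q - t2%:A).
Proof.
have -> : s2 = xi 0 0 * xi 1 1 by apply: ev_det.
have -> : t2 = q ^- 6 * (xi 1 1 * (q ^+ 2 * xi 0 0)).
  by rewrite /tau2 linearZ /= ev_det !twisted_xiE.
have -> k : phi (sigma2 q - k%:A) = phi d * phi a - q *: (phi c * phi b) - k%:A.
  rewrite /sigma2 /Defs.detM raddfB /= [phi (k *: 1)]linearZ /= reversal1.
  by rewrite raddfB /= [phi (q *: _)]linearZ /= !reversalM.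
rewrite !reversal_xE /reversal_x /= /tau2 /Defs.detM !linE.
rewrite (qmatrix_order q_neq0 (xM_qmatrix q)).
by LinSolve.linsolve K (OMq q); field.
Qed.

Lemma alpha_orbit_ker :
  [set h | alpha_xi h = 0] = left_ideal_gen [set sigma1 q - s1%:A; sigma2 q - s2%:A].
Proof.
set L := left_ideal_gen _; have [L0 LB LM] : left_ideal L := left_ideal_genP _.
have := beta_orbit_ker q_neq0 twisted_xi_diag xi_gen' u_free.
set J := right_ideal_gen _ => ker_beta; have [J0 JB JM] : right_ideal J := right_ideal_genP _.
have LZ k v : L v -> L (k *: v) by move=> Lv; rewrite -[v]mul1r scalerAl; apply: LM.
have JZ k v : J v -> J (k *: v) by move=> Jv; rewrite -[v]mulr1 scalerAr; apply: JM.
apply/seteqP; split=> [h /= h0|].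
  have Jh : J (phi h) by rewrite -ker_beta /= -alpha_orbitE.
  rewrite -[h]phiK; apply: (right_ideal_gen_sub (I := [set v | L (psi v)]) _ _ Jh).
    split=> /= [|v w Lv Lw|v w Lv]; first by rewrite raddf0.
      by rewrite raddfB; apply: LB.
    by rewrite reversalM; apply: LM.
  have psi_gen v w k : k != 0 -> phi v = k *: w -> L v -> L (psi w).
    move=> k0 vw Lv; rewrite (_ : w = k^-1 *: phi v); last by rewrite vw scalerA mulVf // scale1r.
    by rewrite linearZ /= phiK; apply: LZ.
  move=> _ [->|->] /=.
    by apply: psi_gen phi_sigma1 _; rewrite ?expf_neq0 //; apply: sub_left_ideal_gen; left.
  by apply: psi_gen phi_sigma2 _; rewrite ?expf_neq0 //; apply: sub_left_ideal_gen; right.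
have alphaJ h : J (phi h) -> alpha_xi h = 0 by rewrite -ker_beta /= -alpha_orbitE.
apply: left_ideal_gen_sub => [|_ [->|->] /=].
- split=> /= [|v w v0 w0|v w v0]; first by rewrite raddf0.
    by rewrite raddfB /= v0 w0 subrr.
  apply: alphaJ; rewrite reversalM; apply: JM.
  by rewrite -ker_beta /= -alpha_orbitE.
- by apply: alphaJ; rewrite phi_sigma1; apply: JZ; apply: sub_right_ideal_gen; left.
- by apply: alphaJ; rewrite phi_sigma2; apply: JZ; apply: sub_right_ideal_gen; right.
Qed.

End AlphaOrbit.

(** * The coideal property *)

Section Coideal.
Variables (K : fieldType) (q : K) (q_neq0 : q != 0).

Local Notation x := (xG q).
Local Notation D := (detV q).
Local Notation Delta := (DeltaGL q_neq0).

(** Elements whose coproduct has first factors in [B] form a subalgebra, so x_0i x_1j D suffices.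
    Its coproduct is the sum of (x_0k x_1l D) ⊗ (x_ki x_lj D): the first factor again takes one
    entry from each row. *)
Lemma sphere_coideal :
  subalgebra (sphere x D) -> right_coideal_subalgebra q_neq0 (sphere x D).
Proof.
set B := sphere x D => B_subalg; split=> //; have [B1 BL BM] := B_subalg.
pose BG : set (OGLq q ⊗ OGLq q) := [set t | exists r : seq (OGLq q * OGLq q),
  (forall p, p \in r -> B p.1) /\ t = \sum_(p <- r) p.1 ⊗ p.2].
have BG_tens g h : B g -> BG (g ⊗ h).
  by move=> Bg; exists [:: (g, h)]; rewrite big_seq1; split=> // p; rewrite inE => /eqP ->.
have BGL k s t : BG s -> BG t -> BG (k *: s + t).
  move=> [r [Br ->]] [r' [Br' ->]]; exists ([seq (p.1, k *: p.2) | p <- r] ++ r'); split.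
    by move=> p; rewrite mem_cat => /orP[/mapP[p' /Br Bp' ->]|/Br'].
  rewrite big_cat big_map scaler_sumr; congr (_ + _).
  by apply: eq_bigr => p _; rewrite tensZr.
have BGD s t : BG s -> BG t -> BG (s + t) by move=> Bs; rewrite -[s]scale1r; apply: BGL.
have BGM s t : BG s -> BG t -> BG (s * t).
  move=> [r [Br ->]] [r' [Br' ->]].
  exists [seq (p.1 * p'.1, p.2 * p'.2) | p <- r, p' <- r']; split.
    by move=> p /allpairsP[[p1 p2] [/= /Br Bp1 /Br' Bp2 ->]]; apply: BM.
  rewrite big_allpairs_dep big_distrlr /=; apply: eq_bigr => p _; apply: eq_bigr => p' _.
  by rewrite tensM.
have Bgen i j : B (x 0 i * x 1 j * D).
  have Bz : B (x 0 1 * x 1 0 * D).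
    by have := sphere_line_r x D 'X 0; rewrite horner_algX mulr1.
  elim/ord2P: i; elim/ord2P: j.
  - by have := sphere_line_p x D 1 1; rewrite rmorph1 mul1r.
  - have -> : x 0 0 * x 1 1 * D = q *: (x 0 1 * x 1 0 * D) + 1.
      by rewrite addrC; apply: mul_adD (qdet_detV q).
    exact: BL.
  - exact: Bz.
  - by have := sphere_line_r x D 1 1; rewrite rmorph1 mul1r.
have DeltaL k g h : Delta (k *: g + h) = k *: Delta g + Delta h by exact: linearP.
apply: (subalgebra_sphere (B := [set g | BG (Delta g)])) => [|i j /=].
  split=> /= [|k g h|g h].
  - by rewrite rmorph1 -tens1; apply: BG_tens.
  - by rewrite DeltaL; apply: BGL.
  - by rewrite rmorphM; apply: BGM.
rewrite !rmorphM /= !DeltaGL_xE DeltaGL_detV !sum2 !mulrDl !mulrDr !mulrDl !tensM.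
by do !apply: (BGD); apply: (BG_tens).
Qed.

End Coideal.

(** * Genericity of xi as inequalities between its entries *)

Section TwistMatrix.
Variables (K : fieldType) (q : K) (q_neq0 : q != 0).
Variables (xi : 'M[K]_2) (xi_diag : is_diag_mx xi).

Local Notation Q := (diag_mx (\row_(j < 2) if j == 0 then q ^+ 2 else 1) : 'M[K]_2).

Lemma twist_mxX n : Q ^+ n = diag_mx (\row_(j < 2) if j == 0 then (q ^+ 2) ^+ n else 1).
Proof.
elim: n => [|n IHn].
  apply/matrixP=> i j; rewrite expr0 !mxE expr0.
  by elim/ord2P: i; elim/ord2P: j.
apply/matrixP=> i j; rewrite exprS IHn [_ * _]mul_diag_mx !mxE.
by elim/ord2P: i; elim/ord2P: j; rewrite ?(mulr0, mulr1n, mulr0n, mulr1) -?exprS.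
Qed.

Lemma twist_mx_unit : Q \is a GRing.unit.
Proof.
rewrite unitmxE det_diag unitfE big_ord_recl big_ord1 !mxE /=.
by rewrite mulr1 expf_neq0.
Qed.

Hypothesis hxi : forall (c : K) (k : int), xi <> c *: Q ^ k.

(** Equality would make [xi] the multiple by [xi 1 1] of the [n]-th power. *)
Lemma diag_generic n : xi 0 0 * (q ^- 2) ^+ n != xi 1 1.
Proof.
apply/eqP=> xiE; apply: (hxi (c := xi 1 1) (k := Posz n)).
rewrite -[_ ^ _]/(Q ^+ n) twist_mxX -xiE; apply/matrixP=> i j; rewrite !mxE.
elim/ord2P: i; elim/ord2P: j; rewrite /= ?mulr0n ?mulr1n ?mulr0 ?(xi_off xi_diag) //.
  by rewrite -mulrA -exprMn mulVf ?expf_neq0 // expr1n mulr1.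
by rewrite mulr1 xiE.
Qed.

(** The extra q^2, which comes from [twisted_xi], shifts the exponent: the excluded power is -(n+1),
    denoted by [Negz n]. *)
Lemma diag_generic_inv n : xi 1 1 * (q ^- 2) ^+ n != q ^+ 2 * xi 0 0.
Proof.
apply/eqP=> xiE; apply: (hxi (c := xi 1 1) (k := Negz n)).
have QU : Q ^+ n.+1 \is a GRing.unit by apply/unitrX/twist_mx_unit.
suff xiQ : xi * Q ^+ n.+1 = (xi 1 1)%:A.
  by rewrite -[_ ^ _]/(Q ^- n.+1) -[LHS](mulrK QU) xiQ mulr_algl.
rewrite twist_mxX; apply/matrixP=> i j; rewrite [_ * _]mul_mx_diag !mxE.
elim/ord2P: i; elim/ord2P: j; rewrite /= ?mulr0 ?mulr1 ?(xi_off xi_diag) ?mul0r //.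
rewrite exprS mulrA [xi 0 0 * _]mulrC -xiE -mulrA -exprMn mulVf ?expf_neq0 //.
by rewrite expr1n mulr1.
Qed.

End TwistMatrix.

Theorem theorem3p2 (R : realType) (q : R[i]) (q_neq0 : q != 0)
    (hq : (forall n : nat, (0 < n)%N -> ~~ n.-unity_root q) \/ q = 1)
    (xi : 'M[R[i]]_2) (xi_diag : is_diag_mx xi)
    (hxi : forall (c : R[i]) (k : int),
       xi <> c *: (diag_mx (\row_(j < 2) if j == 0 then q ^+ 2 else 1)) ^ k) :
  [/\ range (beta_orbit xi_diag q_neq0) = OD_GLq q_neq0,
      range (alpha_orbit xi_diag q_neq0) = OD_GLq q_neq0,
      range (beta_orbit xi_diag q_neq0) = range (alpha_orbit xi_diag q_neq0) &
      right_coideal_subalgebra q_neq0 (range (beta_orbit xi_diag q_neq0))] /\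
  [set h | beta_orbit xi_diag q_neq0 h = 0] =
    right_ideal_gen [set tau1 q - (ev xi_diag (tau1 q) : R[i])%:A;
                         tau2 q - (ev xi_diag (tau2 q) : R[i])%:A] /\
  [set h | alpha_orbit xi_diag q_neq0 h = 0] =
    left_ideal_gen [set sigma1 q - (ev xi_diag (sigma1 q) : R[i])%:A;
                        sigma2 q - (ev xi_diag (sigma2 q) : R[i])%:A].
Proof.
(* The tori are evaluated at 2, whose powers are distinct in characteristic zero. *)
have two_free : injective (GRing.exp (2 : R[i])).
  by move=> m n /eqP; rewrite -!natrX Num.Theory.eqr_nat eqn_exp2l // => /eqP.
have xi_gen := diag_generic q_neq0 xi_diag hxi.
have xi_gen' := diag_generic_inv q_neq0 xi_diag hxi.
have OD := OD_GLqE q_neq0 two_free.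
have beta_range := beta_orbit_range q_neq0 xi_diag xi_gen.
have alpha_range := alpha_orbit_range q_neq0 xi_diag xi_gen'.
split; last by split; [exact: beta_orbit_ker two_free | exact: alpha_orbit_ker two_free].
rewrite beta_range alpha_range OD; split=> //.
by apply: sphere_coideal; rewrite -OD; apply: OD_GLq_subalgebra.
Qed.
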